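(* Let $(A,\mu)$ be a Lie algebroid, $\pi$ a Poisson bivector and $\omega$ a closed $2$-form such that $N:=\pi^\sharp\circ\omega^\flat$ satisfies $N^2=\lambda\,\mathrm{id}_A$ for some $\lambda\in\mathbb R$. If the pair $(\pi,\omega)$ is a $P\Omega$ structure on $(A,\mu)$, then $j=\underline N$ is a Nijenhuis vector-valued form with respect to the $L_\infty$-algebra $(\Gamma(\wedge^\bullet A)[2],l_2)$, with square $k=-\lambda\,\mathcal E$, where $\mathcal E$ is the Euler map.
   Context: Big bracket. For a smooth vector bundle $A\to M$, let $\mathcal F=C^\infty(T^*[2]A[1])$ with the graded Poisson bracket $\{\cdot,\cdot\}$ (the big bracket) of the canonical symplectic structure of $T^*[2]A[1]$. In local coordinates $x_i,\xi_a$ on $A[1]$ and associated moment coordinates $p^i,\theta^a$ one has $\{p^i,x_i\}=\{\theta^a,\xi_a\}=1$ and all other brackets of coordinates vanish. The coordinates $x_i,\xi_a,p^i,\theta^a$ have bidegrees $(0,0),(0,1),(1,1),(1,0)$; $\mathcal F^{k,l}$ is the space of functions of bidegree $(k,l)$, $\mathcal F^{k,0}=\Gamma(\wedge^kA)$, $\mathcal F^{0,l}=\Gamma(\wedge^lA^* )$. The bracket has bidegree $(-1,-1)$ and, with $|F|$ the total degree, satisfies $\{F,G\}=-(-1)^{|F||G|}\{G,F\}$, $\{F,GH\}=\{F,G\}H+(-1)^{|F||G|}G\{F,H\}$, $\{F,\{G,H\}\}=\{\{F,G\},H\}+(-1)^{|F||G|}\{G,\{F,H\}\}$; on $\Gamma(A\oplus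 A^* )$ it is the canonical pairing. A Lie algebroid structure on $A$ is identified with $\mu\in\mathcal F^{1,2}$ such that $\{\mu,\mu\}=0$, with anchor $\rho(X)f=\{\{X,\mu\},f\}$ and bracket $[X,Y]=\{\{X,\mu\},Y\}$. $P\Omega$ structures. $\langle\pi^\sharp\alpha,\beta\rangle=\pi(\alpha,\beta)$, $\langle\omega^\flat X,Y\rangle=\omega(X,Y)$. A $P\Omega$ structure on $(A,\mu)$ is a pair $(\pi,\omega)$ where $\pi\in\Gamma(\wedge^2A)$ is a Poisson bivector (its Schouten–Nijenhuis square vanishes) and the $2$-forms $\omega$ and $\omega_N=\omega(N\cdot,\cdot)$ are closed for the Lie algebroid differential, with $N=\pi^\sharp\circ\omega^\flat$. Vector-valued forms. $L=\Gamma(\wedge^\bullet A)[2]=\bigoplus_{i\ge-2}L_i$, $L_i=\Gamma(\wedge^{i+2}A)$; $l_2(P,Q)=\{\{\mu,P\},Q\}$, which is the only nonzero bracket of the $L_\infty$-algebra $(L,l_2)$. $\underline N(f)=0$ for $f\in C^\infty(M)$ and $\underline N(P_1\wedge\dots\wedge P_p)=\sum_{i=1}^p(-1)^{i-1}N(P_i)\wedge\widehat{P_i}$ (factor $P_i$ omitted in $\widehat{P_i}$). Vector-valued $k$-forms are graded symmetric $k$-linear maps $L^k\to L$. For $K$ a $k$-form and $H$ an $h$-form, $\imath_KH(X_1,\dots,X_{k+h-1})=\sum_{\sigma\in Sh(k,h-1)}\epsilon(\sigma)H(K(X_{\sigma(1)},\dots,X_{\sigma(k)}),X_{\sigma(k+1)},\dots,X_{\sigma(k+h-1)})$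 (unshuffles, Koszul sign), $\imath_KH=0$ if $h=0$, and $[K,H]=\imath_KH-(-1)^{\bar K\bar H}\imath_HK$ with $\bar K$ the degree of $K$ as a graded map. A degree-zero symmetric vector-valued form $n$ is a Nijenhuis form with respect to $l$ with square $k$ ($k$ a vector-valued form of degree zero) if $[n,[n,l]]=[k,l]$ and $[n,k]=0$. The Euler map is $\mathcal E(P)=pP$ for $P\in L_p$. *)

(* Defs.v *)
From HB Require Import structures.
From mathcomp Require Import all_boot all_order all_algebra all_fingroup.
From mathcomp Require Import all_classical all_reals all_analysis.
From mathcomp Require Import -(notations) mpoly.
From mathcomp Require Import ring.

Set Implicit Arguments.
Unset Strict Implicit.
Unset Printing Implicit Defensive.
Import Order.TTheory GRing.Theory Num.Theory numFieldNormedType.Exports.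
Local Open Scope classical_set_scope.
Local Open Scope ring_scope.

Section Smooth.
Variables (R : realType) (n : nat).

Definition partial (k : 'I_n) (f : 'rV[R]_n -> R) : 'rV[R]_n -> R :=
  fun x => 'D_('e_k) f x.

Fixpoint classC (d : nat) (V : set 'rV[R]_n) (f : 'rV[R]_n -> R) : Prop :=
  (forall x, V x -> {for x, continuous f}) /\
  (if d is d'.+1 then
     forall k, (forall x, V x -> derivable f x 'e_k) /\ classC d' V (partial k f)
   else True).

(* Meaningful for V open. *)
Definition smooth (V : set 'rV[R]_n) (f : 'rV[R]_n -> R) : Prop :=
  forall d, classC d V f.

End Smooth.

(* The Grassmann algebra on t odd generators over K: u A is the coefficient of
   the product, in increasing order, of the generators indexed by A. *)
Section Grassmann.
Variables (K : comNzRingType) (t : nat).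

Definition grass : Type := {ffun {set 'I_t} -> K}.
HB.instance Definition _ := GRing.Zmodule.on grass.

(* Sign of the reordering of the B-monomial times the C-monomial. *)
Definition gsign (B C : {set 'I_t}) : K :=
  (-1) ^+ #|[pred bc : 'I_t * 'I_t |
              [&& bc.1 \in B, bc.2 \in C & (bc.2 < bc.1)%N]]|.

Definition gmul (u v : grass) : grass :=
  [ffun A : {set 'I_t} => \sum_(B : {set 'I_t} | B \subset A)
     gsign B (A :\: B) * (u B * v (A :\: B))].

Definition gscal (c : K) : grass :=
  [ffun A : {set 'I_t} => if A == finset.set0 then c else 0].

Definition ggen (a : 'I_t) : grass :=
  [ffun A : {set 'I_t} => (A == finset.set1 a)%:R].

(* gldv and grdv differentiate from the left and from the right. *)
Definition gldv (a : 'I_t) (u : grass) : grass :=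
  [ffun A : {set 'I_t} =>
     if a \in A then 0 else gsign (finset.set1 a) A * u (a |: A)%SET].

Definition grdv (a : 'I_t) (u : grass) : grass :=
  [ffun A : {set 'I_t} =>
     if a \in A then 0 else gsign A (finset.set1 a) * u (a |: A)%SET].

End Grassmann.
Arguments ggen {K t} a.
Arguments gscal {K t} c.

Section GrassmannTheory.
Import mathcomp.boot.finset.
Local Open Scope set_scope.
Variables (K : comNzRingType) (t : nat).
Implicit Types (A B : {set 'I_t}) (u v w : grass K t) (a b : 'I_t) (c : K).
Local Notation sgn := (@gsign K t).
Local Notation gscal := (@gscal K t).
Local Notation ggen := (@ggen K t).

Lemma gmulDl u v w : gmul (u + v) w = gmul u w + gmul v w.
Proof.
apply/ffunP=> A; rewrite !ffunE -big_split; apply: eq_bigr => B _ /=.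
by rewrite ffunE; ring.
Qed.

Lemma gmulDr u v w : gmul w (u + v) = gmul w u + gmul w v.
Proof.
apply/ffunP=> A; rewrite !ffunE -big_split; apply: eq_bigr => B _ /=.
by rewrite ffunE; ring.
Qed.

Lemma gmul0l u : gmul 0 u = 0.
Proof. by apply/ffunP=> A; rewrite !ffunE big1 // => B _; rewrite ffunE; ring. Qed.

Lemma gmul0r u : gmul u 0 = 0.
Proof. by apply/ffunP=> A; rewrite !ffunE big1 // => B _; rewrite ffunE; ring. Qed.

Lemma gmul_suml I (s : seq I) (P : pred I) (F : I -> grass K t) u :
  gmul (\sum_(i <- s | P i) F i) u = \sum_(i <- s | P i) gmul (F i) u.
Proof.
elim/big_rec2: _ => [|i x y _ <-]; first exact: gmul0l.
by rewrite gmulDl.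
Qed.

Lemma gmul_sumr I (s : seq I) (P : pred I) (F : I -> grass K t) u :
  gmul u (\sum_(i <- s | P i) F i) = \sum_(i <- s | P i) gmul u (F i).
Proof.
elim/big_rec2: _ => [|i x y _ <-]; first exact: gmul0r.
by rewrite gmulDr.
Qed.

Lemma gsign0 A : sgn set0 A = 1.
Proof.
rewrite /gsign (eq_card0 (A := [pred bc | _])) // => bc.
by rewrite !inE.
Qed.

Lemma gmul_scal c u : gmul (gscal c) u = [ffun A => c * u A].
Proof.
apply/ffunP=> A; rewrite !ffunE (bigD1 set0) ?sub0set //= ffunE eqxx setD0.
rewrite gsign0 mul1r big1 ?addr0 // => B /andP[_ /negPf h].
by rewrite ffunE h !mul0r mulr0.
Qed.

Lemma gmul_gen a u :
  gmul (ggen a) u =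
  [ffun A : {set 'I_t} => if a \in A then sgn [set a] (A :\ a) * u (A :\ a) else 0].
Proof.
apply/ffunP=> A; rewrite !ffunE; case: ifP => aA.
  rewrite (bigD1 [set a]) ?sub1set //= ffunE eqxx mul1r big1 ?addr0 //.
  by move=> B /andP[_ /negPf h]; rewrite ffunE h mulr0n mul0r mulr0.
rewrite big1 // => B sBA; rewrite ffunE; case: eqP => [e|_]; last by rewrite mulr0n mul0r mulr0.
by move: sBA; rewrite e sub1set aA.
Qed.

Lemma gsign1U a b A : b \notin A ->
  sgn [set a] (b |: A) = sgn [set a] [set b] * sgn [set a] A.
Proof.
move=> bA; rewrite /gsign -exprD; congr (_ ^+ _).
rewrite -cardUI [X in (_ + X)%N]eq_card0 ?addn0.
  by apply: eq_card => -[x y]; rewrite !inE /=; case: (x == a); case: (y == b); case: (y \in A); case: (y < x)%N.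
move=> [x y]; rewrite !inE /=; apply/negP.
by case/andP=> /and3P[_ /eqP-> _] /and3P[_ h _]; rewrite h in bA.
Qed.

Lemma gsign11 a b : sgn [set a] [set b] = (-1) ^+ (b < a)%N.
Proof.
rewrite /gsign; congr (_ ^+ _); case: ltnP => h.
  apply: (etrans _ (card1 (a, b))); apply: eq_card => -[x y]; rewrite !inE /= xpair_eqE.
  by case: eqP => //= ->; case: eqP => //= ->.
apply: eq_card0 => -[x y]; rewrite !inE /=.
by apply/negP => /and3P[/eqP-> /eqP->]; rewrite ltnNge h.
Qed.

Lemma gsign11N a b : a != b -> sgn [set a] [set b] = - sgn [set b] [set a].
Proof.
rewrite !gsign11; case: (ltngtP a b) => //= h; rewrite ?expr0 ?expr1 ?opprK //.
by move/ord_inj: h => ->; rewrite eqxx.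
Qed.

Lemma gsignK a A : sgn [set a] A * sgn [set a] A = 1.
Proof. by rewrite /gsign -exprD addnn -muln2 exprM sqrr_sign. Qed.

Lemma ggenAC a b u :
  gmul (ggen a) (gmul (ggen b) u) = - gmul (ggen b) (gmul (ggen a) u).
Proof.
apply/ffunP=> A; rewrite !gmul_gen !ffunE !inE.
case: (eqVneq a b) => [<-|nab]; rewrite ?eqxx /=.
  by case: ifP; rewrite ?mulr0 ?oppr0.

case aA: (a \in A); case bA: (b \in A); rewrite ?mulr0 ?oppr0 //.
have -> : A :\ a = b |: (A :\ a :\ b) by rewrite setD1K // !inE eq_sym nab bA.
have -> : A :\ b = a |: (A :\ b :\ a) by rewrite setD1K // !inE nab aA.
rewrite !setU1K ?inE ?eqxx // (_ : A :\ b :\ a = A :\ a :\ b); last first.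
  by apply/setP=> x; rewrite !inE; case: (x == a); case: (x == b).
rewrite !gsign1U ?inE ?eqxx ?andbF //.
by rewrite (gsign11N nab); ring.
Qed.

Lemma gldv_gen a b u :
  gldv a (gmul (ggen b) u) = (if a == b then u else 0) - gmul (ggen b) (gldv a u).
Proof.
apply/ffunP=> A; rewrite !gmul_gen !ffunE !inE.
case: (eqVneq a b) => [<-|nab]; rewrite ?eqxx /=.
  case aA: (a \in A); last by rewrite subr0 setU1K ?aA // mulrA gsignK mul1r.
  by rewrite setD1K // mulrA gsignK mul1r subrr.
have -> : (0 : grass K t) A = 0 by exact: (ffunE (fun=> 0) A).
case aA: (a \in A); case bA: (b \in A); rewrite ?mulr0 ?subr0 //.
rewrite sub0r.
have -> : (a |: A) :\ b = a |: (A :\ b).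
  apply/setP=> x; rewrite !inE; case: (eqVneq x a) => [->|]; rewrite ?nab //.
have aAb : a \notin A :\ b by rewrite !inE aA andbF.
have e : A = b |: (A :\ b) by rewrite setD1K.
rewrite [in sgn [set a] A]e !gsign1U ?inE ?eqxx ?aA ?andbF //.
rewrite (gsign11N nab); set s := sgn [set b] [set a].
have ss : s * s = 1 by exact: gsignK.
set p := sgn _ _; set q := sgn _ _; set v := u _.
by rewrite -[RHS]mul1r -ss; ring.
Qed.

Lemma gscal_genC c a u :
  gmul (gscal c) (gmul (ggen a) u) = gmul (ggen a) (gmul (gscal c) u).
Proof.
rewrite !gmul_scal !gmul_gen; apply/ffunP=> A; rewrite !ffunE.
by case: ifP => _; rewrite ?mulr0 //; ring.
Qed.

Lemma gldv_scal a c u : gldv a (gmul (gscal c) u) = gmul (gscal c) (gldv a u).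
Proof.
rewrite !gmul_scal; apply/ffunP=> A; rewrite !ffunE.
by case: ifP => _; rewrite ?mulr0 //; ring.
Qed.

Lemma gscalM c d u : gmul (gscal c) (gmul (gscal d) u) = gmul (gscal (c * d)) u.
Proof. by rewrite !gmul_scal; apply/ffunP=> A; rewrite !ffunE mulrA. Qed.

Lemma gmul_scall c u v : gmul (gmul (gscal c) u) v = gmul (gscal c) (gmul u v).
Proof.
rewrite !gmul_scal; apply/ffunP=> A; rewrite !ffunE mulr_sumr.
by apply: eq_bigr => B _; rewrite ffunE; ring.
Qed.

Lemma gmulNr u v : gmul u (- v) = - gmul u v.
Proof.
apply/ffunP=> A; rewrite !ffunE -sumrN; apply: eq_bigr => B _.
by rewrite ffunE; ring.
Qed.

Lemma gmul1l u : gmul (gscal 1) u = u.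
Proof. by rewrite gmul_scal; apply/ffunP=> A; rewrite ffunE mul1r. Qed.

Lemma gmul_scal0 u : gmul (gscal 0) u = 0.
Proof. by rewrite gmul_scal; apply/ffunP=> A; rewrite !ffunE mul0r. Qed.

Lemma gldvD a u v : gldv a (u + v) = gldv a u + gldv a v.
Proof.
apply/ffunP=> A; rewrite !ffunE; case: ifP => _; first by rewrite addr0.
by rewrite mulrDr.
Qed.

Lemma gldv0 a : gldv a (0 : grass K t) = 0.
Proof. by apply/ffunP=> A; rewrite !ffunE; case: ifP; rewrite ?mulr0. Qed.

Lemma gldv_cst a c : gldv a (gscal c) = 0.
Proof.
apply/ffunP=> A; rewrite !ffunE; case: ifP => // _.
rewrite ifN ?mulr0 //; apply/set0Pn; exists a; exact: setU11.
Qed.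

End GrassmannTheory.

Section Wedge.
Variables (K : comNzRingType) (r : nat).
Local Notation G := (grass K (r + r)).
Implicit Types (c d : 'rV[K]_r) (u : G) (a b : 'I_r).

Definition vec c : G :=
  \sum_(a < r) gmul (gscal (c 0 a)) (ggen (rshift r a)).

Fixpoint wedge (Ps : seq G) : G :=
  if Ps is P :: Qs then gmul P (wedge Qs) else gscal 1.

(* The left derivative of P_1 /\ ... /\ P_p along theta^a is the sum over i of
   (-1)^(i-1) P_i^a times the product of the other factors, which gives the
   formula of gunder_wedge. *)
Definition gunder (N : G -> G) u : G :=
  \sum_(a < r) gmul (N (ggen (rshift r a))) (gldv (rshift r a) u).

Lemma gmul_vec c u :
  gmul (vec c) u =
  \sum_(a < r) gmul (gscal (c 0 a)) (gmul (ggen (rshift r a)) u).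
Proof. by rewrite gmul_suml; apply: eq_bigr => a _; rewrite gmul_scall. Qed.

Lemma gmul_vecAC c d u :
  gmul (vec c) (gmul (vec d) u) = - gmul (vec d) (gmul (vec c) u).
Proof.
rewrite !gmul_vec -sumrN.
under eq_bigr => a _ do rewrite !gmul_sumr.
under [RHS]eq_bigr => a _ do rewrite !gmul_sumr -sumrN.
rewrite exchange_big; apply: eq_bigr => a _; apply: eq_bigr => b _.
by rewrite -!gscal_genC !gscalM ggenAC mulrC gmulNr.
Qed.

Lemma gldv_vec c a u :
  gldv (rshift r a) (gmul (vec c) u) =
  gmul (gscal (c 0 a)) u - gmul (vec c) (gldv (rshift r a) u).
Proof.
rewrite !gmul_vec (big_morph _ (gldvD (rshift r a)) (gldv0 _ _)).
under eq_bigr => b _ do rewrite gldv_scal gldv_gen gmulDr eq_rshift gmulNr.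
rewrite big_split /= -sumrN; congr (_ + _).
rewrite (bigD1 a) //= eqxx big1 ?addr0 // => b /negPf h.
by rewrite eq_sym h gmul0r.
Qed.

Lemma gen_vec a : ggen (rshift r a) = vec (delta_mx 0 a).
Proof.
rewrite /vec (bigD1 a) //= mxE !eqxx gmul1l big1 ?addr0 // => b /negPf h.
by rewrite mxE h andbF gmul_scal0.
Qed.

Lemma gunder_vec N (M : 'M[K]_r) c u : (forall d, N (vec d) = vec (d *m M)) ->
  gunder N (gmul (vec c) u) = gmul (N (vec c)) u + gmul (vec c) (gunder N u).
Proof.
move=> hN; rewrite /gunder.
under eq_bigr => a _ do rewrite gldv_vec gmulDr.
rewrite big_split /=; congr (_ + _).
  under eq_bigr => a _ do rewrite gen_vec hN gmul_vec.
  rewrite hN gmul_vec exchange_big; apply: eq_bigr => b _ /=.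
  under eq_bigr => a _ do rewrite -gscal_genC gscalM -rowE !mxE.
  rewrite mxE [in RHS]gmul_scal; apply/ffunP=> B; rewrite sum_ffunE !ffunE.
  rewrite mulr_suml; apply: eq_bigr => a _.
  by rewrite gmul_scal !ffunE; ring.
rewrite gmul_sumr; apply: eq_bigr => a _.
by rewrite gen_vec hN gmulNr gmul_vecAC opprK.
Qed.

Lemma gunder_cst N f : gunder N (gscal f) = 0.
Proof. by rewrite /gunder big1 // => a _; rewrite gldv_cst gmul0r. Qed.

Lemma gunder_wedge N (M : 'M[K]_r) (cs : seq 'rV[K]_r) :
  (forall d, N (vec d) = vec (d *m M)) ->
  gunder N (wedge (map vec cs)) =
    \sum_(i < size cs)
      gmul (gscal ((-1) ^+ i))
           (gmul (N (vec (nth 0 cs i)))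
                 (wedge (map vec (take i cs ++ drop i.+1 cs)))).
Proof.
move=> hN; elim: cs => [|c cs IH] /=; first by rewrite gunder_cst big_ord0.
rewrite big_ord_recl /= expr0 gmul1l drop0 (gunder_vec _ _ hN); congr (_ + _).
rewrite IH gmul_sumr; apply: eq_bigr => i _ /=.
have vecC (d : 'rV[K]_r) e u :
    gmul (vec d) (gmul (gscal e) u) = gmul (gscal e) (gmul (vec d) u).
  rewrite !gmul_vec gmul_sumr; apply: eq_bigr => a _.
  by rewrite -gscal_genC !gscalM mulrC.
have scalN e u : gmul (gscal (- e)) u = - gmul (gscal e) u.
  by rewrite -mulN1r -gscalM; apply/ffunP=> B; rewrite !gmul_scal !ffunE mulN1r.
by rewrite /bump /= add1n exprS mulN1r vecC hN gmul_vecAC gmulNr scalN.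
Qed.

End Wedge.

(* Functions on T*[2]A[1] over a chart of M trivialising A: polynomials in the
   moments p^1..p^n with coefficients functions of x in R^n, tensored with the
   Grassmann algebra on xi_1..xi_r (indices lshift) and theta^1..theta^r
   (indices rshift). *)
Section LocalSuperfunctions.
Variables (R : realType) (n r : nat).

Definition sfun : Type := grass (mpoly n ('rV[R]_n -> R)) (r + r).
HB.instance Definition _ := GRing.Zmodule.on sfun.

Definition pfun : Type := grass (mpoly n R) (r + r).
HB.instance Definition _ := GRing.Zmodule.on pfun.

Definition eval_at (x : 'rV[R]_n) (F : sfun) : pfun :=
  [ffun A => map_mpoly (fun f : 'rV[R]_n -> R => f x) (F A)].

Definition xi (a : 'I_r) : sfun := ggen (lshift r a).
Definition theta (a : 'I_r) : sfun := ggen (rshift r a).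
Definition mom (k : 'I_n) : sfun := gscal (mpolyX _ (mnm1 k)).
Definition fct (f : 'rV[R]_n -> R) : sfun := gscal (mpolyC n f).

Definition dmom (k : 'I_n) (F : sfun) : sfun := [ffun A => mderiv k (F A)].
Definition dpos (k : 'I_n) (F : sfun) : sfun :=
  [ffun A => map_mpoly (partial k) (F A)].

Definition sscale (c : R) (F : sfun) : sfun := gmul (fct (cst c)) F.

(* Big bracket: right derivatives of F times left derivatives of G, the signs
   being those of {p^k, x_k} = 1 = - {x_k, p^k} and
   {theta^a, xi_a} = {xi_a, theta^a} = 1. *)
Definition lbracket (F G : sfun) : sfun :=
  \sum_(k < n) (gmul (dmom k F) (dpos k G) - gmul (dpos k F) (dmom k G))
  + \sum_(a < r) (gmul (grdv (rshift r a) F) (gldv (lshift r a) G)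
                  + gmul (grdv (lshift r a) F) (gldv (rshift r a) G)).

Definition bidegree (k l : nat) (F : sfun) : Prop :=
  forall A m, mcoeff m (F A) != 0 ->
    (mdeg m + #|[pred a : 'I_r | rshift r a \in A]| = k)%N /\
    (mdeg m + #|[pred a : 'I_r | lshift r a \in A]| = l)%N.

(* Substitution of P k for p^k and T a for the odd generators. *)
Definition subst (P : 'I_n -> pfun) (T : 'I_(r + r) -> pfun) (u : pfun) : pfun :=
  \sum_(A : {set 'I_(r + r)}) \sum_(m <- msupp (u A))
    gmul (gscal (mpolyC n (mcoeff m (u A))))
      (gmul (\big[@gmul _ _/gscal 1]_(k < n) iter (m k) (gmul (P k)) (gscal 1))
            (\big[@gmul _ _/gscal 1]_(a <- enum A) T a)).

End LocalSuperfunctions.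
Arguments xi {R n r} a.
Arguments theta {R n r} a.
Arguments fct {R n r} f.

Section VectorBundle.
Variables (R : realType) (n r : nat).

(* Smooth vector bundles of rank r over smooth n-manifolds.  The charts of the
   base are taken small enough to trivialise the bundle. *)
Record vbundle := VBundle {
  base : topologicalType;
  total : topologicalType;
  proj : total -> base;
  atlas : Type;
  dom : atlas -> set base;
  chart : atlas -> base -> 'rV[R]_n;
  chartV : atlas -> 'rV[R]_n -> base;
  fib : atlas -> total -> 'rV[R]_r;
  fibV : atlas -> base -> 'rV[R]_r -> total;
  trans : atlas -> atlas -> 'rV[R]_n -> 'M[R]_r;
  overlap : atlas -> atlas -> set 'rV[R]_n :=
    fun i j => chart i @` (dom i `&` dom j);
  base_hausdorff : hausdorff_space base;
  base_countable : @second_countable base;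
  dom_open i : open (dom i);
  dom_cover b : exists i, dom i b;
  chart_open i : open (chart i @` dom i);
  chartK i b : dom i b -> chartV i (chart i b) = b;
  chart_cont i b : dom i b -> {for b, continuous (chart i)};
  chartV_cont i x : (chart i @` dom i) x -> {for x, continuous (chartV i)};
  chart_smooth i j k :
    smooth (overlap i j) (fun x => chart j (chartV i x) 0 k);
  proj_cont : continuous proj;
  fibK i e : dom i (proj e) -> fibV i (proj e) (fib i e) = e;
  proj_fibV i b v : dom i b -> proj (fibV i b v) = b;
  fibVK i b v : dom i b -> fib i (fibV i b v) = v;
  fib_cont i e : dom i (proj e) -> {for e, continuous (fib i)};
  fibV_cont i b v : dom i b ->
    {for (b, v), continuous (fun bv : base * 'rV[R]_r => fibV i bv.1 bv.2)};
  trans_fib i j e : dom i (proj e) -> dom j (proj e) ->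
    fib j e = fib i e *m trans i j (chart i (proj e));
  trans_smooth i j a b : smooth (overlap i j) (fun x => trans i j x a b)
}.

End VectorBundle.

Section BigBracket.
Variables (R : realType) (n r : nat) (A : vbundle R n r).

Definition cdom (i : atlas A) : set 'rV[R]_n := @chart _ _ _ A i @` dom i.

(* Transition i -> j of the coordinates of T*[2]A[1] over b: the values of
   xi, theta, p of chart i as expressions in those of chart j.  The formula for
   p^k is the moment of the vector field d/dx_k of chart i on A[1]. *)
Section Transition.
Variables (i j : atlas A) (b : base A).

Definition new_xi (a : 'I_r) : pfun R n r :=
  \sum_(c < r) gmul (gscal (mpolyC n (trans j i (chart j b) c a)))
                    (ggen (lshift r c)).

Definition new_theta (a : 'I_r) : pfun R n r :=
  \sum_(c < r) gmul (gscal (mpolyC n (trans i j (chart i b) a c)))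
                    (ggen (rshift r c)).

Definition new_odd (a : 'I_(r + r)) : pfun R n r :=
  match fintype.split a with inl c => new_xi c | inr c => new_theta c end.

Definition new_mom (k : 'I_n) : pfun R n r :=
  \sum_(l < n)
    gmul (gscal (mpolyC n
            (partial k (fun x => chart j (chartV i x) 0 l) (chart i b))))
         (gscal (mpolyX _ (mnm1 l)))
  + \sum_(a < r) \sum_(c < r)
      gmul (gscal (mpolyC n (partial k (fun x => trans i j x a c) (chart i b))))
           (gmul (new_xi a) (ggen (rshift r c))).

End Transition.

(* A function on T*[2]A[1] is given by its expressions in all charts; these are
   extended by 0 outside the image of the chart, so that equality of functions
   is equality of families. *)
Definition superfun : Type := atlas A -> sfun R n r.
HB.instance Definition _ := GRing.Zmodule.on superfun.

Definition in_F (k l : nat) (F : superfun) : Prop :=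
  (forall i, [/\ bidegree k l (F i),
     forall B m, smooth (cdom i) (mcoeff m (F i B))
     & forall x, ~ cdom i x -> eval_at x (F i) = 0]) /\
  (forall i j b, dom i b -> dom j b ->
     eval_at (chart j b) (F j) =
       subst (@new_mom i j b) (@new_odd i j b) (eval_at (chart i b) (F i))).

Definition bracket (F G : superfun) : superfun := fun i => lbracket (F i) (G i).

Definition lie_algebroid (mu : superfun) : Prop :=
  in_F 1 2 mu /\ bracket mu mu = 0.

Definition schouten (mu P Q : superfun) : superfun := bracket (bracket P mu) Q.

Definition poisson (mu pi : superfun) : Prop :=
  in_F 2 0 pi /\ schouten mu pi pi = 0.

(* The Lie algebroid differential is {mu, .} on forms. *)
Definition closed_form (mu omega : superfun) : Prop := bracket mu omega = 0.

(* Evaluation of bivectors and 2-forms on local sections over a chart. *)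
Definition eval2 (w u v : sfun R n r) : sfun R n r := lbracket (lbracket u w) v.

(* <pi# alpha, beta> = pi(alpha, beta) and <omega^b X, Y> = omega(X, Y), the
   pairing of A and A* being the bracket. *)
Definition sharp (pi alpha : sfun R n r) : sfun R n r := lbracket alpha pi.
Definition flat (omega X : sfun R n r) : sfun R n r := lbracket X omega.

Definition Nmap (pi omega : superfun) (i : atlas A) (X : sfun R n r) :
    sfun R n r :=
  sharp (pi i) (flat (omega i) X).

Definition local_section (i : atlas A) (X : sfun R n r) : Prop :=
  bidegree 1 0 X /\ forall B m, smooth (cdom i) (mcoeff m (X B)).

Definition square_scalar (N : atlas A -> sfun R n r -> sfun R n r)
    (lambda : R) : Prop :=
  forall i X, local_section i X -> forall x, cdom i x ->
    eval_at x (N i (N i X)) = eval_at x (sscale lambda X).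

(* omega_N = sum over a < b of omega(N theta^a, theta^b) xi_a xi_b *)
Definition omegaN (pi omega : superfun) : superfun := fun i =>
  \sum_(a < r) \sum_(b < r | (a < b)%N)
    gmul (eval2 (omega i) (Nmap pi omega i (theta a)) (theta b))
         (gmul (xi a) (xi b)).

Definition POmega (mu pi omega : superfun) : Prop :=
  [/\ poisson mu pi, in_F 0 2 omega, closed_form mu omega
    & closed_form mu (omegaN pi omega)].

Definition scale (c : R) (F : superfun) : superfun := fun i => sscale c (F i).

(* L_d = sections of the (d+2)-nd exterior power of A. *)
Definition in_L (d : int) (P : superfun) : Prop :=
  if (d + 2)%R is Posz k then in_F k 0 P else P = 0.

End BigBracket.

(* Vector-valued forms on a graded vector space L = (+)_d L_d, where the L_d are
   subspaces of V.  A form is given on tuples of homogeneous elements, an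
   element x of L_d being passed as (d, x). *)
Section VectorValuedForms.
Variables (R : realType) (V : zmodType) (sc : R -> V -> V).
Variable L : int -> V -> Prop.

Record vform := VForm {
  arity : nat;
  degree : int;
  app :> seq (int * V) -> V
}.

Definition homogeneous (xs : seq (int * V)) : Prop :=
  forall x, x \in xs -> L x.1 x.2.

Definition permute (k : nat) (s : 'S_k) (xs : seq (int * V)) : seq (int * V) :=
  [seq nth (0, 0) xs (s i) | i <- enum 'I_k].

Definition odd_at (xs : seq (int * V)) (i : nat) : bool :=
  let x := nth (0, 0) xs i in odd `|x.1|%N.

Definition koszul (k : nat) (s : 'S_k) (xs : seq (int * V)) : int :=
  (-1) ^+ #|[pred ij : 'I_k * 'I_k |
     [&& (ij.1 < ij.2)%N, (s ij.2 < s ij.1)%N,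
         odd_at xs (s ij.1) & odd_at xs (s ij.2)]]|.

Definition unshuffle (k l : nat) (s : 'S_(k + l)) : bool :=
  [forall i : 'I_(k + l), forall j : 'I_(k + l),
     ((i < j) && ((j < k) || (k <= i)))%N ==> (s i < s j)%N].

Definition is_vform (K : vform) : Prop :=
  [/\ forall xs, size xs = arity K -> homogeneous xs ->
        L (degree K + \sum_(x <- xs) x.1) (K xs),
      forall xs (s : 'S_(arity K)), size xs = arity K -> homogeneous xs ->
        K xs = K (permute s xs) *~ koszul s xs
    & forall xs ys d x y c, (size xs + size ys).+1 = arity K ->
        homogeneous xs -> homogeneous ys -> L d x -> L d y ->
        K (xs ++ (d, sc c x + y) :: ys)
          = sc c (K (xs ++ (d, x) :: ys)) + K (xs ++ (d, y) :: ys)].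

Definition insertion (K H : vform) (xs : seq (int * V)) : V :=
  if arity H is h.+1 then
    \sum_(s : 'S_(arity K + h) | unshuffle s)
      (let ys := permute s xs in
       H ((degree K + \sum_(y <- take (arity K) ys) y.1, K (take (arity K) ys))
          :: drop (arity K) ys)) *~ koszul s xs
  else 0.

Definition vbracket (K H : vform) : vform :=
  VForm (arity K + arity H).-1 (degree K + degree H)
    (fun xs => insertion K H xs
               - insertion H K xs *~ ((-1) ^+ absz (degree K * degree H))).

Definition vform_eq (K H : vform) : Prop :=
  [/\ arity K = arity H, degree K = degree H
    & forall xs, size xs = arity K -> homogeneous xs -> K xs = H xs].

Definition vform_null (K : vform) : Prop :=
  forall xs, size xs = arity K -> homogeneous xs -> K xs = 0.

Definition nijenhuis (l n k : vform) : Prop :=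
  [/\ is_vform n /\ degree n = 0, is_vform k /\ degree k = 0,
      vform_eq (vbracket n (vbracket n l)) (vbracket k l)
    & vform_null (vbracket n k)].

Definition vscale (c : R) (K : vform) : vform :=
  VForm (arity K) (degree K) (fun xs => sc c (K xs)).

Definition euler : vform :=
  VForm 1 0 (fun xs => if xs is [:: (d, P)] then P *~ d else 0).

End VectorValuedForms.
Arguments euler {V}.

Section Forms.
Variables (R : realType) (n r : nat) (A : vbundle R n r).

Definition l2 (mu : superfun A) : vform (superfun A) :=
  VForm 2 1 (fun xs =>
    if xs is [:: P; Q] then bracket (bracket mu P.2) Q.2 else 0).

Definition underline (N : atlas A -> sfun R n r -> sfun R n r) :
    vform (superfun A) :=
  VForm 1 0 (fun xs =>
    if xs is [:: P] then (fun i => gunder (N i) (P.2 i)) else 0).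

End Forms.

(* Main.v *)
Require Import Defs.
From HB Require Import structures.
From mathcomp Require Import all_boot all_order all_algebra all_fingroup.
From mathcomp Require Import all_classical all_reals all_analysis.
From mathcomp Require Import -(notations) mpoly.
From mathcomp Require Import zify ring.

Set Implicit Arguments.
Unset Strict Implicit.
Unset Printing Implicit Defensive.
Import Order.TTheory GRing.Theory Num.Theory numFieldNormedType.Exports.
Local Open Scope ring_scope.

(** A function on T*[2]A[1] acts on the others by its bracket, and the bivector
    and the 2-form combine into one even function h = {pi, omega}, quadratic in
    the odd coordinates and free of momenta.  On vector fields {h, .} is N, and
    since {h, .} is a derivation of the product, on multivector fields it is the
    extension of N by derivation ([gunder_bra]).

    The binary bracket of P and Q is the derived bracket {{mu, P}, Q}.  By the
    Jacobi identity ([jacobi]) and the graded symmetry of derived brackets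
    ([derived_sym]), bracketing the extension of N with the derived bracket of
    any nu gives minus the derived bracket of {h, nu} ([derived_vbracket],
    [nij_derived]).  Doing so twice, the square of the theorem is the derived
    bracket of {h, {h, mu}}.  On the other side, the binary bracket has degree
    one, so the Euler map contributes the factor -1 and the expected square is
    lambda times the derived bracket of mu ([kform_derived]).  Everything
    therefore comes down to {h, {h, mu}} = lambda mu ([h_square_mu]).

    Write e = pi and f = omega.  That pi is Poisson means {e, {e, mu}} = 0, that
    omega is closed means {f, mu} = 0, and since {h, f} = -2 omega_N
    ([bra_h_f]), that omega_N is closed means {{h, f}, mu} = 0 ([closed_omN]).
    The Jacobi identity then gives in turn {h, mu} = -{f, {e, mu}},
    {f, {h, mu}} = 0, {h, {e, mu}} = -{e, {h, mu}}, and
    {{{h, e}, f}, mu} = 2 {f, {e, {h, mu}}} = -2 {h, {h, mu}}.  The function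
    {{h, e}, f} is quadratic in the odd coordinates and acts on vectors as 2 N^2
    and on covectors as minus twice its transpose; as N^2 = lambda, it is
    2 lambda times the function that counts theta minus xi ([u_grading]), which
    acts on mu, of bidegree (1, 2), as -1.

    This algebra is carried out in one chart, for coefficients with abstract
    derivations.  Smooth functions are multiplied by the indicator function of
    the chart domain, which makes partial derivatives genuine derivations of a
    ring of total functions.  The symmetry of second partial derivatives is
    avoided: it would be used only by terms containing momentum derivatives of
    both arguments of a bracket, and there is always one argument that is free
    of momenta.  Charts are compared only to see that the extension of N maps
    multivector fields to multivector fields ([in_F_nij]), which holds because a
    change of chart acts on functions free of momenta by an algebra morphism
    preserving the pairing of theta with xi ([gmorph_obra], [jac_symplectic]). *)

(** * The Grassmann algebra as a ring *)
Section GrassmannAlgebra.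
Import mathcomp.boot.fintype mathcomp.boot.finset.
Local Open Scope set_scope.
Variables (K : comNzRingType) (t : nat).
Implicit Types (A B C D : {set 'I_t}) (u v w : grass K t) (a b : 'I_t) (c : K).
Local Notation sgn := (@gsign K t).

(** Writing the sign as a product over pairs makes it multiplicative in each of
    its two sets, which is all that associativity uses. *)
Lemma gsign_prod B C :
  sgn B C = \prod_(b in B) \prod_(c in C) (-1) ^+ (c < b)%N.
Proof.
rewrite /gsign pair_big_dep /= -prodr_const big_mkcond [RHS]big_mkcond.
apply: eq_bigr => -[b c] _ /=; rewrite !inE /=.
by case: (b \in B); case: (c \in C); case: (c < b)%N.
Qed.

Lemma gsignUl B C D : [disjoint B & C] -> sgn (B :|: C) D = sgn B D * sgn C D.
Proof.
move=> BC; rewrite !gsign_prod -bigU //=; apply: eq_bigl => x.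
by rewrite !inE.
Qed.

Lemma gsignUr B C D : [disjoint C & D] -> sgn B (C :|: D) = sgn B C * sgn B D.
Proof.
move=> CD; rewrite !gsign_prod -big_split; apply: eq_bigr => b _.
by rewrite -bigU //=; apply: eq_bigl => x; rewrite !inE.
Qed.

Lemma gsignC B C : [disjoint B & C] ->
  sgn B C = (-1) ^+ (#|B| * #|C|) * sgn C B.
Proof.
move=> BC; rewrite !gsign_prod [X in _ * X]exchange_big /=.
have -> : (-1) ^+ (#|B| * #|C|) = \prod_(b in B) \prod_(c in C) (-1) :> K.
  by under eq_bigr do rewrite prodr_const; rewrite prodr_const -exprM mulnC.
rewrite -big_split /=; apply: eq_bigr => b bB.
rewrite -big_split /=; apply: eq_bigr => c cC.
case: (ltngtP b c) => //= [_|_|/ord_inj e]; rewrite ?expr0 ?expr1 ?mulr1 ?mulrNN ?mulr1 //.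
by have := disjointFr BC bB; rewrite e cC.
Qed.

Lemma gmulE u v A :
  gmul u v A = \sum_(B : {set 'I_t} | B \subset A) sgn B (A :\: B) * (u B * v (A :\: B)).
Proof. exact: ffunE. Qed.

Lemma gmul_assoc : associative (@gmul K t).
Proof.
move=> u v w; apply/ffunP=> A; rewrite !gmulE.
pose F B D := sgn B (A :\: B) * (sgn D (A :\: B :\: D) *
                (u B * v D * w (A :\: B :\: D))).
transitivity (\sum_(B : {set 'I_t} | B \subset A) \sum_(D : {set 'I_t} | D \subset A :\:
  B) F B D).
  apply: eq_bigr => B _; rewrite gmulE !mulr_sumr; apply: eq_bigr => D _.
  by rewrite /F; ring.
transitivity (\sum_(B : {set 'I_t} | B \subset A) \sum_(E : {set 'I_t} | (B \subset E)
  && (E \subset A))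
    F B (E :\: B)).
  apply: eq_bigr => B sBA.
  rewrite (reindex_onto (fun E : {set 'I_t} => E :\: B) (fun D => B :|: D)) /=; last first.
    move=> D sDB; rewrite setDUl setDv set0U; apply/setDidPl.
    by rewrite disjoints_subset (subset_trans sDB) ?subsetDr.
  apply: eq_bigl => E; apply/andP/andP => [[sEB /eqP <-]|[sBE sEA]].
    by rewrite subsetUl subUset sBA /= (subset_trans sEB) ?subsetDl.
  rewrite setDSS ?subxx //; split=> //; apply/eqP.
  by apply/setP=> x; rewrite !inE; case xB: (x \in B) => //=; rewrite (subsetP sBE).
rewrite (exchange_big_dep (fun E : {set 'I_t} => E \subset A)) /=;
  last by move=> B E _ /andP[].
apply: eq_bigr => E sEA; rewrite gmulE mulr_suml mulr_sumr.
apply: eq_big => [B|B /andP[sBA /andP[sBE _]]].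
  rewrite sEA andbT; case sBE: (B \subset E); rewrite ?andbF //.
  by rewrite (subset_trans sBE sEA).
rewrite /F; have -> : A :\: B :\: (E :\: B) = A :\: E.
  apply/setP=> x; rewrite !inE; case xB: (x \in B) => //=.
  by rewrite (subsetP sBE).
have -> : A :\: B = (E :\: B) :|: (A :\: E).
  apply/setP=> x; rewrite !inE; case xB: (x \in B) => /=.
    by rewrite (subsetP sBE).
  by case xE: (x \in E) => //=; rewrite (subsetP sEA).
have eE : E = B :|: (E :\: B).
  by apply/setP=> x; rewrite !inE; case xB: (x \in B) => //=; rewrite (subsetP sBE).
have dE X : [disjoint E :\: X & A :\: E].
  by rewrite disjoint_subset; apply/subsetP => x; rewrite !inE => /andP[_ ->].
rewrite gsignUr //; have -> : sgn E (A :\: E) = sgn B (A :\: E) * sgn (E :\: B) (A :\: E).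
  rewrite {1}eE gsignUl //.
  by rewrite disjoint_subset; apply/subsetP => x xB; rewrite !inE xB.
by ring.
Qed.

Lemma gmul1r u : gmul u (gscal 1) = u.
Proof.
apply/ffunP=> A; rewrite gmulE (bigD1 A) ?subxx //= setDv ffunE eqxx mulr1.
rewrite gsign_prod big1 ?mul1r; last by move=> b _; rewrite big1 // => c; rewrite inE.
rewrite big1 ?addr0 // => B /andP[sBA nBA]; rewrite ffunE ifN ?mulr0 //.
by rewrite setD_eq0; apply: contra nBA => sAB; rewrite eqEsubset sBA.
Qed.

Lemma gscal1_neq0 : gscal 1 != 0 :> grass K t.
Proof.
apply/eqP => /ffunP/(_ set0); rewrite !ffunE eqxx => /eqP.
by rewrite oner_eq0.
Qed.

End GrassmannAlgebra.

HB.instance Definition _ (K : comNzRingType) t :=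
  GRing.Zmodule_isNzRing.Build (grass K t) (@gmul_assoc K t) (@gmul1l K t)
    (@gmul1r K t) (fun u v w => gmulDl u v w) (fun w u v => gmulDr u v w)
    (@gscal1_neq0 K t).

(** * Calculus in the Grassmann algebra *)
Section GrassmannCalculus.
Import mathcomp.boot.fintype mathcomp.boot.finset.
Local Open Scope set_scope.
Variables (K : comNzRingType) (t : nat).
Implicit Types (A B C D : {set 'I_t}) (u v w : grass K t) (a b : 'I_t) (c : K).
Local Notation sgn := (@gsign K t).
Local Notation gscal := (@gscal K t).
Local Notation ggen := (@ggen K t).

Lemma gmulP u v : gmul u v = u * v.
Proof. by []. Qed.

Lemma coef_grassM u v A :
  (u * v) A = \sum_(B : {set 'I_t} | B \subset A) sgn B (A :\: B) * (u B * v (A :\: B)).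
Proof. exact: gmulE. Qed.

(** The product only sees products of coefficients, so a factor may be replaced
    by one that agrees with it wherever the other factor does not vanish. *)
Lemma gmul_eq u v u' v' : (forall A B, u A * v B = u' A * v' B) ->
  gmul u v = gmul u' v'.
Proof.
move=> e; apply/ffunP=> A; rewrite !gmulP !coef_grassM; apply: eq_bigr => B _.
by rewrite e.
Qed.

Lemma coef_grassD u v A : (u + v) A = u A + v A.
Proof. exact: ffunE. Qed.

Lemma coef_grassN u A : (- u) A = - u A.
Proof. exact: ffunE. Qed.

Lemma coef_grass0 A : (0 : grass K t) A = 0.
Proof. exact: (ffunE (fun=> 0) A). Qed.

Lemma coef_gscalM c u A : (gscal c * u) A = c * u A.
Proof. by rewrite -gmulP gmul_scal ffunE. Qed.

Lemma gscalC c u : gscal c * u = u * gscal c.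
Proof.
apply/ffunP=> A; rewrite coef_gscalM coef_grassM (bigD1 A) ?subxx //= setDv ffunE eqxx.
rewrite gsign_prod big1 ?mul1r => [|b _]; last by rewrite big1 // => x; rewrite inE.
rewrite big1 ?addr0 1?mulrC // => B /andP[sBA nBA]; rewrite ffunE ifN ?mulr0 //.
by rewrite setD_eq0; apply: contra nBA => sAB; rewrite eqEsubset sBA.
Qed.

Lemma gscalD c d : gscal (c + d) = gscal c + gscal d.
Proof. by apply/ffunP=> A; rewrite !ffunE; case: ifP; rewrite ?addr0. Qed.

Lemma gscal0 : gscal 0 = 0.
Proof. by apply/ffunP=> A; rewrite !ffunE; case: ifP. Qed.

Lemma gscalMM c d : gscal (c * d) = gscal c * gscal d.
Proof. by apply/ffunP=> A; rewrite coef_gscalM !ffunE; case: ifP; rewrite ?mulr0. Qed.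

Lemma gscal_mulACA c d u v : gscal c * u * (gscal d * v) = gscal (c * d) * (u * v).
Proof. by rewrite gscalMM -!mulrA; congr (_ * _); rewrite !mulrA gscalC. Qed.

(** Monomials arise from constants by successive multiplication by generators:
    additive identities need only be checked against one generator at a time. *)
Lemma grass_ind (P : grass K t -> Prop) :
  (forall c, P (gscal c)) -> (forall u v, P u -> P v -> P (u + v)) ->
  (forall a u, P u -> P (ggen a * u)) -> forall u, P u.
Proof.
move=> Pc PD Pg u.
have Pmon : forall A c, P [ffun B : {set 'I_t} => if B == A then c else 0].
  move=> A; move: {2}#|A| (leqnn #|A|) => m; elim: m A => [|m IH] A.
    rewrite leqn0 cards_eq0 => /eqP-> c; exact: Pc.
  case: (set_0Vmem A) => [-> _ c|[a aA] hA c]; first exact: Pc.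
  have -> : [ffun B : {set 'I_t} => if B == A then c else 0]
    = ggen a * [ffun B : {set 'I_t} => if B == A :\ a then sgn [set a] (A :\ a) * c else 0]
    :> grass K t.
    apply/ffunP=> B; rewrite -gmulP gmul_gen !ffunE.
    case: (eqVneq B A) => [->|nBA].
      by rewrite aA eqxx mulrA gsignK mul1r.
    case aB: (a \in B) => //; rewrite ifN ?mulr0 //.
    apply: contra nBA => /eqP e; by rewrite -(setD1K aB) e setD1K.
  apply/Pg/IH; move: hA; rewrite (cardsD1 a A) aA; lia.
have -> : u = \sum_(A : {set 'I_t}) [ffun B : {set 'I_t} => if B == A then u A else 0].
  apply/ffunP=> B; rewrite sum_ffunE (bigD1 B) //= ffunE eqxx big1 ?addr0 // => A nAB.
  by rewrite ffunE eq_sym ifN.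
elim/big_ind: _ => [|u1 u2|A _]; first by rewrite -gscal0; apply: Pc.
  exact: PD.
exact: Pmon.
Qed.

(** The grading automorphism, with which all Koszul signs are expressed: no
    homogeneity assumption is needed to state a Leibniz rule. *)
Definition ginv u : grass K t := [ffun A : {set 'I_t} => (-1) ^+ #|A| * u A].

Lemma ginvD u v : ginv (u + v) = ginv u + ginv v.
Proof. by apply/ffunP=> A; rewrite !ffunE mulrDr. Qed.

Lemma ginvN u : ginv (- u) = - ginv u.
Proof. by apply/ffunP=> A; rewrite !ffunE mulrN. Qed.

Lemma ginv0 : ginv 0 = 0.
Proof. by apply/ffunP=> A; rewrite !ffunE mulr0. Qed.

Lemma ginv_sum I (s : seq I) (P : pred I) (F : I -> grass K t) :
  ginv (\sum_(i <- s | P i) F i) = \sum_(i <- s | P i) ginv (F i).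
Proof. exact: (big_morph _ ginvD ginv0). Qed.

Lemma ginvK u : ginv (ginv u) = u.
Proof. by apply/ffunP=> A; rewrite !ffunE mulrA -exprD addnn -muln2 exprM sqrr_sign
  mul1r. Qed.

Lemma ginvM u v : ginv (u * v) = ginv u * ginv v.
Proof.
apply/ffunP=> A; rewrite !ffunE mulr_sumr; apply: eq_bigr => B sBA; rewrite !ffunE.
have -> : #|A| = (#|B| + #|A :\: B|)%N by rewrite cardsDS // subnKC // subset_leq_card.
by rewrite exprD; ring.
Qed.

Lemma ginv_scal c : ginv (gscal c) = gscal c.
Proof.
apply/ffunP=> A; rewrite !ffunE; case: eqP => [->|]; rewrite ?mulr0 //.
by rewrite cards0 mul1r.
Qed.

Lemma ginv_gen a : ginv (ggen a) = - ggen a.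
Proof.
apply/ffunP=> A; rewrite !ffunE; case: eqP => [->|]; rewrite ?mulr0 ?oppr0 //.
by rewrite cards1 mulN1r.
Qed.

(** Moving the generator from the right end of a monomial to its left end costs
    one sign for each remaining factor. *)
Lemma grdvE a u : grdv a u = ginv (gldv a u).
Proof.
apply/ffunP=> A; rewrite !ffunE; case: ifP => aA; rewrite ?mulr0 // mulrA; congr (_ * _).
by rewrite gsignC ?cards1 ?muln1 // disjoint_sym disjoints1 aA.
Qed.

Lemma gldv_ginv a u : gldv a (ginv u) = - ginv (gldv a u).
Proof.
apply/ffunP=> A; rewrite !ffunE; case: ifP => aA; rewrite ?mulr0 ?oppr0 //.
by rewrite cardsU1 aA exprS; ring.
Qed.

Lemma gldvN a u : gldv a (- u) = - gldv a u.
Proof. by apply/ffunP=> A; rewrite !ffunE; case: ifP; rewrite ?oppr0 ?mulrN. Qed.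

Lemma gldv_sum a I (s : seq I) (P : pred I) (F : I -> grass K t) :
  gldv a (\sum_(i <- s | P i) F i) = \sum_(i <- s | P i) gldv a (F i).
Proof. exact: (big_morph _ (gldvD a) (gldv0 _ a)). Qed.

Lemma gldvM a u v : gldv a (u * v) = gldv a u * v + ginv u * gldv a v.
Proof.
elim/grass_ind: u => [c|u1 u2 IH1 IH2|b u IH].
- by rewrite gldv_cst mul0r add0r ginv_scal -!gmulP gldv_scal.
- by rewrite mulrDl !gldvD ginvD IH1 IH2 !mulrDl addrACA.
rewrite -mulrA -!gmulP !gldv_gen !gmulP IH ginvM ginv_gen.
rewrite !mulrBl !mulrDr opprD -!mulrA addrA mulNr; congr (_ - _ - _).
by case: eqP; rewrite ?mul0r.
Qed.

Lemma ggen_mulC a b : ggen a * ggen b = - (ggen b * ggen a) :> grass K t.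
Proof. by have := ggenAC a b (1 : grass K t); rewrite !gmulP !mulr1. Qed.

Lemma gldv_genE a b : gldv a (ggen b) = (a == b)%:R.
Proof.
have := gldv_gen a b (1 : grass K t); rewrite !gmulP mulr1 => ->.
rewrite (_ : gldv a 1 = 0) ?mulr0 ?subr0; first by case: eqP.
exact: gldv_cst.
Qed.

Lemma gldv_scalM a c u : gldv a (gscal c * u) = gscal c * gldv a u.
Proof. exact: gldv_scal. Qed.

Lemma gldvAC a b u : gldv a (gldv b u) = - gldv b (gldv a u).
Proof.
elim/grass_ind: u => [c|u1 u2 IH1 IH2|d u IH].
- by rewrite !gldv_cst !gldv0 oppr0.
- by rewrite !gldvD IH1 IH2 opprD.
rewrite -!gmulP !gldv_gen !gldvD !gldvN !gldv_gen IH !gmulP mulrN.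
have E (e : bool) x : gldv x (if e then u else 0) = if e then gldv x u else 0.
  by case: e; rewrite ?gldv0.
rewrite !E; case: eqP; case: eqP => _ _; rewrite ?add0r ?sub0r ?subr0 ?opprB ?opprK //.
all: by rewrite ?opprD ?opprK ?addrA ?opprB //; ring.
Qed.

Lemma ggen_gldv a u : ggen a * gldv a u = [ffun A : {set 'I_t} => if a \in A then u A
  else 0].
Proof.
apply/ffunP=> A; rewrite -gmulP gmul_gen !ffunE; case: ifP => // aA.
by rewrite !inE eqxx /= setD1K // mulrA gsignK mul1r.
Qed.

(** Parity [e], with the zero element of both parities. *)
Definition gpar (e : bool) u := forall A, u A != 0 -> odd #|A| = e.

Lemma gpar_comm e u v : gpar e u -> u * v = (if e then ginv v else v) * u.
Proof.
move=> pu; apply/ffunP=> A; rewrite !coef_grassM.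
rewrite (reindex_onto (fun B : {set 'I_t} => A :\: B) (fun B => A :\: B)) /=; last first.
  by move=> B sBA; rewrite setDDr setDv set0U; apply/setIidPr.
apply: eq_big => [B|B /andP[_ /eqP eB]].
  rewrite subsetDl /= setDDr setDv set0U; apply/eqP/idP => [<-|]; first exact: subsetIl.
  by move/setIidPr.
rewrite eB.
have dB : [disjoint A :\: B & B].
  by rewrite disjoint_subset; apply/subsetP => x; rewrite !inE => /andP[].
case: (eqVneq (u (A :\: B)) 0) => [->|nz]; first by rewrite ?mulr0 ?mul0r ?mulr0.
rewrite gsignC // -signr_odd oddM (pu _ nz) //.
by case: (e) => /=; rewrite ?ffunE ?signr_odd; ring.
Qed.

Lemma gpar_ginv e u : gpar e u -> ginv u = (-1) ^+ e * u.
Proof.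
move=> pu; rewrite -[(-1) ^+ e]/(_ : grass K t).
have -> : (-1) ^+ e = gscal ((-1) ^+ e).
  case: e {pu} => //=; rewrite !expr1; apply/ffunP=> A; rewrite !ffunE.
  by case: ifP; rewrite ?oppr0.
apply/ffunP=> A; rewrite coef_gscalM ffunE.
case: (eqVneq (u A) 0) => [->|nz]; first by rewrite ?mulr0.
by rewrite -signr_odd (pu _ nz).
Qed.

Lemma gpar_gldv e a u : gpar e u -> gpar (~~ e) (gldv a u).
Proof.
move=> pu A; rewrite ffunE; case: ifP => aA; first by rewrite eqxx.
move=> nz; have /pu : u (a |: A) != 0 by apply: contraNneq nz => ->; rewrite mulr0.
by rewrite cardsU1 aA /= => <-; rewrite negbK.
Qed.

End GrassmannCalculus.

Arguments gpar_gldv {K t e} a {u} _ [A] _.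

(** * The super Poisson bracket *)

(** Coefficients carrying two families of derivations: [dm] is the derivative
    along the momenta, [dp] the one along the positions.  The latter obeys the
    derivation rules only on the regular coefficients, because a partial
    derivative is additive and multiplicative only on differentiable functions.
    Position derivatives are not assumed to commute with each other. *)
Record bideriv (K : comNzRingType) (n : nat) := BiDeriv {
  dm : 'I_n -> K -> K;
  dp : 'I_n -> K -> K;
  reg : K -> Prop;
  dmD : forall k x y, dm k (x + y) = dm k x + dm k y;
  dmM : forall k x y, dm k (x * y) = dm k x * y + x * dm k y;
  dmC : forall k l x, dm k (dm l x) = dm l (dm k x);
  reg0 : reg 0;
  regD : forall x y, reg x -> reg y -> reg (x + y);
  regN : forall x, reg x -> reg (- x);
  regM : forall x y, reg x -> reg y -> reg (x * y);
  reg_dm : forall k x, reg x -> reg (dm k x);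
  reg_dp : forall k x, reg x -> reg (dp k x);
  dpD : forall k x y, reg x -> reg y -> dp k (x + y) = dp k x + dp k y;
  dpM : forall k x y, reg x -> reg y -> dp k (x * y) = dp k x * y + x * dp k y;
  dmp : forall k l x, reg x -> dm k (dp l x) = dp l (dm k x)
}.

Section Superbracket.
Variables (K : comNzRingType) (n r : nat) (J : bideriv K n).
Local Notation G := (grass K (r + r)).
Implicit Types (u v w h F H P Q : G) (a b : 'I_(r + r)) (k l : 'I_n).

Definition gdm k u : G := [ffun A => dm J k (u A)].
Definition gdp k u : G := [ffun A => dp J k (u A)].
Definition greg u := forall A, reg J (u A).

(** The conjugate odd generator, exchanging xi_c and theta^c. *)
Definition dual a : 'I_(r + r) :=
  match fintype.split a with inl c => rshift r c | inr c => lshift r c end.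

Lemma dual_lshift (c : 'I_r) : dual (lshift r c) = rshift r c.
Proof. by rewrite /dual (unsplitK (inl c : 'I_r + 'I_r)%type). Qed.

Lemma dual_rshift (c : 'I_r) : dual (rshift r c) = lshift r c.
Proof. by rewrite /dual (unsplitK (inr c : 'I_r + 'I_r)%type). Qed.

Lemma dualK : involutive dual.
Proof.
move=> a; rewrite -[a]splitK; case: (fintype.split a) => c /=.
  by rewrite dual_lshift dual_rshift.
by rewrite dual_rshift dual_lshift.
Qed.

Fact bra_key : unit. Proof. by []. Qed.

(** Right derivatives are written as left derivatives followed by [ginv], and the
    two odd families are merged into one sum over generators and their
    conjugates.  The lock prevents conversion from expanding nested brackets. *)
Definition bra u v : G := locked_with bra_key
  (\sum_k (gdm k u * gdp k v - gdp k u * gdm k v)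
   + \sum_a ginv (gldv a u) * gldv (dual a) v).

Lemma bra_def u v : bra u v =
  \sum_k (gdm k u * gdp k v - gdp k u * gdm k v)
  + \sum_a ginv (gldv a u) * gldv (dual a) v.
Proof. by rewrite /bra unlock. Qed.

Lemma bra_intro u v (X : 'I_n -> G) (Y : 'I_r -> G) :
  (forall k, X k = gmul (gdm k u) (gdp k v) - gmul (gdp k u) (gdm k v)) ->
  (forall c, Y c = gmul (ginv (gldv (rshift r c) u)) (gldv (lshift r c) v)
                 + gmul (ginv (gldv (lshift r c) u)) (gldv (rshift r c) v)) ->
  \sum_k X k + \sum_c Y c = bra u v.
Proof.
move=> hX hY; rewrite bra_def; congr (_ + _); first by apply: eq_bigr => k _; rewrite hX.
rewrite big_split_ord /= addrC -big_split; apply: eq_bigr => c _ /=.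
by rewrite hY dual_lshift dual_rshift.
Qed.

Lemma dm0 k : dm J k 0 = 0.
Proof. by have /eqP := dmD J k 0 0; rewrite addr0 -subr_eq0 opprD addrA subrr sub0r
  oppr_eq0 => /eqP. Qed.

Lemma dmN k x : dm J k (- x) = - dm J k x.
Proof. by apply/eqP; rewrite -addr_eq0 -dmD addNr dm0. Qed.

Lemma dp0 k : dp J k 0 = 0.
Proof.
have /eqP := dpD k (reg0 J) (reg0 J).
by rewrite addr0 -subr_eq0 opprD addrA subrr sub0r oppr_eq0 => /eqP.
Qed.

Lemma dpN k x : reg J x -> dp J k (- x) = - dp J k x.
Proof. by move=> hx; apply/eqP; rewrite -addr_eq0 -dpD ?addNr ?dp0 //; exact: regN. Qed.

Lemma reg_sign m x : reg J x -> reg J ((-1) ^+ m * x).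
Proof. by move=> hx; rewrite -signr_odd mulr_sign; case: ifP => _ //; apply: regN. Qed.

Lemma dm_sign k m x : dm J k ((-1) ^+ m * x) = (-1) ^+ m * dm J k x.
Proof. by rewrite -signr_odd !mulr_sign; case: ifP => _ //; rewrite dmN. Qed.

Lemma dp_sign k m x : reg J x -> dp J k ((-1) ^+ m * x) = (-1) ^+ m * dp J k x.
Proof. by move=> hx; rewrite -signr_odd !mulr_sign; case: ifP => _ //; rewrite dpN. Qed.

Lemma reg_sum I (s : seq I) (P : pred I) (f : I -> K) :
  (forall i, P i -> reg J (f i)) -> reg J (\sum_(i <- s | P i) f i).
Proof. by move=> h; elim/big_ind: _ => //; [apply: reg0 | apply: regD]. Qed.

Lemma dp_sum k I (s : seq I) (P : pred I) (f : I -> K) :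
  (forall i, P i -> reg J (f i)) ->
  dp J k (\sum_(i <- s | P i) f i) = \sum_(i <- s | P i) dp J k (f i).
Proof.
move=> h.
elim: s => [|i s IH]; first by rewrite !big_nil dp0.
rewrite !big_cons; case: ifP => // Pi.
by rewrite dpD ?IH //; [apply: h | apply: reg_sum].
Qed.

Lemma greg0 : greg 0.
Proof. by move=> A; rewrite coef_grass0; apply: reg0. Qed.

Lemma gregD u v : greg u -> greg v -> greg (u + v).
Proof. by move=> hu hv A; rewrite coef_grassD; apply: regD. Qed.

Lemma gregN u : greg u -> greg (- u).
Proof. by move=> hu A; rewrite coef_grassN; apply: regN. Qed.

Lemma greg_sum I (s : seq I) (P : pred I) (f : I -> G) :
  (forall i, P i -> greg (f i)) -> greg (\sum_(i <- s | P i) f i).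
Proof. by move=> h; elim/big_ind: _ => //; [apply: greg0 | apply: gregD]. Qed.

Lemma gregM u v : greg u -> greg v -> greg (u * v).
Proof.
move=> hu hv A; rewrite coef_grassM; apply: reg_sum => B _.
by apply: reg_sign; apply: regM.
Qed.

Lemma greg_gldv a u : greg u -> greg (gldv a u).
Proof. by move=> hu A; rewrite ffunE; case: ifP => _; [apply: reg0 | apply: reg_sign]. Qed.

Lemma greg_ginv u : greg u -> greg (ginv u).
Proof. by move=> hu A; rewrite ffunE; apply: reg_sign. Qed.

Lemma greg_gdm k u : greg u -> greg (gdm k u).
Proof. by move=> hu A; rewrite ffunE; apply: reg_dm. Qed.

Lemma greg_gdp k u : greg u -> greg (gdp k u).
Proof. by move=> hu A; rewrite ffunE; apply: reg_dp. Qed.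

Lemma greg_bra u v : greg u -> greg v -> greg (bra u v).
Proof.
move=> hu hv; rewrite bra_def; apply: gregD; apply: greg_sum => i _.
  apply: gregD; first by apply: gregM; [apply: greg_gdm | apply: greg_gdp].
  by apply/gregN/gregM; [apply: greg_gdp | apply: greg_gdm].
by apply: gregM; [apply/greg_ginv/greg_gldv | apply: greg_gldv].
Qed.

Lemma gdmD k u v : gdm k (u + v) = gdm k u + gdm k v.
Proof. by apply/ffunP=> A; rewrite !ffunE dmD. Qed.

Lemma gdm0 k : gdm k 0 = 0.
Proof. by apply/ffunP=> A; rewrite !ffunE dm0. Qed.

Lemma gdmN k u : gdm k (- u) = - gdm k u.
Proof. by apply/ffunP=> A; rewrite !ffunE dmN. Qed.

Lemma gdm_sum k I (s : seq I) (P : pred I) (f : I -> G) :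
  gdm k (\sum_(i <- s | P i) f i) = \sum_(i <- s | P i) gdm k (f i).
Proof. exact: (big_morph _ (gdmD k) (gdm0 k)). Qed.

Lemma gdmM k u v : gdm k (u * v) = gdm k u * v + u * gdm k v.
Proof.
apply/ffunP=> A; rewrite coef_grassD !coef_grassM ffunE coef_grassM.
rewrite (big_morph _ (dmD J k) (dm0 k)) -big_split; apply: eq_bigr => B _.
by rewrite /gsign dm_sign dmM mulrDr !ffunE.
Qed.

Lemma gdm_gldv k a u : gdm k (gldv a u) = gldv a (gdm k u).
Proof. by apply/ffunP=> A; rewrite !ffunE; case: ifP => _; rewrite ?dm0 ?dm_sign. Qed.

Lemma gdm_ginv k u : gdm k (ginv u) = ginv (gdm k u).
Proof. by apply/ffunP=> A; rewrite !ffunE dm_sign. Qed.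

Lemma gdmC k l u : gdm k (gdm l u) = gdm l (gdm k u).
Proof. by apply/ffunP=> A; rewrite !ffunE dmC. Qed.

Lemma gdp0 k : gdp k 0 = 0.
Proof. by apply/ffunP=> A; rewrite !ffunE dp0. Qed.

Lemma gdpD k u v : greg u -> greg v -> gdp k (u + v) = gdp k u + gdp k v.
Proof. by move=> hu hv; apply/ffunP=> A; rewrite !ffunE dpD. Qed.

Lemma gdpN k u : greg u -> gdp k (- u) = - gdp k u.
Proof. by move=> hu; apply/ffunP=> A; rewrite !ffunE dpN. Qed.

Lemma gdp_sum k I (s : seq I) (P : pred I) (f : I -> G) :
  (forall i, P i -> greg (f i)) ->
  gdp k (\sum_(i <- s | P i) f i) = \sum_(i <- s | P i) gdp k (f i).
Proof.
move=> hf; apply/ffunP=> A; rewrite ffunE !sum_ffunE dp_sum.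
  by apply: eq_bigr => i _; rewrite ffunE.
by move=> i Pi; apply: hf.
Qed.

Lemma gdpM k u v : greg u -> greg v -> gdp k (u * v) = gdp k u * v + u * gdp k v.
Proof.
move=> hu hv; apply/ffunP=> A; rewrite coef_grassD !coef_grassM ffunE coef_grassM.
rewrite dp_sum => [|B _]; last by apply/reg_sign/regM.
rewrite -big_split; apply: eq_bigr => B _.
by rewrite /gsign dp_sign ?dpM ?mulrDr ?ffunE //; apply: regM.
Qed.

Lemma gdp_gldv k a u : greg u -> gdp k (gldv a u) = gldv a (gdp k u).
Proof.
move=> hu; apply/ffunP=> A; rewrite !ffunE; case: ifP => _; rewrite ?dp0 //.
by rewrite /gsign dp_sign.
Qed.

Lemma gdmp k l u : greg u -> gdm k (gdp l u) = gdp l (gdm k u).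
Proof. by move=> hu; apply/ffunP=> A; rewrite !ffunE dmp. Qed.

Lemma gpar_gdp e k u : gpar e u -> gpar e (gdp k u).
Proof.
move=> pu A; rewrite ffunE => nz; apply: pu.
by apply: contraNneq nz => ->; rewrite dp0.
Qed.

Arguments gpar_gdp {e} k {u} _ [A] _.

(** An even [h] free of momenta: [bra h] is then an even derivation.  As the
    momentum derivatives of [h] vanish, [bra h] takes no position derivative of
    its argument, so that it is additive without any regularity. *)
Section Derivation.
Variable h : G.
Hypothesis h_reg : greg h.
Hypothesis h_even : gpar false h.
Hypothesis h_mom : forall k, gdm k h = 0.

Lemma even_gdp_comm k u : gdp k h * u = u * gdp k h.
Proof. by rewrite (gpar_comm _ (gpar_gdp _ h_even)). Qed.

Lemma even_gldv_comm a u : gldv a h * u = ginv u * gldv a h.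
Proof. by rewrite (gpar_comm _ (gpar_gldv a h_even)). Qed.

Lemma even_gldv2_comm a b u : gldv a (gldv b h) * u = u * gldv a (gldv b h).
Proof. by rewrite (gpar_comm _ (gpar_gldv a (gpar_gldv b h_even))). Qed.

Lemma even_gldv_gdp_comm a k u : gldv a (gdp k h) * u = ginv u * gldv a (gdp k h).
Proof. by rewrite (gpar_comm _ (gpar_gldv a (gpar_gdp k h_even))). Qed.

Lemma braE u :
  bra h u = - (\sum_k gdp k h * gdm k u + \sum_a gldv a h * gldv (dual a) u).
Proof.
rewrite bra_def opprD -!sumrN; congr (_ + _); apply: eq_bigr => i _.
  by rewrite h_mom mul0r sub0r.
rewrite (gpar_ginv (gpar_gldv i h_even)) /= expr1 -mulrA mulN1r //.
Qed.

Lemma bra0r : bra h 0 = 0.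
Proof.
rewrite braE !big1 ?addr0 ?oppr0 // => i _; first by rewrite gldv0 mulr0.
by rewrite gdm0 mulr0.
Qed.

Lemma braDr u v : bra h (u + v) = bra h u + bra h v.
Proof.
rewrite !braE -opprD addrACA -!big_split /=; congr (- (_ + _)); apply: eq_bigr => i _.
  by rewrite gdmD mulrDr.
by rewrite gldvD mulrDr.
Qed.

Lemma braNr u : bra h (- u) = - bra h u.
Proof. by apply/eqP; rewrite -addr_eq0 -braDr addNr bra0r. Qed.

Lemma bra_sumr I (s : seq I) (P : pred I) (f : I -> G) :
  bra h (\sum_(i <- s | P i) f i) = \sum_(i <- s | P i) bra h (f i).
Proof. exact: (big_morph _ braDr bra0r). Qed.

Lemma braMr u v : bra h (u * v) = bra h u * v + u * bra h v.
Proof.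
rewrite !braE mulNr mulrN -opprD; congr (- _).
rewrite mulrDl mulrDr addrACA !mulr_suml !mulr_sumr -!big_split /=.
congr (_ + _); apply: eq_bigr => i _.
  by rewrite gdmM mulrDr !mulrA (even_gdp_comm i u).
by rewrite gldvM mulrDr !mulrA (even_gldv_comm i (ginv u)) ginvK.
Qed.

Lemma bra_ginv u : bra h (ginv u) = ginv (bra h u).
Proof.
rewrite !braE ginvN ginvD !ginv_sum; congr (- (_ + _)); apply: eq_bigr => i _.
  by rewrite ginvM gdm_ginv (gpar_ginv (gpar_gdp i h_even)) mul1r.
rewrite ginvM (gpar_ginv (gpar_gldv i h_even)) gldv_ginv /= expr1 mulN1r.
by rewrite mulrN mulNr.
Qed.

Lemma gdm_bra k u : gdm k (bra h u) = bra h (gdm k u).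
Proof.
rewrite !braE gdmN gdmD !gdm_sum; congr (- (_ + _)); apply: eq_bigr => i _.
  by rewrite gdmM gdmp // h_mom gdp0 mul0r add0r gdmC.
by rewrite gdmM !gdm_gldv h_mom gldv0 mul0r add0r.
Qed.

(** The failure of [bra h] to commute with an odd derivative ([curl_gldv]) or a
    position derivative ([curl_gdp]); both involve the second derivatives of [h]. *)
Definition curl_gldv b u : G :=
  \sum_k gldv b (gdp k h) * gdm k u + \sum_a gldv b (gldv a h) * gldv (dual a) u.

Definition curl_gdp l u : G :=
  \sum_k gdp l (gdp k h) * gdm k u + \sum_a gldv a (gdp l h) * gldv (dual a) u.

Lemma gldv_bra b u : gldv b (bra h u) = bra h (gldv b u) - curl_gldv b u.
Proof.
rewrite !braE gldvN gldvD !gldv_sum -opprD; congr (- _).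
rewrite addrACA -!big_split /=; congr (_ + _); apply: eq_bigr => i _.
  by rewrite gldvM (gpar_ginv (gpar_gdp i h_even)) mul1r -gdm_gldv addrC.
rewrite gldvM (gpar_ginv (gpar_gldv i h_even)) /= expr1 mulN1r (gldvAC b (dual i)).
by rewrite mulrNN addrC.
Qed.

Lemma gdp_bra l u : greg u -> gdp l (bra h u) = bra h (gdp l u) - curl_gdp l u.
Proof.
move=> hu; have hk k : greg (gdp k h * gdm k u).
  by apply: gregM; [apply: greg_gdp | apply: greg_gdm].
have ha a : greg (gldv a h * gldv (dual a) u) by apply: gregM; apply: greg_gldv.
rewrite !braE gdpN; last by apply: gregD; apply: greg_sum => i _.
rewrite gdpD ?gdp_sum //; try by apply: greg_sum => i _.
rewrite -opprD; congr (- _).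
rewrite addrACA -!big_split /=; congr (_ + _); apply: eq_bigr => i _.
  by rewrite gdpM ?gdmp 1?addrC //; [apply: greg_gdp | apply: greg_gdm].
by rewrite gdpM ?gdp_gldv 1?addrC //; apply: greg_gldv.
Qed.

(** Distributing [bra h] over the bracket of [u] and [v] leaves the commutators of
    [bra h] with the partial derivatives.  The mixed and odd second derivatives
    of [h] occur twice and cancel.  The only terms that would need the symmetry
    of the second position derivatives carry a momentum derivative of [u] and
    one of [v]: they vanish as soon as [u] or [v] is free of momenta. *)
Lemma jacobi u v : greg u -> greg v ->
  (forall k, gdm k u = 0) \/ (forall k, gdm k v = 0) ->
  bra h (bra u v) = bra (bra h u) v + bra u (bra h v).
Proof.
move=> hu hv uv0.
(* The terms with second position derivatives are the ones dropped here. *)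
have mom0 : \sum_k (curl_gdp k u * gdm k v - gdm k u * curl_gdp k v)
  = \sum_k ((\sum_a gldv a (gdp k h) * gldv (dual a) u) * gdm k v
            - gdm k u * \sum_a gldv a (gdp k h) * gldv (dual a) v).
  have curlE w k : (forall l, gdm l w = 0) ->
      curl_gdp k w = \sum_a gldv a (gdp k h) * gldv (dual a) w.
    by move=> e; rewrite /curl_gdp big1 ?add0r // => l _; rewrite e mulr0.
  apply: eq_bigr => k _; case: uv0 => e; rewrite ?e ?mul0r ?mulr0.
    by rewrite (curlE u).
  by rewrite (curlE v).
(* The remaining commutators cancel in pairs after exchanging each generator
   with its conjugate. *)
have curl0 : \sum_k (curl_gdp k u * gdm k v - gdm k u * curl_gdp k v)
  - \sum_a (ginv (curl_gldv a u) * gldv (dual a) v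
            + ginv (gldv a u) * curl_gldv (dual a) v) = 0.
  rewrite mom0 /curl_gldv sumrB.
  under [X in _ - X]eq_bigr => a _ do
    rewrite ginvD mulrDl mulrDr addrACA addrC addrACA.
  rewrite !big_split /=.
  have -> : \sum_k (\sum_a gldv a (gdp k h) * gldv (dual a) u) * gdm k v
    = \sum_a ginv (gldv a u) * \sum_k gldv (dual a) (gdp k h) * gdm k v.
    under eq_bigr do rewrite mulr_suml.
    rewrite exchange_big (reindex_inj (inv_inj dualK)) /=.
    apply: eq_bigr => a _; rewrite mulr_sumr; apply: eq_bigr => k _.
    by rewrite dualK even_gldv_gdp_comm mulrA.
  have -> : \sum_k gdm k u * (\sum_a gldv a (gdp k h) * gldv (dual a) v)
    = - \sum_a ginv (\sum_k gldv a (gdp k h) * gdm k u) * gldv (dual a) v.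
    under eq_bigr do rewrite mulr_sumr.
    rewrite exchange_big -sumrN /=; apply: eq_bigr => a _.
    rewrite ginv_sum mulr_suml -sumrN; apply: eq_bigr => k _.
    rewrite ginvM (gpar_ginv (gpar_gldv a (gpar_gdp k h_even))) /= expr1 mulN1r.
    by rewrite !mulNr opprK mulrA even_gldv_gdp_comm ginvK.
  have -> : \sum_a ginv (\sum_b gldv a (gldv b h) * gldv (dual b) u) * gldv (dual a) v
    = - \sum_a ginv (gldv a u) * \sum_b gldv (dual a) (gldv b h) * gldv (dual b) v.
    under eq_bigr do rewrite ginv_sum mulr_suml.
    rewrite exchange_big (reindex_inj (inv_inj dualK)) -sumrN /=.
    apply: eq_bigr => b _; rewrite mulr_sumr -sumrN; apply: eq_bigr => a _.
    rewrite ginvM (gpar_ginv (gpar_gldv a (gpar_gldv _ h_even))) /= mul1r dualK.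
    by rewrite even_gldv2_comm gldvAC mulrN mulNr mulrA.
  set x := \sum_a _; set y := \sum_a _; set z := \sum_a _.
  by rewrite opprK (addrC (- z)) -[y - z + _]addrA addKr (addrC y) subrr.
rewrite -[LHS]addr0 -[X in _ + X]curl0 (bra_def u v) braDr !bra_sumr.
rewrite (bra_def (bra h u) v) (bra_def u (bra h v)) addrACA [RHS]addrACA.
rewrite -!sumrN -!big_split /=; congr (_ + _); apply: eq_bigr => i _.
  rewrite !gdm_bra !gdp_bra // braDr braNr !braMr mulrBl mulrBr !(opprD,
    opprB) opprK !addrA.
  rewrite [LHS](ACl (1*3*5*2*6*4)) //.
rewrite !gldv_bra ginvD ginvN -bra_ginv mulrBl mulrBr braMr opprD.
by rewrite addrACA.
Qed.

Lemma bra_antisym u : bra u h = - bra h u.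
Proof.
rewrite bra_def braE opprK; congr (_ + _).
  by apply: eq_bigr => k _; rewrite h_mom mulr0 subr0 even_gdp_comm.
rewrite (reindex_inj (inv_inj dualK)) /=; apply: eq_bigr => a _.
by rewrite dualK even_gldv_comm.
Qed.

End Derivation.

Lemma braDl u v w : greg u -> greg v -> bra (u + v) w = bra u w + bra v w.
Proof.
move=> hu hv; rewrite !bra_def addrACA -!big_split; congr (_ + _); apply: eq_bigr => i _ /=.
  by rewrite gdmD gdpD // !mulrDl opprD addrACA.
by rewrite gldvD ginvD mulrDl.
Qed.

Lemma braNl u w : greg u -> bra (- u) w = - bra u w.
Proof.
move=> hu; rewrite !bra_def opprD -!sumrN; congr (_ + _); apply: eq_bigr => i _ /=.
  by rewrite gdmN gdpN // !mulNr opprD.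
by rewrite gldvN ginvN mulNr.
Qed.

(** [P] and [Q] depend only on the positions and on theta, as multivector fields
    do; [u] is arbitrary. *)
Section DerivedBracket.
Variables (P Q : G) (p q : bool).
Hypotheses (P_reg : greg P) (Q_reg : greg Q) (pP : gpar p P) (qQ : gpar q Q).
Hypotheses (P_mom : forall k, gdm k P = 0) (Q_mom : forall k, gdm k Q = 0).
Hypotheses (P_xi : forall c : 'I_r, gldv (lshift r c) P = 0)
  (Q_xi : forall c : 'I_r, gldv (lshift r c) Q = 0).

Lemma bra_section u S : (forall k, gdm k S = 0) ->
  (forall c : 'I_r, gldv (lshift r c) S = 0) ->
  bra u S = \sum_k gdm k u * gdp k S
            + \sum_(c < r) ginv (gldv (lshift r c) u) * gldv (rshift r c) S.
Proof.
move=> S_mom S_xi; rewrite bra_def; congr (_ + _).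
  by apply: eq_bigr => k _; rewrite S_mom mulr0 subr0.
rewrite big_split_ord /= [X in _ + X]big1 ?addr0 => [|c _].
  by apply: eq_bigr => c _; rewrite dual_lshift.
by rewrite dual_rshift S_xi mulr0.
Qed.

(** Bracketing with [P] and then with [Q] differentiates [u] twice along the
    momenta and xi: [P] does not depend on these variables. *)
Lemma bra_bra_sections u :
  bra (bra u P) Q =
   \sum_l \sum_k gdm l (gdm k u) * (gdp k P * gdp l Q)
 + \sum_l \sum_(c < r) ginv (gldv (lshift r c) (gdm l u)) * (gldv (rshift r c) P * gdp l Q)
 + \sum_(e < r) \sum_k ginv (gldv (lshift r e) (gdm k u)) * (ginv (gdp k P) * gldv
   (rshift r e) Q)
 - \sum_(e < r) \sum_(c < r) gldv (lshift r e) (gldv (lshift r c) u)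
     * (ginv (gldv (rshift r c) P) * gldv (rshift r e) Q).
Proof.
rewrite (bra_section _ Q_mom Q_xi) (bra_section _ P_mom P_xi).
rewrite -!addrA; rewrite [RHS]addrA; congr (_ + _).
  rewrite -big_split; apply: eq_bigr => l _ /=.
  rewrite gdmD !gdm_sum mulrDl !mulr_suml; congr (_ + _); apply: eq_bigr => i _.
    by rewrite gdmM gdmp // P_mom gdp0 mulr0 addr0 mulrA.
  by rewrite gdmM gdm_ginv !gdm_gldv P_mom gldv0 mulr0 addr0 mulrA.
rewrite -sumrN -big_split; apply: eq_bigr => e _ /=.
rewrite gldvD !gldv_sum ginvD !ginv_sum mulrDl !mulr_suml -sumrN.
congr (_ + _); apply: eq_bigr => i _.
  by rewrite gldvM -gdp_gldv // P_xi gdp0 mulr0 addr0 ginvM mulrA.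
rewrite gldvM [gldv (lshift r e) (gldv (rshift r i) P)]gldvAC P_xi gldv0 oppr0 mulr0 addr0.
by rewrite ginvM gldv_ginv ginvN ginvK mulNr mulNr mulrA.
Qed.

End DerivedBracket.

Lemma gpar_swap p q u v : gpar p u -> gpar q v ->
  u * v = (-1) ^+ (p && q) * (v * u).
Proof.
move=> pu qv; rewrite (gpar_comm v pu); case: p {pu} => /=; last by rewrite mul1r.
by rewrite (gpar_ginv qv) mulrA.
Qed.

(** This is the Jacobi identity for [u], [P] and [Q], whose bracket of [P] with
    [Q] vanishes.  Since [u] may contain momenta it is read off the expansion of
    [bra_bra_sections] instead: second derivatives of [u] are graded symmetric. *)
Lemma derived_sym P Q p q u : greg P -> greg Q -> gpar p P -> gpar q Q ->
  (forall k, gdm k P = 0) -> (forall k, gdm k Q = 0) ->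
  (forall c : 'I_r, gldv (lshift r c) P = 0) ->
  (forall c : 'I_r, gldv (lshift r c) Q = 0) ->
  bra (bra u P) Q = (-1) ^+ (p && q) * bra (bra u Q) P.
Proof.
move=> rP rQ pP qQ mP mQ xP xQ.
rewrite (bra_bra_sections rP mP mQ xP xQ) (bra_bra_sections rQ mQ mP xQ xP).
have signC m (x y : G) : (-1) ^+ m * (x * y) = x * ((-1) ^+ m * y).
  by rewrite mulrA -commr_sign mulrA.
have pk k := gpar_gdp k pP; have qk k := gpar_gdp k qQ.
have pc a := gpar_gldv a pP; have qc a := gpar_gldv a qQ.
rewrite mulrBr !mulrDr !mulr_sumr -!addrA; congr (_ + _).
  rewrite exchange_big /=; apply: eq_bigr => k _; rewrite mulr_sumr.
  apply: eq_bigr => l _; rewrite gdmC signC; congr (_ * _).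
  by rewrite (gpar_swap (pk _) (qk _)).
rewrite addrCA; congr (_ + _).
  rewrite exchange_big /=; apply: eq_bigr => l _; rewrite mulr_sumr.
  apply: eq_bigr => e _; rewrite signC; congr (_ * _).
  rewrite (gpar_ginv (pk _)) -mulrA (gpar_swap (pk _) (qc _)) !mulrA -!exprD.
  by case: (p); case: (q) => /=; rewrite ?(expr0, expr1, expr2, mulrNN, mulr1, mul1r).
congr (_ - _).
  rewrite exchange_big /=; apply: eq_bigr => l _; rewrite mulr_sumr.
  apply: eq_bigr => e _; rewrite signC; congr (_ * _).
  rewrite (gpar_ginv (qk _)) -mulrA (gpar_swap (pc _) (qk _)) !mulrA -!exprD.
  by case: (p); case: (q) => /=; rewrite ?(expr0, expr1, expr2, mulrNN, mulr1, mul1r).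
rewrite exchange_big /=; apply: eq_bigr => l _; rewrite mulr_sumr.
apply: eq_bigr => e _; rewrite signC gldvAC mulNr -mulrN; congr (_ * _).
rewrite (gpar_ginv (pc _)) (gpar_ginv (qc _)) -!mulrA (gpar_swap (pc _) (qc _)).
rewrite !mulrA -!exprD.
by case: (p); case: (q) => /=; rewrite ?(expr0, expr1, expr2, mulrNN, mulr1, mul1r,
  mulNr, opprK).
Qed.
End Superbracket.

(** * Smooth functions cut off to a chart domain *)
Section SmoothFunctions.
Local Open Scope classical_set_scope.
Variables (R : realType) (n : nat) (U : set 'rV[R]_n).
Hypothesis U_open : open U.
Implicit Types (f g : 'rV[R]_n -> R) (x : 'rV[R]_n) (k : 'I_n) (d : nat).

Lemma open_near x (P : 'rV[R]_n -> Prop) :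
  U x -> (forall y, U y -> P y) -> \forall y \near x, P y.
Proof.
move=> Ux hP; have nU : nbhs x U by exact: open_nbhs_nbhs.
by apply: filterS nU.
Qed.

Lemma partial_eq f g k x : U x -> (forall y, U y -> f y = g y) ->
  partial k f x = partial k g x.
Proof. by move=> Ux fg; apply: near_eq_derive; apply: open_near. Qed.

Lemma continuous_at_eq f g x : U x -> (forall y, U y -> f y = g y) ->
  {for x, continuous f} -> {for x, continuous g}.
Proof.
move=> Ux fg cf; have e : \forall y \near x, f y = g y by apply: open_near.
suff : g @ x --> g x by [].
rewrite -(fg x Ux); apply: cvg_trans (cf : f @ x --> f x).
exact: near_eq_cvg e.
Qed.

Lemma classC_eq d f g : (forall y, U y -> f y = g y) -> classC d U f -> classC d U g.
Proof.
elim: d f g => [|d IH] f g fg [cf df]; split.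
- by move=> x Ux; apply: continuous_at_eq (cf x Ux).
- by [].
- by move=> x Ux; apply: continuous_at_eq (cf x Ux).
move=> k; have [dfk cfk] := df k; split=> [x Ux|].
  by apply: near_eq_derivable (dfk x Ux); apply: open_near.
by apply: IH cfk => y Uy; apply: partial_eq.
Qed.

Lemma classC_cst d c : classC d U (cst c).
Proof.
elim: d c => [|d IH] c; split=> //; try by move=> x _; apply: cst_continuous.
move=> k; split=> [x _|]; first exact: derivable_cst.
by apply: classC_eq (IH 0) => y _; rewrite /partial derive_cst.
Qed.

Lemma classC_le d f : classC d.+1 U f -> classC d U f.
Proof.
elim: d f => [|d IH] f [cf df]; split=> // k.
by have [dfk cfk] := df k; split=> //; apply: IH.
Qed.

Lemma classCD d f g : classC d U f -> classC d U g -> classC d U (f + g).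
Proof.
elim: d f g => [|d IH] f g [cf df] [cg dg]; split=> //.
1,2: by move=> x Ux; apply: continuousD; [apply: cf | apply: cg].
move=> k; have [dfk cfk] := df k; have [dgk cgk] := dg k.
split=> [x Ux|]; first by apply: derivableD; [apply: dfk | apply: dgk].
apply: classC_eq (IH _ _ cfk cgk) => y Uy.
by rewrite /partial deriveD //; [apply: dfk | apply: dgk].
Qed.

Lemma classCM d f g : classC d U f -> classC d U g -> classC d U (f * g).
Proof.
elim: d f g => [|d IH] f g hf hg.
  have [cf _] := hf; have [cg _] := hg.
  by split=> // x Ux; apply: continuousM; [apply: cf | apply: cg].
have [cf df] := hf; have [cg dg] := hg; split.
  by move=> x Ux; apply: continuousM; [apply: cf | apply: cg].
move=> k; have [dfk cfk] := df k; have [dgk cgk] := dg k.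
split=> [x Ux|]; first by apply: derivableM; [apply: dfk | apply: dgk].
apply: classC_eq (classCD (IH _ _ (classC_le hf) cgk) (IH _ _ (classC_le hg) cfk)).
by move=> y Uy; rewrite /partial deriveM //; [apply: dfk | apply: dgk].
Qed.

(** Smooth on the open set [U] and zero outside it: equality of such functions is
    equality on [U], and together they form a ring with unit the indicator
    function of [U]. *)
Definition smooth0 f := smooth U f /\ (forall x, ~ U x -> f x = 0).

Definition dom_indic : 'rV[R]_n -> R := fun x => if `[< U x >] then 1 else 0.
(** The partial derivative is set to zero outside [U], where the functions need
    not be differentiable; it becomes a derivation of the functions of
    [smooth0], with equalities between total functions. *)
Definition cut_partial k f := dom_indic * partial k f.

Lemma dom_indicT x : U x -> dom_indic x = 1.
Proof. by move=> Ux; rewrite /dom_indic asboolT. Qed.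

Lemma dom_indicF x : ~ U x -> dom_indic x = 0.
Proof. by move=> Ux; rewrite /dom_indic asboolF. Qed.

Lemma smooth0_dom_indic : smooth0 dom_indic.
Proof.
split=> [d|x]; last exact: dom_indicF.
by apply: classC_eq (classC_cst d 1) => y Uy; rewrite dom_indicT.
Qed.

Lemma dom_indic_mul f : (forall x, ~ U x -> f x = 0) -> dom_indic * f = f.
Proof.
move=> f0; apply/funext => x; rewrite /GRing.mul /=.
by case: (pselect (U x)) => Ux; [rewrite dom_indicT ?mul1r | rewrite (f0 x) ?mulr0].
Qed.

Lemma eq_smooth0 f g : (forall x, ~ U x -> f x = 0) -> (forall x, ~ U x -> g x = 0) ->
  (forall x, U x -> f x = g x) -> f = g.
Proof.
move=> f0 g0 fg; apply/funext => x.
by case: (pselect (U x)) => Ux; [apply: fg | rewrite f0 ?g0].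
Qed.

Lemma smooth0_0 : smooth0 0.
Proof. by split=> // d; apply: classC_cst. Qed.

Lemma smooth0D f g : smooth0 f -> smooth0 g -> smooth0 (f + g).
Proof.
move=> [sf f0] [sg g0]; split=> [d|x Ux]; first exact: classCD.
by rewrite /GRing.add /= f0 ?g0 ?addr0.
Qed.

Lemma smooth0M f g : smooth0 f -> smooth0 g -> smooth0 (f * g).
Proof.
move=> [sf f0] [sg g0]; split=> [d|x Ux]; first exact: classCM.
by rewrite /GRing.mul /= f0 ?mul0r.
Qed.

Lemma smooth0Z c f : smooth0 f -> smooth0 (cst c * f).
Proof.
move=> [sf f0]; split=> [d|x Ux]; first exact: classCM (classC_cst d c) (sf d).
by rewrite /GRing.mul /= f0 ?mulr0.
Qed.

Lemma smooth0N f : smooth0 f -> smooth0 (- f).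
Proof.
have -> : - f = cst (-1) * f by apply/funext=> x; rewrite /GRing.mul /= mulN1r.
exact: smooth0Z.
Qed.

Lemma smooth0_derivable f k x : smooth0 f -> U x -> derivable f x 'e_k.
Proof. by move=> [/(_ 1%N) [_ /(_ k) [h _]] _]; apply: h. Qed.

Lemma smooth0_cut_partial k f : smooth0 f -> smooth0 (cut_partial k f).
Proof.
move=> [sf f0]; split=> [d|x Ux]; last by rewrite /cut_partial /GRing.mul /= dom_indicF
  ?mul0r.
have [_ /(_ k) [_ h]] := sf d.+1.
by apply: classC_eq h => y Uy; rewrite /cut_partial {1}/GRing.mul /= dom_indicT ?mul1r.
Qed.

Lemma cut_partialE k f x : U x -> cut_partial k f x = partial k f x.
Proof. by move=> Ux; rewrite /cut_partial {1}/GRing.mul /= dom_indicT ?mul1r. Qed.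

Lemma cut_partialF k f x : ~ U x -> cut_partial k f x = 0.
Proof. by move=> Ux; rewrite -[LHS]/(dom_indic x * partial k f x) dom_indicF ?mul0r. Qed.

Lemma cut_partialD k f g : smooth0 f -> smooth0 g -> cut_partial k (f + g)
  = cut_partial k f + cut_partial k g.
Proof.
move=> hf hg; rewrite /cut_partial -mulrDr; apply: eq_smooth0 => x Ux.
1,2: by rewrite /GRing.mul /= dom_indicF ?mul0r.
rewrite /GRing.mul /= dom_indicT // !mul1r /partial deriveD //; exact: smooth0_derivable.
Qed.

Lemma cut_partialM k f g : smooth0 f -> smooth0 g -> cut_partial k (f * g)
  = cut_partial k f * g + f * cut_partial k g.
Proof.
move=> hf hg; apply: eq_smooth0 => x Ux.
- exact: cut_partialF.
- by rewrite -[LHS]/(cut_partial k f x * g x + f x * cut_partial k g x) !cut_partialF //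
  mul0r mulr0 addr0.
rewrite cut_partialE // /partial deriveM; [|exact: smooth0_derivable..].
by rewrite -[RHS]/(cut_partial k f x * g x + f x * cut_partial k g x) !cut_partialE //
  addrC [_ * g x]mulrC.
Qed.

Lemma cut_partial0 k : cut_partial k 0 = 0.
Proof.
have /eqP := cut_partialD k smooth0_0 smooth0_0.
by rewrite addr0 -subr_eq0 opprD addrA subrr sub0r oppr_eq0 => /eqP.
Qed.

End SmoothFunctions.

(** * Polynomials in the momenta over a chart domain *)

(** Stated for maps that are not morphisms, such as a partial derivative, which is
    not additive on arbitrary functions. *)
Lemma mcoeff_map_poly0 (n : nat) (K L : comNzRingType) (f : K -> L) (p : mpoly n K) m :
  f 0 = 0 -> mcoeff m (map_mpoly f p) = f (mcoeff m p).
Proof.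
move=> f0; rewrite /map_mpoly /mmap raddf_sum /=.
under eq_bigr => k _ do rewrite mmap1_id mcoeffCM mcoeffX.
case: (boolP (m \in msupp p)) => hm.
  rewrite (bigD1_seq m) ?msupp_uniq //= eqxx mulr1 big1 ?addr0 // => k /negPf nkm.
  by rewrite nkm mulr0.
rewrite big1_seq => [|k /= kp]; last first.
  case: eqP => [e|_]; last by rewrite mulr0.
  by rewrite e (negPf hm) in kp.
by move: hm; rewrite -mcoeff_eq0 => /eqP ->; rewrite f0.
Qed.

Lemma mul_map_mpoly (n : nat) (K : comNzRingType) (f g : K -> K) (p q : mpoly n K) :
  f 0 = 0 -> g 0 = 0 -> (forall m y, mcoeff m p * f y = mcoeff m p * g y) ->
  p * map_mpoly f q = p * map_mpoly g q.
Proof.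
move=> f0 g0 fg; apply/mpolyP => m; rewrite !mcoeffM; apply: eq_bigr => i _.
by rewrite !mcoeff_map_poly0 // fg.
Qed.

Section ChartJets.
Local Open Scope classical_set_scope.
Variables (R : realType) (n r : nat) (U : set 'rV[R]_n).
Hypothesis U_open : open U.
Local Notation K := (mpoly n ('rV[R]_n -> R)).
Implicit Types (p q : K) (k l : 'I_n).

Definition jdp k p : K := map_mpoly (cut_partial U k) p.
Definition jreg p := forall m, smooth0 U (mcoeff m p).

Lemma mcoeff_jdp k p m : mcoeff m (jdp k p) = cut_partial U k (mcoeff m p).
Proof. by rewrite mcoeff_map_poly0 // cut_partial0. Qed.

Lemma smooth0_sum I (s : seq I) (P : pred I) (f : I -> 'rV[R]_n -> R) :
  (forall i, P i -> smooth0 U (f i)) -> smooth0 U (\sum_(i <- s | P i) f i).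
Proof.
move=> h; elim/big_ind: _ => //; first exact: smooth0_0.
by move=> f1 f2; apply: smooth0D.
Qed.

Lemma cut_partial_sum k I (s : seq I) (P : pred I) (f : I -> 'rV[R]_n -> R) :
  (forall i, P i -> smooth0 U (f i)) ->
  cut_partial U k (\sum_(i <- s | P i) f i) = \sum_(i <- s | P i) cut_partial U k (f i).
Proof.
move=> h; elim: s => [|i s IH]; first by rewrite !big_nil cut_partial0.
rewrite !big_cons; case: ifP => // Pi.
by rewrite cut_partialD ?IH //; [apply: h | apply: smooth0_sum].
Qed.

Lemma smooth0Mn f m : smooth0 U f -> smooth0 U (f *+ m).
Proof.
move=> hf; elim: m => [|m IH]; first exact: smooth0_0.
by rewrite mulrS; apply: smooth0D.
Qed.

Lemma cut_partialMn k f m : smooth0 U f -> cut_partial U k (f *+ m)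
  = cut_partial U k f *+ m.
Proof.
move=> hf; elim: m => [|m IH]; first by rewrite !mulr0n cut_partial0.
by rewrite !mulrS cut_partialD ?IH //; apply: smooth0Mn.
Qed.

Lemma jreg0 : jreg 0.
Proof. by move=> m; rewrite mcoeff0; apply: smooth0_0. Qed.

Lemma jregD p q : jreg p -> jreg q -> jreg (p + q).
Proof. by move=> hp hq m; rewrite mcoeffD; apply: smooth0D. Qed.

Lemma jregN p : jreg p -> jreg (- p).
Proof. by move=> hp m; rewrite mcoeffN; apply: smooth0N. Qed.

Lemma jregM p q : jreg p -> jreg q -> jreg (p * q).
Proof.
by move=> hp hq m; rewrite mcoeffM; apply: smooth0_sum => i _; apply: smooth0M.
Qed.

Lemma jreg_mderiv k p : jreg p -> jreg (mderiv k p).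
Proof. by move=> hp m; rewrite mcoeff_deriv; apply: smooth0Mn. Qed.

Lemma jreg_jdp k p : jreg p -> jreg (jdp k p).
Proof. by move=> hp m; rewrite mcoeff_jdp; apply: smooth0_cut_partial. Qed.

Lemma jdpD k p q : jreg p -> jreg q -> jdp k (p + q) = jdp k p + jdp k q.
Proof.
move=> hp hq; apply/mpolyP => m.
rewrite [LHS]mcoeff_jdp (mcoeffD m p q) cut_partialD //.
rewrite -(mcoeff_jdp k p m) -(mcoeff_jdp k q m).
by symmetry; exact: mcoeffD.
Qed.

Lemma jdpM k p q : jreg p -> jreg q -> jdp k (p * q) = jdp k p * q + p * jdp k q.
Proof.
move=> hp hq; apply/mpolyP => m; rewrite mcoeffD mcoeff_jdp !mcoeffM.
rewrite cut_partial_sum => [|i _]; last exact: smooth0M.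
by rewrite -big_split; apply: eq_bigr => i _; rewrite cut_partialM // !mcoeff_jdp.
Qed.

Lemma mderiv_jdp k l p : jreg p -> mderiv k (jdp l p) = jdp l (mderiv k p).
Proof.
move=> hp; apply/mpolyP => m.
by rewrite mcoeff_deriv !mcoeff_jdp mcoeff_deriv cut_partialMn.
Qed.

Definition chart_jets : bideriv K n :=
  BiDeriv (fun k p q => mderivD k p q) (fun k p q => mderivM k p q)
    (fun k l p => mderiv_comm l k p)
    jreg0 jregD jregN jregM jreg_mderiv jreg_jdp jdpD jdpM mderiv_jdp.

Implicit Types (F H : Defs.sfun R n r).

(** Differentiation without a cut-off agrees with [jdp] on [U], and outside [U] the
    coefficients of [p] vanish. *)
Lemma mul_dpos p q k : jreg p ->
  p * map_mpoly (partial k) q = p * jdp k q.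
Proof.
move=> hp; apply: mul_map_mpoly => [| |m y].
- by apply/funext => x; rewrite /partial derive_cst.
- exact: cut_partial0.
apply/funext => x; case: (pselect (U x)) => Ux.
  by rewrite -[LHS]/(_ x * _ x) -[RHS]/(_ x * _ x) cut_partialE.
rewrite -[LHS]/(_ x * _ x) -[RHS]/(_ x * _ x).
by have [_ ->] := hp m; rewrite ?mul0r.
Qed.

(** In each product of the bracket, the factor that is not differentiated along the
    positions vanishes outside [U], so the derivatives may be cut off. *)
Lemma lbracket_bra F H : greg chart_jets F -> greg chart_jets H ->
  lbracket F H = bra chart_jets F H.
Proof.
move=> hF hH; rewrite /lbracket; apply: bra_intro => [k|c].
  have em (E : Defs.sfun R n r) A : dmom k E A = mderiv k (E A) := ffunE _ _.
  have ep (E : Defs.sfun R n r) A : dpos k E A = map_mpoly (partial k) (E A) := ffunE _ _.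
  have gm (E : Defs.sfun R n r) A : gdm chart_jets k E A = mderiv k (E A) := ffunE _ _.
  have gp (E : Defs.sfun R n r) A : gdp chart_jets k E A = jdp k (E A) := ffunE _ _.
  have eq1 : gmul (dmom k F) (dpos k H) = gmul (gdm chart_jets k F) (gdp chart_jets k H).
    apply: gmul_eq => A B.
    apply: etrans (f_equal2 *%R (em F A) (ep H B)) _.
    apply: etrans (esym (f_equal2 *%R (gm F A) (gp H B))).
    by apply: mul_dpos; apply: jreg_mderiv; apply: hF.
  have eq2 : gmul (dpos k F) (dmom k H) = gmul (gdp chart_jets k F) (gdm chart_jets k H).
    apply: gmul_eq => A B.
    apply: etrans (f_equal2 *%R (ep F A) (em H B)) _.
    apply: etrans (esym (f_equal2 *%R (gp F A) (gm H B))).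
    apply: etrans (mulrC _ _) _; apply: etrans (mulrC _ _).
    by apply: mul_dpos; apply: jreg_mderiv; apply: hH.
  exact: (f_equal2 (fun x y => x - y) eq1 eq2).
by rewrite !grdvE.
Qed.

End ChartJets.

(** * Bihomogeneous elements free of momenta *)
Section HamiltonianAlgebra.
Import mathcomp.boot.fintype mathcomp.boot.finset.
Variables (K : comNzRingType) (n r : nat) (J : bideriv K n).
Local Notation G := (grass K (r + r)).
Local Notation bra := (@bra K n r J).
Local Notation greg := (@greg K n r J).
Local Notation gdm := (@gdm K n r J).
Implicit Types (u v w h P Q : G) (A B : {set 'I_(r + r)}) (a b : 'I_(r + r)).

Definition momfree u := forall k, gdm k u = 0.

Definition ntheta A := #|[pred c : 'I_r | rshift r c \in A]|.
Definition nxi A := #|[pred c : 'I_r | lshift r c \in A]|.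

Lemma nthetaD A B : B \subset A -> ntheta A = (ntheta B + ntheta (A :\: B))%N.
Proof.
move=> sBA; rewrite /ntheta -cardUI (_ : #|[predI _ & _]| = 0%N) ?addn0.
  apply: eq_card => c; rewrite !inE; case cB: (rshift r c \in B) => //=.
  by rewrite (subsetP sBA).
by apply: eq_card0 => c; rewrite !inE; case: (rshift r c \in B).
Qed.

Lemma nxiD A B : B \subset A -> nxi A = (nxi B + nxi (A :\: B))%N.
Proof.
move=> sBA; rewrite /nxi -cardUI (_ : #|[predI _ & _]| = 0%N) ?addn0.
  apply: eq_card => c; rewrite !inE; case cB: (lshift r c \in B) => //=.
  by rewrite (subsetP sBA).
by apply: eq_card0 => c; rewrite !inE; case: (lshift r c \in B).
Qed.

Lemma card_theta_xi A : #|A| = (ntheta A + nxi A)%N.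
Proof.
have cardE (T : finType) (p : pred T) : #|p| = (\sum_x p x)%N.
  by rewrite -sum1_card big_mkcond; apply: eq_bigr => x _; rewrite unfold_in; case: (p x).
rewrite (cardE _ (mem A)) /ntheta /nxi !cardE big_split_ord addnC /=.
by congr (_ + _)%N; apply: eq_bigr => c _; rewrite ?inE.
Qed.

Definition isth a := if fintype.split a is inr _ then 1%N else 0%N.
Definition isxi a := if fintype.split a is inl _ then 1%N else 0%N.

Lemma isth_rshift (c : 'I_r) : isth (rshift r c) = 1%N.
Proof. by rewrite /isth (unsplitK (inr c : 'I_r + 'I_r)%type). Qed.
Lemma isth_lshift (c : 'I_r) : isth (lshift r c) = 0%N.
Proof. by rewrite /isth (unsplitK (inl c : 'I_r + 'I_r)%type). Qed.
Lemma isxi_rshift (c : 'I_r) : isxi (rshift r c) = 0%N.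
Proof. by rewrite /isxi (unsplitK (inr c : 'I_r + 'I_r)%type). Qed.
Lemma isxi_lshift (c : 'I_r) : isxi (lshift r c) = 1%N.
Proof. by rewrite /isxi (unsplitK (inl c : 'I_r + 'I_r)%type). Qed.

Lemma isth_isxi a : (isth a + isxi a = 1)%N.
Proof. by rewrite /isth /isxi; case: fintype.split. Qed.

Lemma isth_dual a : isth (dual a) = isxi a.
Proof.
rewrite -[a]splitK; case: (fintype.split a) => c /=.
  by rewrite dual_lshift isth_rshift isxi_lshift.
by rewrite dual_rshift isth_lshift isxi_rshift.
Qed.

Lemma isxi_dual a : isxi (dual a) = isth a.
Proof. by rewrite -{2}[a]dualK isth_dual. Qed.

Lemma ntheta1 a : ntheta [set a]%SET = isth a.
Proof.
rewrite -[a]splitK; case: (fintype.split a) => c /=.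
  by rewrite isth_lshift /ntheta eq_card0 // => d; rewrite !inE eq_rlshift.
rewrite isth_rshift /ntheta -(card1 c); apply: eq_card => d.
by rewrite !inE eq_rshift.
Qed.

Lemma nxi1 a : nxi [set a]%SET = isxi a.
Proof.
rewrite -[a]splitK; case: (fintype.split a) => c /=.
  rewrite isxi_lshift /nxi -(card1 c); apply: eq_card => d.
  by rewrite !inE eq_lshift.
by rewrite isxi_rshift /nxi eq_card0 // => d; rewrite !inE eq_lrshift.
Qed.

Lemma nthetaU1 a A : a \notin A -> ntheta (a |: A)%SET = (isth a + ntheta A)%N.
Proof.
move=> aA; rewrite (@nthetaD _ [set a]%SET) ?subsetUl // ntheta1 setDUl setDv set0U.
by rewrite setDE (setIidPl _) // subsetC sub1set inE.
Qed.

Lemma nxiU1 a A : a \notin A -> nxi (a |: A)%SET = (isxi a + nxi A)%N.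
Proof.
move=> aA; rewrite (@nxiD _ [set a]%SET) ?subsetUl // nxi1 setDUl setDv set0U.
by rewrite setDE (setIidPl _) // subsetC sub1set inE.
Qed.

Definition gdeg (k l : nat) u := forall A, u A != 0 -> ntheta A = k /\ nxi A = l.

Lemma gdeg_gpar k l u : gdeg k l u -> gpar (odd (k + l)) u.
Proof. by move=> du A /du [<- <-]; rewrite card_theta_xi. Qed.

Lemma gdeg0 k l : gdeg k l 0.
Proof. by move=> A; rewrite coef_grass0 eqxx. Qed.

Lemma gdegD k l u v : gdeg k l u -> gdeg k l v -> gdeg k l (u + v).
Proof.
move=> du dv A; rewrite coef_grassD; case: (eqVneq (u A) 0) => [->|nz _].
  by rewrite add0r => /dv.
exact: du.
Qed.

Lemma gdegN k l u : gdeg k l u -> gdeg k l (- u).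
Proof. by move=> du A; rewrite coef_grassN oppr_eq0 => /du. Qed.

Lemma gdeg_sum k l I (s : seq I) (P : pred I) (F : I -> G) :
  (forall i, P i -> gdeg k l (F i)) -> gdeg k l (\sum_(i <- s | P i) F i).
Proof. by move=> h; elim/big_ind: _ => //; [apply: gdeg0 | apply: gdegD]. Qed.

Lemma gdegM k l k' l' u v : gdeg k l u -> gdeg k' l' v ->
  gdeg (k + k') (l + l') (u * v).
Proof.
move=> du dv A; rewrite coef_grassM => nz.
have [B sBA] : exists2 B : {set 'I_(r + r)}, B \subset A & u B * v (A :\: B)%SET != 0.
  apply/exists_inP; apply: contraNT nz; rewrite negb_exists_in => /forall_inP h.
  by rewrite big1 // => B /h; rewrite negbK => /eqP ->; rewrite mulr0.
case: (eqVneq (u B) 0) => [->|uB]; first by rewrite mul0r eqxx.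
case: (eqVneq (v (A :\: B)%SET) 0) => [->|vB _]; first by rewrite mulr0 eqxx.
by rewrite (nthetaD sBA) (nxiD sBA); have [-> ->] := du _ uB; have [-> ->] := dv _ vB.
Qed.

Lemma gdeg_ginv k l u : gdeg k l u -> gdeg k l (ginv u).
Proof.
by move=> du A; rewrite ffunE => nz; apply: du; apply: contraNneq nz => ->; rewrite mulr0.
Qed.

Lemma gdeg_gldv k l a u : gdeg (isth a + k) (isxi a + l) u -> gdeg k l (gldv a u).
Proof.
move=> du A; rewrite ffunE; case: ifPn => aA nz; first by rewrite eqxx in nz.
have /du : u (a |: A)%SET != 0 by apply: contraNneq nz => ->; rewrite mulr0.
by rewrite nthetaU1 // nxiU1 // => -[/addnI -> /addnI ->].
Qed.

Lemma gdeg_gldv0 k l a u : gdeg k l u -> (k < isth a)%N || (l < isxi a)%N ->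
  gldv a u = 0.
Proof.
move=> du small; apply/ffunP=> A; rewrite coef_grass0 ffunE; case: ifPn => // aA.
case: (eqVneq (u (a |: A)%SET) 0) => [->|/du]; first by rewrite mulr0.
by rewrite nthetaU1 // nxiU1 // => -[ek el]; move: small; rewrite -ek -el; lia.
Qed.

Lemma bra_momfree u v : momfree u -> momfree v ->
  bra u v = \sum_a ginv (gldv a u) * gldv (dual a) v.
Proof.
move=> mu mv; rewrite bra_def big1 ?add0r // => k _.
by rewrite mu mv mul0r mulr0 subrr.
Qed.

(** Each term of the bracket removes one theta from a factor and one xi from the
    other. *)
Lemma gdeg_bra k l k' l' k2 l2 u v : momfree u -> momfree v ->
  gdeg k l u -> gdeg k' l' v ->
  (k2.+1 = k + k')%N -> (l2.+1 = l + l')%N -> gdeg k2 l2 (bra u v).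
Proof.
move=> mu mv du dv ek el; rewrite bra_momfree //; apply: gdeg_sum => a _.
case: (boolP ((k < isth a)%N || (l < isxi a)%N)) => [s1|n1].
  by rewrite (gdeg_gldv0 du s1) ginv0 mul0r; apply: gdeg0.
case: (boolP ((k' < isth (dual a))%N || (l' < isxi (dual a))%N)) => [s2|n2].
  by rewrite (gdeg_gldv0 dv s2) mulr0; apply: gdeg0.
move: n1 n2; rewrite !negb_or -!leqNgt isth_dual isxi_dual => /andP[h1 h2] /andP[h3 h4].
have := isth_isxi a => e.
have -> : k2 = ((k - isth a) + (k' - isxi a))%N by lia.
have -> : l2 = ((l - isxi a) + (l' - isth a))%N by lia.
apply: gdegM; first by apply/gdeg_ginv/gdeg_gldv; rewrite !subnKC.
by apply: gdeg_gldv; rewrite isth_dual isxi_dual !subnKC.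
Qed.

Lemma bra_eq0 k l k' l' u v : momfree u -> momfree v ->
  gdeg k l u -> gdeg k' l' v -> (k + k' = 0)%N \/ (l + l' = 0)%N -> bra u v = 0.
Proof.
move=> mu mv du dv small; rewrite bra_momfree // big1 // => a _.
have e := isth_isxi a; have eth := isth_dual a; have exi := isxi_dual a.
case: (boolP ((k < isth a)%N || (l < isxi a)%N)) => [s1|n1].
  by rewrite (gdeg_gldv0 du s1) ginv0 mul0r.
by rewrite (gdeg_gldv0 dv (a := dual a)) ?mulr0 // eth exi; move: n1; lia.
Qed.

(** Bidegree [(k, l)] in theta and xi.  Multivector fields and forms are of this
    kind; the structure element and its brackets may contain momenta. *)
Definition bihom k l u := [/\ greg u, momfree u & gdeg k l u].

Lemma momfree_bra u v : momfree u -> momfree v -> momfree (bra u v).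
Proof.
move=> mu mv x; rewrite bra_momfree // gdm_sum big1 // => a _.
by rewrite gdmM gdm_ginv !gdm_gldv mu mv !gldv0 ginv0 mul0r mulr0 addr0.
Qed.

Lemma bihom_bra k l k' l' k2 l2 u v : bihom k l u -> bihom k' l' v ->
  (k2.+1 = k + k')%N -> (l2.+1 = l + l')%N -> bihom k2 l2 (bra u v).
Proof.
move=> [ru mu du] [rv mv dv] ek el; split.
- exact: greg_bra.
- exact: momfree_bra.
- exact: gdeg_bra ek el.
Qed.

Lemma bihom_jacobi k l k' l' h u v : bihom k l h -> ~~ odd (k + l) -> bihom k' l' u ->
  greg v ->
  bra h (bra u v) = bra (bra h u) v + bra u (bra h v).
Proof.
move=> [rh mh dh] ev [ru mu du] rv; apply: jacobi => //; last by left.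
by rewrite -(negbTE ev); apply: gdeg_gpar.
Qed.

Lemma bihom_antisym k l h u : bihom k l h -> ~~ odd (k + l) -> bra u h = - bra h u.
Proof.
move=> [rh mh dh] ev; apply: bra_antisym => //.
by rewrite -(negbTE ev); apply: gdeg_gpar.
Qed.

Lemma bihom_braDr k l h u v : bihom k l h -> ~~ odd (k + l) ->
  bra h (u + v) = bra h u + bra h v.
Proof.
move=> [rh mh dh] ev; apply: braDr => //.
by rewrite -(negbTE ev); apply: gdeg_gpar.
Qed.

Lemma bihom_braNr k l h u : bihom k l h -> ~~ odd (k + l) -> bra h (- u) = - bra h u.
Proof.
move=> [rh mh dh] ev; apply: braNr => //.
by rewrite -(negbTE ev); apply: gdeg_gpar.
Qed.

Lemma bihom_bra0r k l h : bihom k l h -> ~~ odd (k + l) -> bra h 0 = 0.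
Proof.
move=> [rh mh dh] ev; apply: bra0r => //.
by rewrite -(negbTE ev); apply: gdeg_gpar.
Qed.

Lemma bihomN k l u : bihom k l u -> bihom k l (- u).
Proof.
move=> [ru mu du]; split; [exact: gregN | | exact: gdegN].
by move=> x; rewrite gdmN mu oppr0.
Qed.

Lemma bihomD k l u v : bihom k l u -> bihom k l v -> bihom k l (u + v).
Proof.
move=> [ru mu du] [rv mv dv]; split; [exact: gregD | | exact: gdegD].
by move=> x; rewrite gdmD mu mv addr0.
Qed.

End HamiltonianAlgebra.

(** * The square of the Hamiltonian of N *)

(** [o] stands for the indicator function of a chart domain, the unit of the
    coefficients that vanish outside it, and [l] for the constant lambda times
    that function. *)
Section Core.
Import mathcomp.boot.fintype mathcomp.boot.finset.
Variables (K : comNzRingType) (n r : nat) (J : bideriv K n) (o l : K).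
Hypothesis o_reg : reg J o.
Hypothesis o_id : forall x, reg J x -> o * x = x.
Hypothesis o_dm : forall k, dm J k o = 0.
Hypothesis l_reg : reg J l.
Hypothesis l_dm : forall k, dm J k l = 0.
Hypothesis l_dp : forall k, dp J k l = 0.
Hypothesis two_reg : forall x : K, x + x = 0 -> x = 0.
Local Notation G := (grass K (r + r)).
Local Notation bra := (@bra K n r J).
Local Notation greg := (@greg K n r J).
Local Notation gdm := (@gdm K n r J).
Local Notation bihom := (@bihom K n r J).
Local Notation gscal := (@gscal K (r + r)).
Implicit Types (u v w h P Q : G) (A B : {set 'I_(r + r)}) (a b : 'I_(r + r)).

Lemma grass_two_reg u : u + u = 0 -> u = 0.
Proof.
move=> uu; apply/ffunP=> A; rewrite coef_grass0; apply: two_reg.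
by rewrite -coef_grassD uu coef_grass0.
Qed.

Lemma gscal_o u : greg u -> gscal o * u = u.
Proof. by move=> ru; apply/ffunP=> A; rewrite coef_gscalM o_id. Qed.

(** For [c] equal to [o] this is the generator itself, made regular. *)
Definition sgen (c : K) a : G := gscal c * ggen a.

Lemma bihom_sgen c a : reg J c -> (forall k, dm J k c = 0) ->
  bihom (isth a) (isxi a) (sgen c a).
Proof.
move=> c_reg c_dm; split=> [A|k|A]; rewrite ?coef_gscalM ?ffunE.
- by case: eqP => _; rewrite ?mulr1 ?mulr0 //; apply: reg0.
- apply/ffunP=> A; rewrite coef_grass0 ffunE coef_gscalM ffunE.
  by case: eqP => _; rewrite ?mulr1 ?mulr0 ?dm0.
by case: (eqVneq A [set a]%SET) => [->|]; rewrite ?mulr0 ?eqxx // ntheta1 nxi1.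
Qed.

Lemma bihom_s a : bihom (isth a) (isxi a) (sgen o a).
Proof. exact: bihom_sgen. Qed.

Lemma bihom_vec (c : 'I_r) : bihom 1 0 (sgen o (rshift r c)).
Proof. by have := bihom_s (rshift r c); rewrite isth_rshift isxi_rshift. Qed.

Lemma bihom_cov (c : 'I_r) : bihom 0 1 (sgen o (lshift r c)).
Proof. by have := bihom_s (lshift r c); rewrite isth_lshift isxi_lshift. Qed.

Lemma bihom_veclam (c : 'I_r) : bihom 1 0 (sgen l (rshift r c)).
Proof. by have := bihom_sgen (rshift r c) l_reg l_dm; rewrite isth_rshift isxi_rshift. Qed.

Lemma bihom_covlam (c : 'I_r) : bihom 0 1 (sgen l (lshift r c)).
Proof. by have := bihom_sgen (lshift r c) l_reg l_dm; rewrite isth_lshift isxi_lshift. Qed.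

(** The bracket with a generator is the derivative along its conjugate. *)
Lemma bra_gen u a : greg u -> momfree J u -> bra u (sgen o (dual a)) = ginv (gldv a u).
Proof.
move=> ru mu; have [_ ms _] := bihom_s (dual a).
rewrite bra_momfree // (bigD1 a) //= big1 ?addr0 => [|b /negPf nba].
  rewrite gldv_scalM gldv_genE eqxx mulr1 -gscalC gscal_o //.
  exact/greg_ginv/greg_gldv.
by rewrite gldv_scalM gldv_genE (inj_eq (inv_inj (@dualK r))) nba !mulr0.
Qed.

Lemma gldv_ext u : u set0 = 0 -> (forall a, gldv a u = 0) -> u = 0.
Proof.
move=> u0 du; apply/ffunP=> A; rewrite coef_grass0.
case: (set_0Vmem A) => [-> //|[a aA]].
have := ggen_gldv a u; rewrite du mulr0 => /ffunP/(_ A).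
by rewrite coef_grass0 ffunE aA => <-.
Qed.

(** The brackets with the generators are all the odd derivatives, and these
    determine an element without constant term. *)
Lemma bra_ext p q u : (0 < p + q)%N -> bihom p q u ->
  (forall a, bra u (sgen o a) = 0) -> u = 0.
Proof.
move=> pq [ru mu du] hu; apply: gldv_ext => [|a].
  apply/eqP; apply: contraTT pq => /du [<- <-].
  by rewrite -card_theta_xi cards0.
by rewrite -[LHS]ginvK -bra_gen // hu ginv0.
Qed.

(** The bracket of [u] and [v], say of two vectors or of two covectors, vanishes by
    its bidegree, so the derivation rule makes the action of [h] skew. *)
Lemma bra_invariant k q k1 q1 k2 q2 h u v : bihom k q h -> ~~ odd (k + q) ->
  bihom k1 q1 u -> bihom k2 q2 v -> (k1 + k2 = 0)%N \/ (q1 + q2 = 0)%N ->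
  bra (bra h u) v = - bra u (bra h v).
Proof.
move=> hh ev hu hv small; have rv : greg v by case: hv.
have := bihom_jacobi hh ev hu rv.
have [_ mu du] := hu; have [_ mv dv] := hv.
rewrite (bra_eq0 mu mv du dv small) (bihom_bra0r hh ev).
by move=> /esym/eqP; rewrite addr_eq0 => /eqP.
Qed.

(** lambda times the Hamiltonian that counts theta minus xi. *)
Definition grading : G := \sum_(c < r) gscal l * (ggen (rshift r c) * ggen (lshift r c)).

Lemma coef_gen2 a b A :
  (ggen a * ggen b : G) A = 0 \/ exists m, (ggen a * ggen b : G) A = (-1) ^+ m.
Proof.
rewrite -gmulP gmul_gen ffunE; case: ifP => _; last by left.
rewrite ffunE; case: eqP => _; last by left; rewrite mulr0.
by right; rewrite mulr1; eexists.
Qed.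

Lemma greg_gen2 a b : greg (gscal l * (ggen a * ggen b)).
Proof.
move=> A; rewrite coef_gscalM; have [->|[m ->]] := coef_gen2 a b A.
  by rewrite mulr0; apply: reg0.
by rewrite mulrC; apply: reg_sign.
Qed.

Lemma gdp_gen2 k a b : gdp J k (gscal l * (ggen a * ggen b) : G) = 0.
Proof.
apply/ffunP=> A; rewrite ffunE coef_grass0 coef_gscalM.
have [->|[m ->]] := coef_gen2 a b A; first by rewrite mulr0 dp0.
by rewrite mulrC dp_sign // l_dp mulr0.
Qed.

Lemma gdm_gen2 k a b : gdm k (gscal l * (ggen a * ggen b) : G) = 0.
Proof.
apply/ffunP=> A; rewrite ffunE coef_grass0 coef_gscalM.
have [->|[m ->]] := coef_gen2 a b A; first by rewrite mulr0 dm0.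
by rewrite mulrC dm_sign // l_dm mulr0.
Qed.

Lemma gdeg_gen a : gdeg (isth a) (isxi a) (ggen a : G).
Proof.
move=> A; rewrite ffunE; case: (eqVneq A [set a]%SET) => [->|]; rewrite ?eqxx //.
by rewrite ntheta1 nxi1.
Qed.

Arguments gdeg_gen : clear implicits.

Lemma gdeg_scal k q c u : gdeg k q u -> gdeg k q (gscal c * u).
Proof. by move=> du A; rewrite coef_gscalM => nz; apply: du; apply: contraNneq nz => ->;
  rewrite mulr0. Qed.

Lemma bihom_grading : bihom 1 1 grading.
Proof.
split=> [|k|]; first by apply: greg_sum => c _; apply: greg_gen2.
  by rewrite gdm_sum big1 // => c _; apply: gdm_gen2.
apply: gdeg_sum => c _; apply: gdeg_scal.
have := gdegM (gdeg_gen (rshift r c)) (gdeg_gen (lshift r c)).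
by rewrite isth_rshift isxi_rshift isth_lshift isxi_lshift.
Qed.

Lemma gdp_grading k : gdp J k grading = 0.
Proof.
rewrite gdp_sum ?big1 // => c _; first exact: gdp_gen2.
exact: greg_gen2.
Qed.

Lemma gldv_theta_grading (c : 'I_r) : gldv (rshift r c) grading = sgen l (lshift r c).
Proof.
rewrite gldv_sum (bigD1 c) //= big1 ?addr0 => [|d /negPf ndc]; last first.
  rewrite gldv_scalM gldvM !gldv_genE eq_rlshift mulr0 addr0 eq_rshift eq_sym ndc.
  by rewrite mul0r mulr0.
by rewrite gldv_scalM gldvM !gldv_genE eq_rlshift mulr0 addr0 eqxx mul1r.
Qed.

Lemma gldv_xi_grading (c : 'I_r) : gldv (lshift r c) grading = - sgen l (rshift r c).
Proof.
rewrite gldv_sum (bigD1 c) //= big1 ?addr0 => [|d /negPf ndc]; last first.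
  rewrite gldv_scalM gldvM !gldv_genE eq_lrshift mul0r add0r eq_lshift eq_sym ndc.
  by rewrite !mulr0.
rewrite gldv_scalM gldvM !gldv_genE eq_lrshift mul0r add0r eqxx mulr1.
by rewrite ginv_gen mulrN.
Qed.

Lemma euler_theta u A : (\sum_(c < r) ggen (rshift r c) * gldv (rshift r c) u) A
  = (ntheta A)%:R * u A.
Proof.
rewrite sum_ffunE /ntheta -sum1_card natr_sum mulr_suml [RHS]big_mkcond /=.
by apply: eq_bigr => c _; rewrite ggen_gldv ffunE !inE mul1r.
Qed.

Lemma euler_xi u A : (\sum_(c < r) ggen (lshift r c) * gldv (lshift r c) u) A
  = (nxi A)%:R * u A.
Proof.
rewrite sum_ffunE /nxi -sum1_card natr_sum mulr_suml [RHS]big_mkcond /=.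
by apply: eq_bigr => c _; rewrite ggen_gldv ffunE !inE mul1r.
Qed.

(** Momenta count for nothing, as [l] has no position derivative; so every element
    of bidegree [(k, k + 1)], with momenta included, is an eigenvector. *)
Lemma bra_grading u : (forall A, u A != 0 -> (ntheta A).+1 = nxi A) ->
  bra grading u = - (gscal l * u).
Proof.
move=> hu; have [gr gm gd] := bihom_grading.
rewrite braE //; last exact: (gdeg_gpar gd).
rewrite big1 ?add0r => [|k _]; last by rewrite gdp_grading mul0r.
congr (- _); rewrite big_split_ord /=.
under eq_bigr => c _ do rewrite dual_lshift gldv_xi_grading mulNr -mulrA.
under [X in _ + X]eq_bigr => c _ do rewrite dual_rshift gldv_theta_grading -mulrA.
rewrite sumrN -!mulr_sumr -mulrN -mulrDr; congr (_ * _).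
apply/ffunP=> A; rewrite coef_grassD coef_grassN euler_theta euler_xi.
case: (eqVneq (u A) 0) => [->|/hu <-]; first by rewrite !mulr0 oppr0 addr0.
by rewrite -natr1; ring.
Qed.

Lemma bra_grading_vec (c : 'I_r) : bra grading (sgen o (rshift r c)) = sgen l (rshift r c).
Proof.
have [gr gm gd] := bihom_grading.
rewrite -dual_lshift bra_gen // gldv_xi_grading ginvN dual_lshift.
by rewrite ginvM ginv_scal ginv_gen mulrN opprK.
Qed.

Lemma bra_grading_cov (c : 'I_r) : bra grading (sgen o (lshift r c))
  = - sgen l (lshift r c).
Proof.
have [gr gm gd] := bihom_grading.
rewrite -dual_rshift bra_gen // gldv_theta_grading dual_rshift.
by rewrite ginvM ginv_scal ginv_gen mulrN.
Qed.

Lemma bra_cov_veclam (c d : 'I_r) :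
  bra (sgen o (lshift r c)) (sgen l (rshift r d))
    = bra (sgen l (lshift r c)) (sgen o (rshift r d)).
Proof.
have [_ m1 _] := bihom_cov c; have [_ m2 _] := bihom_vec d.
have [_ m3 _] := bihom_covlam c; have [_ m4 _] := bihom_veclam d.
rewrite !bra_momfree //; apply: eq_bigr => a _.
by rewrite !gldv_scalM !ginvM !ginv_scal !gldv_genE !gscal_mulACA mulrC.
Qed.

(** [e] and [f] play the part of the bivector and of the 2-form; then [bra h] is N on
    vectors, as [bra f] sends vectors to covectors and [bra e] covectors to
    vectors. *)
Section Structure.
Variables (e f mu : G).
Local Notation h := (bra e f).
Hypothesis e_bihom : bihom 2 0 e.
Hypothesis f_bihom : bihom 0 2 f.
Hypothesis h_square : forall c : 'I_r,
  bra h (bra h (sgen o (rshift r c))) = sgen l (rshift r c).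

Lemma h_bihom : bihom 1 1 h.
Proof. exact: bihom_bra e_bihom f_bihom _ _. Qed.

Lemma e_vec Y : bihom 1 0 Y -> bra e Y = 0.
Proof. by move=> [_ mY dY]; have [_ me de] := e_bihom; apply: bra_eq0 me mY de dY _;
  right. Qed.

Lemma f_cov Z : bihom 0 1 Z -> bra f Z = 0.
Proof. by move=> [_ mY dY]; have [_ me de] := f_bihom; apply: bra_eq0 me mY de dY _;
  left. Qed.

Lemma f_vec_bihom Y : bihom 1 0 Y -> bihom 0 1 (bra f Y).
Proof. by move=> hY; apply: bihom_bra f_bihom hY _ _. Qed.

Lemma e_cov_bihom Z : bihom 0 1 Z -> bihom 1 0 (bra e Z).
Proof. by move=> hZ; apply: bihom_bra e_bihom hZ _ _. Qed.

Lemma h_vec_bihom Y : bihom 1 0 Y -> bihom 1 0 (bra h Y).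
Proof. by move=> hY; apply: bihom_bra h_bihom hY _ _. Qed.

Lemma h_vec Y : bihom 1 0 Y -> bra h Y = bra e (bra f Y).
Proof.
move=> hY; have [rY _ _] := hY.
have := bihom_jacobi e_bihom isT f_bihom rY.
by rewrite (e_vec hY) (bihom_bra0r f_bihom isT) // addr0 => ->.
Qed.

Lemma h_cov Z : bihom 0 1 Z -> bra h Z = - bra f (bra e Z).
Proof.
move=> hZ; have [rZ _ _] := hZ.
have := bihom_jacobi e_bihom isT f_bihom rZ.
by rewrite (f_cov hZ) (bihom_bra0r e_bihom isT) // => /esym/eqP; rewrite addr_eq0 => /eqP.
Qed.

Local Notation he := (bra h e).
Local Notation u := (bra he f).

Lemma he_bihom : bihom 2 0 he.
Proof. exact: bihom_bra h_bihom e_bihom _ _. Qed.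

Lemma u_bihom : bihom 1 1 u.
Proof. exact: bihom_bra he_bihom f_bihom _ _. Qed.

Lemma he_cov Z : bihom 0 1 Z ->
  bra he Z = bra e (bra f (bra e Z)) + bra e (bra f (bra e Z)).
Proof.
move=> hZ; have [rZ _ _] := hZ.
have := bihom_jacobi h_bihom isT e_bihom rZ.
rewrite (h_vec (e_cov_bihom hZ)) (h_cov hZ) (bihom_braNr _ e_bihom isT) //.
by move/eqP; rewrite eq_sym subr_eq => /eqP.
Qed.

Lemma u_vec (c : 'I_r) : bra u (sgen o (rshift r c))
  = sgen l (rshift r c) + sgen l (rshift r c).
Proof.
have hY := bihom_vec c; set Y := sgen o _ in hY *; have [rY _ _] := hY.
have := bihom_jacobi he_bihom isT f_bihom rY.
have -> : bra he Y = 0.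
  by have [_ m1 d1] := he_bihom; have [_ m2 d2] := hY; apply: bra_eq0 m1 m2 d1 d2 _; right.
rewrite (bihom_bra0r f_bihom isT) // addr0 => <-.
rewrite (he_cov (f_vec_bihom hY)) -(h_vec hY) -(h_vec (h_vec_bihom hY)).
by rewrite h_square.
Qed.

(** The transpose of N also squares to lambda: since [bra f] and [bra e] are
    skew, its fourfold composite against a vector can be moved onto the vector. *)
Lemma fefe (c : 'I_r) : bra f (bra e (bra f (bra e (sgen o (lshift r c)))))
  = sgen l (lshift r c).
Proof.
have hX := bihom_cov c; set X := sgen o _ in hX *.
have h1 := e_cov_bihom hX; have h2 := f_vec_bihom h1; have h3 := e_cov_bihom h2.
have h4 := f_vec_bihom h3; have hl := bihom_covlam c.
have hw := bihomD h4 (bihomN hl); have [r4 m4 d4] := h4; have [rl ml dl] := hl.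
apply/eqP; rewrite -subr_eq0; apply/eqP; apply: (bra_ext _ hw) => // a.
rewrite braDl //; last exact: gregN.
rewrite braNl //.
rewrite -[a]splitK; case: (fintype.split a) => d /=.
  have [_ mx dx] := bihom_cov d.
  rewrite (bra_eq0 m4 mx d4 dx) ?(bra_eq0 ml mx dl dx) ?subrr //; by left.
have hY := bihom_vec d; set Y := sgen o _ in hY *.
have k1 := f_vec_bihom hY; have k2 := e_cov_bihom k1; have k3 := f_vec_bihom k2.
rewrite (bra_invariant f_bihom isT h3 hY (or_intror erefl)) (bra_invariant e_bihom isT
  h2 k1 (or_introl erefl)).
rewrite (bra_invariant f_bihom isT h1 k2 (or_intror erefl)) (bra_invariant e_bihom isT
  hX k3 (or_introl erefl)).
rewrite !opprK -(h_vec hY) -(h_vec (h_vec_bihom hY)) h_square.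
by rewrite bra_cov_veclam subrr.
Qed.

Lemma u_cov (c : 'I_r) : bra u (sgen o (lshift r c))
  = - (sgen l (lshift r c) + sgen l (lshift r c)).
Proof.
have hX := bihom_cov c; set X := sgen o _ in hX *; have [rX _ _] := hX.
have := bihom_jacobi he_bihom isT f_bihom rX.
rewrite (f_cov hX) (bihom_bra0r he_bihom isT) // (he_cov hX) (bihom_braDr _ _ f_bihom
  isT) // fefe.
by move/esym/eqP; rewrite addr_eq0 => /eqP.
Qed.

(** Both sides are quadratic in the odd generators, hence determined by their
    action on vectors and on covectors, where the assumption on the square of N
    makes them equal. *)
Lemma u_grading : u = grading + grading.
Proof.
have hg := bihomD bihom_grading bihom_grading; have hw := bihomD u_bihom (bihomN hg).
have [rg mg dg] := bihom_grading; have [rgg _ _] := hg; have [ru _ _] := u_bihom.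
apply/eqP; rewrite -subr_eq0; apply/eqP; apply: (bra_ext _ hw) => // a.
rewrite braDl //; last exact: gregN.
rewrite braNl // braDl //.
rewrite -[a]splitK; case: (fintype.split a) => d /=.
  by rewrite u_cov bra_grading_cov [- (_ + sgen _ _)]opprD subrr.
by rewrite u_vec bra_grading_vec subrr.
Qed.

Hypothesis mu_reg : greg mu.
Hypothesis mu_weight : forall A, mu A != 0 -> (ntheta A).+1 = nxi A.
Hypothesis eemu : bra e (bra e mu) = 0.
Hypothesis fmu : bra f mu = 0.
Hypothesis hfmu : bra (bra h f) mu = 0.

(** The three vanishing assumptions let the Jacobi identity rewrite every iterated
    bracket of [e], [f] and [h] with [mu] in terms of the single element
    [bra f (bra e (bra h mu))], which is the opposite of the wanted square.
    The same element is half of [bra u mu], and [u] is known by [u_grading]. *)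
Lemma h_square_mu : bra h (bra h mu) = gscal l * mu.
Proof.
have [re _ _] := e_bihom; have [rf _ _] := f_bihom; have [rh _ _] := h_bihom.
have r1 : greg (bra e mu) by apply: greg_bra.
have r2 : greg (bra h mu) by apply: greg_bra.
have hmu : bra h mu = - bra f (bra e mu).
  have := bihom_jacobi e_bihom isT f_bihom mu_reg.
  rewrite fmu (bihom_bra0r e_bihom isT) // => /esym/eqP.
  by rewrite addr_eq0 => /eqP.
have fhmu : bra f (bra h mu) = 0.
  have := bihom_jacobi h_bihom isT f_bihom mu_reg.
  by rewrite fmu (bihom_bra0r h_bihom isT) // hfmu add0r => <-.
have hemu : bra h (bra e mu) = - bra e (bra h mu).
  have := bihom_jacobi e_bihom isT f_bihom r1.
  rewrite eemu (bihom_bra0r f_bihom isT) addr0 => <-.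
  by rewrite hmu (bihom_braNr _ e_bihom isT) // opprK.
have hehmu : bra he mu = - (bra e (bra h mu) + bra e (bra h mu)).
  have := bihom_jacobi h_bihom isT e_bihom mu_reg.
  by rewrite hemu => /eqP; rewrite -subr_eq => /eqP <-; rewrite opprD.
have umu : bra u mu = bra f (bra e (bra h mu)) + bra f (bra e (bra h mu)).
  have := bihom_jacobi he_bihom isT f_bihom mu_reg.
  rewrite fmu (bihom_bra0r he_bihom isT) // hehmu (bihom_braNr _ f_bihom isT) //
    (bihom_braDr _ _ f_bihom isT) //.
  by move/esym/eqP; rewrite subr_eq0 => /eqP.
have hhmu : bra h (bra h mu) = - bra f (bra e (bra h mu)).
  have := bihom_jacobi e_bihom isT f_bihom r2.
  rewrite fhmu (bihom_bra0r e_bihom isT) // => /esym/eqP.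
  by rewrite addr_eq0 => /eqP.
have [rg _ _] := bihom_grading.
move: umu; rewrite u_grading braDl // bra_grading // -[bra f _]opprK -hhmu -!opprD.
move/oppr_inj => E; apply/eqP; rewrite -subr_eq0; apply/eqP; apply: grass_two_reg.
by rewrite addrACA -E -opprD subrr.
Qed.

End Structure.
End Core.

(** * Two-forms *)
Section TwoForms.
Import mathcomp.boot.fintype mathcomp.boot.finset.
Variables (K : comNzRingType) (n r : nat) (J : bideriv K n) (o : K).
Hypothesis o_reg : reg J o.
Hypothesis o_id : forall x, reg J x -> o * x = x.
Hypothesis o_dm : forall k, dm J k o = 0.
Hypothesis two_reg : forall x : K, x + x = 0 -> x = 0.
Local Notation G := (grass K (r + r)).
Local Notation bra := (@bra K n r J).
Local Notation greg := (@greg K n r J).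
Local Notation gdm := (@gdm K n r J).
Local Notation bihom := (@bihom K n r J).
Local Notation gscal := (@gscal K (r + r)).
Local Notation X c := (lshift r c).
Local Notation t c := (sgen o (rshift r c)).
Implicit Types (u v w h P Q : G) (A B : {set 'I_(r + r)}) (a b c : 'I_r).

Lemma gdeg_euler_xi q w : gdeg 0 q w -> \sum_(c < r) ggen (X c) * gldv (X c) w = w *+ q.
Proof.
move=> dw; apply/ffunP=> A; rewrite euler_xi.
have -> : (w *+ q) A = w A *+ q.
  by elim: q {dw} => [|q IH]; rewrite ?mulr0n ?coef_grass0 // !mulrS coef_grassD IH.
by case: (eqVneq (w A) 0) => [->|/dw[_ ->]]; rewrite ?mul0rn ?mulr0 // mulr_natl.
Qed.

(** Euler identity in xi, applied twice, gives twice the sum over ordered pairs. *)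
Lemma two_form_expansion w : gdeg 0 2 w ->
  w = \sum_(a < r) \sum_(b < r | (a < b)%N) gldv (X b) (gldv (X a) w) * (ggen (X a) *
    ggen (X b)).
Proof.
move=> dw; set sw := RHS.
pose F a b : G := ggen (X a) * (ggen (X b) * gldv (X b) (gldv (X a) w)).
have d1 a : gdeg 0 1 (gldv (X a) w) by apply: gdeg_gldv; rewrite isth_lshift isxi_lshift.
have ww : w + w = \sum_(a < r) \sum_(b < r) F a b.
  rewrite -mulr2n -(gdeg_euler_xi dw); apply: eq_bigr => a _.
  by rewrite -{1}[gldv (X a) w]mulr1n -(gdeg_euler_xi (d1 a)) mulr_sumr.
have FC a b : F a b = F b a.
  by rewrite /F gldvAC !mulrN -!gmulP ggenAC opprK.
have Faa a : F a a = 0.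
  apply: (grass_two_reg two_reg); rewrite /F -!gmulP {1}ggenAC.
  exact: addNr.
have SF : sw = \sum_(a < r) \sum_(b < r | (a < b)%N) F a b.
  apply: eq_bigr => a _; apply: eq_bigr => b _; rewrite /F [RHS]mulrA.
  have pw : gpar false (gldv (X b) (gldv (X a) w)).
    exact: gpar_gldv (gpar_gldv _ (gdeg_gpar dw)).
  by rewrite (gpar_comm _ pw).
apply/eqP; rewrite -subr_eq0; apply/eqP; apply: (grass_two_reg two_reg).
rewrite addrACA -opprD ww; apply/eqP; rewrite subr_eq0; apply/eqP.
rewrite {2}SF [Z in sw + Z](exchange_big_dep xpredT) //= {1}SF -big_split;
  apply: eq_bigr => a _ /=.
rewrite (bigID (fun b : 'I_r => (a < b)%N)) /=; congr (_ + _).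
rewrite (bigD1 a) ?ltnn //= Faa add0r; apply: eq_big => [b|b _]; last exact: FC.
by rewrite -leqNgt [RHS]ltn_neqAle andbC.
Qed.

Lemma greg_mul_gen v (b : 'I_(r + r)) : greg v -> v * ggen b = v * sgen o b :> G.
Proof. by move=> rv; rewrite /sgen mulrA -gscalC (gscal_o o_id). Qed.

Lemma gdm_gen k (b : 'I_(r + r)) : gdm k (ggen b) = 0.
Proof.
apply/ffunP=> A; rewrite coef_grass0 !ffunE; case: eqP => _ /=; last exact: dm0.
have /eqP := dmM J k 1 1; rewrite !mulr1 mul1r -subr_eq0 opprD addrA subrr sub0r oppr_eq0.
by move/eqP.
Qed.

Section NijenhuisForm.
Variables (e f : G).
Local Notation h := (bra e f).
Hypothesis e_bihom : bihom 2 0 e.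
Hypothesis f_bihom : bihom 0 2 f.

(** The coefficient of the form omega_N on the pair of theta^a and theta^b. *)
Definition omN_coef a b : G := bra (bra (bra (bra (t a) f) e) f) (t b).

Definition omN : G := \sum_(a < r) \sum_(b < r | (a < b)%N) omN_coef a b * (ggen (X a) *
  ggen (X b)).

Lemma bihom_t c : bihom 1 0 (t c).
Proof. exact: bihom_vec. Qed.

(** Composing the two musical maps, defined by brackets with [f] and [e] on the
    right, is acting by [h] on the left: the two signs cancel. *)
Lemma sharp_flat Y : bihom 1 0 Y -> bra (bra Y f) e = bra h Y.
Proof.
move=> hY.
rewrite (bihom_antisym _ f_bihom isT) (bihom_antisym _ e_bihom isT) (bihom_braNr _
  e_bihom isT) opprK.
by rewrite (h_vec e_bihom f_bihom hY).
Qed.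

Lemma omN_coefE a b : omN_coef a b = - bra (bra f (bra h (t a))) (t b).
Proof.
rewrite /omN_coef (sharp_flat (bihom_t a)) (bihom_antisym _ f_bihom isT) braNl //.
have [rf _ _] := f_bihom; have [re _ _] := e_bihom; have [rt _ _] := bihom_t a.
by do !apply: greg_bra.
Qed.

Lemma bihom_omN_coef a b : bihom 0 0 (omN_coef a b).
Proof.
rewrite omN_coefE; apply: bihomN; apply: (bihom_bra (k:=0) (l:=1)) (bihom_t b) _ _ => //.
by apply: f_vec_bihom => //; apply: h_vec_bihom => //; apply: bihom_t.
Qed.

Lemma bihom_omN : bihom 0 2 omN.
Proof.
split=> [|k|].
- apply: greg_sum => a _; apply: greg_sum => b _; have [rb _ _] := bihom_omN_coef a b.
  have [ra _ _] := bihom_s o_reg o_dm (X a); have [rb' _ _] := bihom_s o_reg o_dm (X b).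
  have g2 := gregM rb ra.
  by rewrite mulrA (greg_mul_gen _ rb) (greg_mul_gen _ g2); apply: gregM.
- rewrite gdm_sum big1 // => a _; rewrite gdm_sum big1 // => b _.
  have [_ mb _] := bihom_omN_coef a b.
  by rewrite !gdmM mb !gdm_gen !mul0r !mulr0 addr0 mulr0 addr0.
apply: gdeg_sum => a _; apply: gdeg_sum => b _; have [_ _ db] := bihom_omN_coef a b.
have := gdegM db (gdegM (@gdeg_gen K r (X a)) (@gdeg_gen K r (X b))).
by rewrite !isth_lshift !isxi_lshift.
Qed.

(** Since N is symmetric with respect to [f], inserting N in either slot of the form
    has the same effect, and the action of [h] on [f], which inserts it in
    both, is twice omega_N up to sign. *)
Lemma bra_h_f : bra h f = - (omN + omN).
Proof.
have hh : bihom 1 1 h := h_bihom e_bihom f_bihom.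
have hw : bihom 0 2 (bra h f) by apply: bihom_bra hh f_bihom _ _.
have [rw mw dw] := hw.
rewrite (two_form_expansion dw) /omN -big_split -sumrN; apply: eq_bigr => a _ /=.
rewrite -big_split -sumrN; apply: eq_bigr => b _ /=.
rewrite -mulrDl -mulNr; congr (_ * _).
have ha := bihom_t a; have hb := bihom_t b; have [ra _ _] := ha.
have hv := f_vec_bihom f_bihom (h_vec_bihom e_bihom f_bihom ha); have [rv mv dv] := hv.
have w_t : bra (bra h f) (t a) = - (bra f (bra h (t a)) + bra f (bra h (t a))).
  have := bihom_jacobi hh isT f_bihom ra.
  rewrite (h_cov e_bihom f_bihom (f_vec_bihom f_bihom ha)) -(h_vec e_bihom f_bihom ha).
  by move/eqP; rewrite -subr_eq => /eqP <-; rewrite opprD.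
have rg u c : greg u -> momfree J u -> bra u (t c) = ginv (gldv (X c) u).
  by move=> ru mu; rewrite -[rshift r c]dual_lshift (bra_gen o_reg o_id o_dm).
have wab : bra (bra (bra h f) (t a)) (t b) = - gldv (X b) (gldv (X a) (bra h f)).
  have [_ mt _] := ha.
  rewrite rg; [|exact: greg_bra|exact: momfree_bra].
  by rewrite (rg _ _ rw mw) gldv_ginv ginvN ginvK.
rewrite -[LHS]opprK -wab w_t braNl; last exact: gregD.
by rewrite braDl // !omN_coefE -opprD !opprK.
Qed.

Lemma closed_omN mu : bra mu omN = 0 -> bra (bra h f) mu = 0.
Proof.
have hN := bihom_omN; have [rN _ _] := hN.
rewrite (bihom_antisym _ hN isT) => /eqP; rewrite oppr_eq0 => /eqP closed.
by rewrite bra_h_f braNl ?braDl ?closed ?addr0 ?oppr0 //; apply: gregD.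
Qed.

End NijenhuisForm.
End TwoForms.

(** * Sections and derived brackets *)
Section Sections.
Variables (K : comNzRingType) (n r : nat) (J : bideriv K n).
Local Notation G := (grass K (r + r)).
Local Notation bra := (@bra K n r J).
Local Notation greg := (@greg K n r J).
Local Notation gdm := (@gdm K n r J).
Local Notation bihom := (@bihom K n r J).
Implicit Types (u v w h P Q : G).

Definition section_like P := momfree J P /\ forall c : 'I_r, gldv (lshift r c) P = 0.

(** Total degree at most [m] in the momenta and xi, expressed by derivatives.  Each
    bracket with a section lowers this degree by one, so that it controls the
    derived bracket of elements that contain momenta. *)
Fixpoint section_after m u : Prop :=
  if m is m'.+1 then
    (forall k, section_after m' (gdm k u)) /\ (forall c : 'I_r,
      section_after m' (gldv (lshift r c) u))
  else section_like u.

Lemma bihom_section_like p P : bihom p 0 P -> section_like P.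
Proof.
move=> [_ mP dP]; split=> // c; apply: gdeg_gldv0 dP _.
by rewrite isxi_lshift orbT.
Qed.

Lemma section_like0 : section_like 0.
Proof. by split=> [k|c]; rewrite ?gdm0 ?gldv0. Qed.

Lemma section_likeD u v : section_like u -> section_like v -> section_like (u + v).
Proof. by move=> [mu xu] [mv xv]; split=> [k|c]; rewrite ?gdmD ?gldvD ?mu ?mv ?xu ?xv
  addr0. Qed.

Lemma section_likeN u : section_like u -> section_like (- u).
Proof. by move=> [mu xu]; split=> [k|c]; rewrite ?gdmN ?gldvN ?mu ?xu oppr0. Qed.

Lemma section_after0 m : section_after m 0.
Proof.
elim: m => [|m IH]; first exact: section_like0.
by split=> [k|c]; rewrite ?gdm0 ?gldv0.
Qed.

Lemma section_afterD m u v : section_after m u -> section_after m v ->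
  section_after m (u + v).
Proof.
elim: m u v => [|m IH] u v /=; first exact: section_likeD.
by move=> [mu xu] [mv xv]; split=> [k|c]; rewrite ?gdmD ?gldvD; apply: IH.
Qed.

Lemma section_afterN m u : section_after m u -> section_after m (- u).
Proof.
elim: m u => [|m IH] u /=; first exact: section_likeN.
by move=> [mu xu]; split=> [k|c]; rewrite ?gdmN ?gldvN; apply: IH.
Qed.

Lemma section_after_sum m I (s : seq I) (p : pred I) (F : I -> G) :
  (forall i, p i -> section_after m (F i)) -> section_after m (\sum_(i <- s | p i) F i).
Proof. by move=> hF; elim/big_ind: _ => //; [apply: section_after0 | apply:
  section_afterD]. Qed.

Lemma section_after_ginv m u : section_after m u -> section_after m (ginv u).
Proof.
elim: m u => [|m IH] u /=.
  by move=> [mu xu]; split=> [k|c]; rewrite ?gdm_ginv ?gldv_ginv ?mu ?xu ginv0 ?oppr0.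
move=> [mu xu]; split=> [k|c]; rewrite ?gdm_ginv ?gldv_ginv.
  exact: IH.
by apply/section_afterN/IH.
Qed.

Lemma section_after_mul m u P : section_after m u -> section_like P ->
  section_after m (u * P).
Proof.
move=> hu [mP xP]; elim: m u hu => [|m IH] u /=.
  by move=> [mu xu]; split=> [k|c]; rewrite ?gdmM ?gldvM ?mP ?xP ?mu ?xu mul0r mulr0 addr0.
move=> [mu xu]; split=> [k|c]; rewrite ?gdmM ?gldvM ?mP ?xP mulr0 addr0.
  exact: IH.
exact: IH.
Qed.

Lemma section_like_gdp k P : greg P -> section_like P -> section_like (gdp J k P).
Proof.
move=> rP [mP xP]; split=> [i|c]; first by rewrite gdmp // mP gdp0.
by rewrite -gdp_gldv // xP gdp0.
Qed.

Lemma section_like_gldv (d : 'I_r) P : section_like P -> section_like (gldv (rshift r d) P).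
Proof.
move=> [mP xP]; split=> [i|c]; first by rewrite gdm_gldv mP gldv0.
by rewrite gldvAC xP gldv0 oppr0.
Qed.

Lemma section_after_bra m u P : greg P -> section_after m.+1 u -> section_like P ->
  section_after m (bra u P).
Proof.
move=> rP [mu xu] hP; have [mP xP] := hP; rewrite (bra_section _ mP xP);
  apply: section_afterD.
  apply: section_after_sum => k _; apply: section_after_mul (mu k) _;
    exact: section_like_gdp.
apply: section_after_sum => c _; apply: section_after_mul;
  first exact/section_after_ginv/xu.
exact: section_like_gldv.
Qed.

(** The element [h] acts on sections algebraically, without differentiating them. *)
Lemma bra_even_section h P : momfree J h -> section_like P ->
  bra h P = \sum_(c < r) ginv (gldv (lshift r c) h) * gldv (rshift r c) P.
Proof.
move=> mh [mP xP]; rewrite (bra_section _ mP xP) big1 ?add0r // => k _.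
by rewrite mh mul0r.
Qed.

(** Since [bra h] is a derivation of the bracket, the derived bracket of [mu] is
    transported by it up to the derived bracket of [bra h mu]; [derived_sym] puts
    the term with [Q] first into the same order as the others. *)
Lemma derived_vbracket h mu p q P Q : bihom 1 1 h -> greg mu -> bihom p 0 P ->
  bihom q 0 Q ->
  bra (bra mu (bra h P)) Q + (-1) ^+ (odd p && odd q) * bra (bra mu (bra h Q)) P
    - bra h (bra (bra mu P) Q)
  = - bra (bra (bra h mu) P) Q.
Proof.
move=> hh rmu hP hQ.
have hjP : bihom p 0 (bra h P) := bihom_bra hh hP erefl erefl.
have hjQ : bihom q 0 (bra h Q) := bihom_bra hh hQ erefl erefl.
have [rh mh dh] := hh; have [rP mP dP] := hP; have [rQ mQ dQ] := hQ.
have [rjP mjP djP] := hjP; have [rjQ mjQ djQ] := hjQ.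
have [_ xP] := bihom_section_like hP; have [_ xjQ] := bihom_section_like hjQ.
have ph : gpar false h := gdeg_gpar dh.
have pP : gpar (odd p) P by move: (gdeg_gpar dP); rewrite addn0.
have pjQ : gpar (odd q) (bra h Q) by move: (gdeg_gpar djQ); rewrite addn0.
rewrite -(derived_sym _ rP rjQ pP pjQ mP mjQ xP xjQ).
rewrite (jacobi rh ph mh (greg_bra rmu rP) rQ (or_intror mQ)).
rewrite (jacobi rh ph mh rmu rP (or_intror mP)).
rewrite braDl; [|by do !apply: greg_bra..].
by rewrite opprD addrACA subrr addr0 opprD addrCA subrr addr0.
Qed.

End Sections.

(** * Linear substitutions of the odd generators *)
Section GrassmannMorphism.
Import mathcomp.boot.fintype mathcomp.boot.finset.
Variables (K : comNzRingType) (t : nat) (M : 'I_t -> 'I_t -> K).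
Local Notation G := (grass K t).
Local Notation gscal := (@gscal K t).
Local Notation sgn := (@gsign K t).
Implicit Types (u v : G) (A B : {set 'I_t}) (a b : 'I_t).

Definition lin a : G := \sum_c gscal (M a c) * ggen c.

Definition gmorph u : G := \sum_(A : {set 'I_t}) gscal (u A) * \prod_(a in A) lin a.

Lemma lin_mulC a b : lin a * lin b = - (lin b * lin a).
Proof.
rewrite /lin mulr_suml; under eq_bigr do rewrite mulr_sumr.
rewrite exchange_big mulr_suml -sumrN; apply: eq_bigr => d _.
rewrite mulr_sumr -sumrN; apply: eq_bigr => c _.
rewrite !gscal_mulACA mulrC -mulrN; congr (_ * _).
exact: ggen_mulC.
Qed.

(** Anticommutation alone only gives that twice the square vanishes, which does not
    suffice over an arbitrary ring; the terms cancel in pairs instead. *)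
Lemma lin_sq a : lin a * lin a = 0.
Proof.
have gg0 c : ggen c * ggen c = 0 :> G.
  apply/ffunP=> A; rewrite coef_grass0 -gmulP gmul_gen ffunE; case: ifP => // cA.
  rewrite ffunE; case: eqP => e; last by rewrite mulr0.
  by have := set11 c; rewrite -e !inE eqxx.
pose F c d := gscal (M a c * M a d) * (ggen c * ggen d).
have -> : lin a * lin a = \sum_c \sum_d F c d.
  rewrite /lin mulr_suml; apply: eq_bigr => c _; rewrite mulr_sumr.
  by apply: eq_bigr => d _; rewrite gscal_mulACA.
have FN c d : F c d = - F d c by rewrite /F ggen_mulC mulrN mulrC.
have F0 c : F c c = 0 by rewrite /F gg0 mulr0.
transitivity (\sum_(c < t) (\sum_(d < t | (d < c)%N) F c d + \sum_(d < t | (c < d)%N) F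
  c d)).
  apply: eq_bigr => c _; rewrite (bigD1 c) //= F0 add0r.
  rewrite (bigID (fun d : 'I_t => (d < c)%N)) /=; congr (_ + _); apply: eq_bigl => d.
    by rewrite -(inj_eq val_inj) /= neq_ltn; case: ltngtP.
  by rewrite -(inj_eq val_inj) /= neq_ltn; case: ltngtP.
rewrite big_split /= [X in _ + X](exchange_big_dep xpredT) //= -big_split big1 // => c _ /=.
rewrite -big_split big1 // => d _ /=.
by rewrite FN addNr.
Qed.

(** Products over a set run through the generators in increasing order; this
    isolates the place of one of them. *)
Lemma ord_enum_split a : exists e1 e2, index_enum 'I_t = e1 ++ a :: e2 :> seq 'I_t /\
  (forall c, c \in e1 -> (c < a)%N) /\ (forall c, c \in e2 -> (a < c)%N).
Proof.
have ha : a \in index_enum 'I_t by rewrite mem_index_enum.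
have srt : sorted ltn (map val (index_enum 'I_t)).
  have -> : map val (index_enum 'I_t) = iota 0 t.
    by rewrite -val_enum_ord enumT.
  exact: iota_ltn_sorted.
case/splitPr: ha srt => e1 e2; rewrite map_cat /= => srt; exists e1, e2; split=> //.
move: srt; rewrite (sorted_pairwise ltn_trans) pairwise_cat /= => /and3P[h _ /andP[h2 _]].
split=> c hc.
  exact: (allrelP h _ _ (map_f val hc) (mem_head _ _)).
exact: (allP h2 _ (map_f val hc)).
Qed.

(** Moving the linear form to its place in the ordered product crosses exactly the
    factors of smaller index, which is the sign of the Grassmann product. *)
Lemma lin_mul_prod a B :
  lin a * \prod_(b in B) lin b
  = if a \in B then 0 else gscal (sgn [set a] B) * \prod_(b in a |: B) lin b.
Proof.
have [e1 [e2 [ee [l1 l2]]]] := ord_enum_split a.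
have comm s : lin a * \prod_(b <- s | b \in B) lin b
    = (-1) ^+ (count (mem B) s) * (\prod_(b <- s | b \in B) lin b * lin a).
  elim: s => [|c s IH]; first by rewrite big_nil mulr1 !mul1r.
  rewrite big_cons /=; case: ifP => cB; last by rewrite add0n IH.
  set p := \prod_(b <- s | _) _ in IH *.
  have -> : lin a * (lin c * p) = - (lin c * (lin a * p)) by rewrite !mulrA lin_mulC mulNr.
  rewrite IH exprS mulN1r !mulNr; congr (- _).
  by rewrite !mulrA commr_sign.
have a1 : a \notin e1 by apply/negP => /l1; rewrite ltnn.
have a2 : a \notin e2 by apply/negP => /l2; rewrite ltnn.
rewrite ee big_cat big_cons /= mulrA comm.
case: ifP => aB.
  by rewrite -!mulrA (mulrA (lin a) (lin a)) lin_sq mul0r !mulr0.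
rewrite big_cat big_cons !inE eqxx /=.
have drop_a s : a \notin s -> \prod_(b <- s | b \in a |: B) lin b
  = \prod_(b <- s | b \in B) lin b.
  move=> nas; rewrite big_seq_cond [RHS]big_seq_cond; apply: eq_bigl => b.
  case bs: (b \in s) => //=; rewrite !inE; case: eqP => // e.
  by rewrite e (negPf nas) in bs.
rewrite !drop_a // !mulrA; congr (_ * _ * _ * _).
rewrite gsign_prod big_set1 (eq_bigl (fun c => c \in B)) // ee big_cat big_cons aB /=.
rewrite [X in _ * X]big1_seq ?mulr1 => [|c /andP[_ /l2 ac]]; last by rewrite ltnNge ltnW.
have -> : \prod_(c <- e1 | c \in B) (-1) ^+ (c < a)%N = (-1) ^+ count (mem B) e1 :> K.
  elim: e1 l1 {ee a1} => [|c s IH] l1; first by rewrite big_nil.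
  rewrite big_cons /= IH => [|d ds]; last by apply: l1; rewrite inE ds orbT.
  by case: ifP => cB; rewrite ?add0n // l1 ?mem_head // -exprD.
elim: (count _ _) => [|m IH]; first by rewrite !expr0.
by rewrite !exprS IH gscalMM; congr (_ * _); apply/ffunP=> A;
  rewrite coef_grassN !ffunE; case: ifP; rewrite ?oppr0.
Qed.

Lemma gmorphD u v : gmorph (u + v) = gmorph u + gmorph v.
Proof.
rewrite -big_split; apply: eq_bigr => A _ /=.
by rewrite coef_grassD gscalD mulrDl.
Qed.

Lemma gmorphZ c u : gmorph (gscal c * u) = gscal c * gmorph u.
Proof.
rewrite mulr_sumr; apply: eq_bigr => A _.
by rewrite coef_gscalM gscalMM mulrA.
Qed.

Lemma gmorph_scal c : gmorph (gscal c) = gscal c.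
Proof.
rewrite /gmorph (bigD1 set0) //= [X in _ + X]big1 ?addr0 => [|A /negPf nA].
  rewrite ffunE eqxx -[RHS]mulr1; congr (_ * _); apply: big1 => b.
  by rewrite inE.
by rewrite ffunE nA gscal0 mul0r.
Qed.

Lemma gmorph0 : gmorph 0 = 0.
Proof. by rewrite -gscal0 gmorph_scal gscal0. Qed.

Lemma gmorph_sum I (s : seq I) (P : pred I) (F : I -> G) :
  gmorph (\sum_(i <- s | P i) F i) = \sum_(i <- s | P i) gmorph (F i).
Proof. exact: (big_morph _ gmorphD gmorph0). Qed.

Lemma gmorphN u : gmorph (- u) = - gmorph u.
Proof. by apply/eqP; rewrite -addr_eq0 -gmorphD addNr gmorph0. Qed.

Lemma gmorph_gen a u : gmorph (ggen a * u) = lin a * gmorph u.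
Proof.
rewrite /gmorph mulr_sumr.
have cg A : (ggen a * u : G) A = if a \in A then sgn [set a] (A :\ a) * u (A :\ a) else 0.
  by rewrite -gmulP gmul_gen ffunE.
under [RHS]eq_bigr => B _ do rewrite mulrA -gscalC -mulrA lin_mul_prod.
rewrite (bigID (fun A : {set 'I_t} => a \in A)) /= [X in _ + X]big1 ?addr0 => [|A aA];
  last first.
  by rewrite cg (negPf aA) gscal0 mul0r.
rewrite [RHS](bigID (fun A : {set 'I_t} => a \in A)) /= [X in _
  = X + _]big1 ?add0r => [|A aA]; last first.
  by rewrite aA mulr0.
rewrite (reindex_onto (fun B : {set 'I_t} => a |: B) (fun A : {set 'I_t} => A :\ a)) /=;
  last by move=> A; apply: setD1K.
apply: eq_big => [B|B /andP[_ /eqP aB]].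
  rewrite setU11 /=; apply/eqP/idP => [<-|]; last exact: setU1K.
  by rewrite !inE eqxx.
have naB : a \notin B by rewrite -aB !inE eqxx.
rewrite (negPf naB) cg setU11 aB mulrA -gscalMM.
by rewrite [u B * _]mulrC.
Qed.

Lemma gmorphM u v : gmorph (u * v) = gmorph u * gmorph v.
Proof.
elim/grass_ind: u => [c|u1 u2 IH1 IH2|a u IH].
- by rewrite gmorphZ gmorph_scal.
- by rewrite mulrDl !gmorphD IH1 IH2 mulrDl.
by rewrite -mulrA !gmorph_gen IH mulrA.
Qed.

Lemma gmorph_ginv u : gmorph (ginv u) = ginv (gmorph u).
Proof.
elim/grass_ind: u => [c|u1 u2 IH1 IH2|a u IH].
- by rewrite ginv_scal gmorph_scal ginv_scal.
- by rewrite ginvD !gmorphD IH1 IH2 ginvD.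
rewrite ginvM ginv_gen mulNr gmorphN !gmorph_gen IH ginvM -mulNr; congr (_ * _).
rewrite /lin ginv_sum -sumrN; apply: eq_bigr => c _.
by rewrite ginvM ginv_scal ginv_gen mulrN.
Qed.

Lemma gldv_lin a c : gldv c (lin a) = gscal (M a c).
Proof.
rewrite /lin gldv_sum (bigD1 c) //= big1 ?addr0 => [|d /negPf ndc].
  by rewrite gldv_scalM gldv_genE eqxx mulr1.
by rewrite gldv_scalM gldv_genE eq_sym ndc mulr0.
Qed.

(** Chain rule. *)
Lemma gldv_gmorph c u : gldv c (gmorph u) = \sum_b gscal (M b c) * gmorph (gldv b u).
Proof.
elim/grass_ind: u => [d|u1 u2 IH1 IH2|a u IH].
- rewrite gmorph_scal gldv_cst big1 // => b _.
  by rewrite gldv_cst gmorph0 mulr0.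
- rewrite gmorphD gldvD IH1 IH2 -big_split; apply: eq_bigr => b _ /=.
  by rewrite gldvD gmorphD mulrDr.
rewrite gmorph_gen gldvM gldv_lin IH.
under [RHS]eq_bigr => b _ do
  rewrite gldvM gmorphD mulrDr ginv_gen mulNr gmorphN gmorph_gen gldv_genE.
rewrite big_split /= [X in _ = X + _](bigD1 a) //= eqxx mul1r [X in _
  = _ + X + _]big1 ?addr0 => [|b /negPf nb]; last first.
  by rewrite nb mul0r gmorph0 mulr0.
congr (_ + _); have -> : ginv (lin a) = - lin a.
  rewrite /lin ginv_sum -sumrN; apply: eq_bigr => d _.
  by rewrite ginvM ginv_scal ginv_gen mulrN.
rewrite mulNr mulr_sumr -sumrN; apply: eq_bigr => b _.
by rewrite mulrN !mulrA gscalC.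
Qed.

End GrassmannMorphism.

Section OddBracket.
Variables (K : comNzRingType) (r : nat) (M : 'I_(r + r) -> 'I_(r + r) -> K).
Implicit Types (u v : grass K (r + r)).

(** The bracket of elements free of momenta. *)
Definition obra u v : grass K (r + r) := \sum_a ginv (gldv a u) * gldv (dual a) v.

(** [M] preserves the pairing of each generator with its conjugate. *)
Hypothesis symplectic : forall b c, \sum_a M b a * M c (dual a) = (c == dual b)%:R.

Lemma gmorph_obra u v : gmorph M (obra u v) = obra (gmorph M u) (gmorph M v).
Proof.
rewrite /obra gmorph_sum.
under [RHS]eq_bigr => a _ do rewrite !gldv_gmorph ginv_sum mulr_suml.
rewrite [RHS]exchange_big /=; apply: eq_bigr => b _; rewrite gmorphM gmorph_ginv.
under [RHS]eq_bigr => a _ do rewrite mulr_sumr.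
rewrite [RHS]exchange_big [RHS](bigD1 (dual b)) //= [X in _
  = _ + X]big1 ?addr0 => [|c /negPf nc].
  under [RHS]eq_bigr => a _ do rewrite ginvM ginv_scal gscal_mulACA.
  rewrite -mulr_suml -(big_morph (@gscal K (r + r)) (@gscalD K (r + r)) (@gscal0 K (r +
    r))).
  by rewrite symplectic eqxx mul1r.
under eq_bigr => a _ do rewrite ginvM ginv_scal gscal_mulACA.
rewrite -mulr_suml -(big_morph (@gscal K (r + r)) (@gscalD K (r + r)) (@gscal0 K (r + r))).
by rewrite symplectic nc gscal0 mul0r.
Qed.

End OddBracket.

(** * Weights with momenta *)
Section MomentWeights.
Import mathcomp.boot.fintype mathcomp.boot.finset.
Variables (L : comNzRingType) (n r : nat) (J : bideriv (mpoly n L) n).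
Hypothesis J_dm : forall k p, dm J k p = mderiv k p.
Hypothesis L_char0 : forall (x : L) m, x *+ m.+1 = 0 -> x = 0.
Local Notation G := (grass (mpoly n L) (r + r)).
Implicit Types (F : G) (p : mpoly n L) (m : multinom n).

(** The bidegree in the presence of momenta, each of bidegree [(1, 1)]. *)
Definition weights (k q : nat) F := forall A m, mcoeff m (F A) != 0 ->
  (mdeg m + ntheta A = k)%N /\ (mdeg m + nxi A = q)%N.

Lemma gdm_mcoeff k F A m : mcoeff m (gdm J k F A)
  = mcoeff (mnm_add m (mnm1 k)) (F A) *+ (m k).+1.
Proof. by rewrite ffunE J_dm mcoeff_deriv. Qed.

Lemma mpoly_neq0 p : p != 0 -> exists m, mcoeff m p != 0.
Proof.
move=> nz; exists (mlead p); by rewrite mleadc_eq0.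
Qed.

Lemma mpoly_eq0 p : (forall m, mcoeff m p = 0) -> p = 0.
Proof. by move=> h; apply/mpolyP => m; rewrite h mcoeff0. Qed.

Lemma momfree_coef F : (forall A m, mcoeff m (F A) != 0 -> mdeg m = 0%N) -> momfree J F.
Proof.
move=> h k; apply/ffunP=> A; rewrite coef_grass0; apply: mpoly_eq0 => m.
rewrite gdm_mcoeff; case: (eqVneq (mcoeff (mnm_add m (mnm1 k)) (F A)) 0) => [->|/h].
  by rewrite mul0rn.
by rewrite mdegD mdeg1 addn1.
Qed.

(** In characteristic zero a monomial has a nonzero derivative along each momentum
    that occurs in it. *)
Lemma coef_momfree F A m : momfree J F -> mcoeff m (F A) != 0 -> m = mnm0.
Proof.
move=> mF nz; apply/eqP; rewrite -mdeg_eq0; apply: contraNT nz => nm.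
have [k mk] : exists k, (0 < m k)%N.
  apply/existsP; apply: contraNT nm; rewrite negb_exists => /forallP h.
  by rewrite mdegE big1 // => k _; have := h k; rewrite lt0n negbK => /eqP.
have e : mnm_add (mnm_sub m (mnm1 k)) (mnm1 k) = m.
  by rewrite submK // lep1mP -lt0n.
have := gdm_mcoeff k F A (mnm_sub m (mnm1 k)); rewrite mF coef_grass0 mcoeff0 e.
by move/esym/L_char0 ->.
Qed.

(** Each momentum adds one to both weights, so that none occurs when a weight is
    zero: multivector fields and forms are free of momenta. *)
Lemma weights_bihom k q F : greg J F -> (k = 0 \/ q = 0)%N -> weights k q F ->
  bihom J k q F.
Proof.
move=> rF kq wF; have m0 A m : mcoeff m (F A) != 0 -> mdeg m = 0%N.
  by move=> /wF[]; case: kq => ->; lia.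
split=> //; first exact: momfree_coef.
move=> A /mpoly_neq0[m nz]; have [] := wF _ _ nz.
by rewrite (m0 _ _ nz) !add0n.
Qed.

Lemma bihom_weights k q F : bihom J k q F -> weights k q F.
Proof.
move=> [_ mF dF] A m nz; rewrite (coef_momfree mF nz) mdeg0 !add0n; apply: dF.
by apply: contraNneq nz => ->; rewrite mcoeff0.
Qed.

Lemma weights_balance k F A : weights k k.+1 F -> F A != 0 -> (ntheta A).+1 = nxi A.
Proof. by move=> wF /mpoly_neq0[m] /wF[]; lia. Qed.

Definition xi_weight q F := forall A m, mcoeff m (F A) != 0 -> (mdeg m + nxi A = q)%N.

Lemma xi_weight_gldv q F (c : 'I_r) : xi_weight q F ->
  xi_weight q.-1 (gldv (lshift r c) F) /\ (q = 0%N -> gldv (lshift r c) F = 0).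
Proof.
move=> wF.
have key A m : mcoeff m (gldv (lshift r c) F A) != 0 -> (mdeg m + (nxi A).+1 = q)%N.
  rewrite ffunE; case: ifPn => cA; first by rewrite mcoeff0 eqxx.
  rewrite /gsign -signr_odd mulr_sign => nz.
  have := wF (lshift r c |: A)%SET m; rewrite nxiU1 // isxi_lshift add1n; apply.
  by move: nz; case: ifP => // _; rewrite mcoeffN oppr_eq0.
split=> [A m /key|q0]; first by lia.
apply/ffunP=> A; rewrite coef_grass0; apply: mpoly_eq0 => m.
by apply/eqP; apply: contraT => /key; rewrite q0 addnS.
Qed.

Lemma xi_weight_gdm q F k : xi_weight q F ->
  xi_weight q.-1 (gdm J k F) /\ (q = 0%N -> gdm J k F = 0).
Proof.
move=> wF.
have key A m : mcoeff m (gdm J k F A) != 0 -> ((mdeg m).+1 + nxi A = q)%N.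
  rewrite gdm_mcoeff => nz; have := wF A (mnm_add m (mnm1 k));
    rewrite mdegD mdeg1 addn1; apply.
  by apply: contraNneq nz => ->; rewrite mul0rn.
split=> [A m /key|q0]; first by lia.
apply/ffunP=> A; rewrite coef_grass0; apply: mpoly_eq0 => m.
by apply/eqP; apply: contraT => /key; rewrite q0.
Qed.

Lemma xi_weight_section_after q F : xi_weight q F -> section_after J q F.
Proof.
elim: q F => [|q IH] F wF /=.
  by split=> [k|c]; [apply: (xi_weight_gdm k wF).2 | apply: (xi_weight_gldv c wF).2].
by split=> [k|c]; apply: IH; [apply: (xi_weight_gdm k wF).1 | apply: (xi_weight_gldv c
  wF).1].
Qed.

End MomentWeights.

(** * The odd part of the bracket *)
Section OddBracketLemmas.
Variables (K : comNzRingType) (n r : nat) (J : bideriv K n) (o : K).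
Hypothesis o_id : forall x, reg J x -> o * x = x.
Local Notation G := (grass K (r + r)).
Implicit Types (u v : G).

Lemma obra_bra u v : momfree J u -> momfree J v -> bra J u v = obra u v.
Proof. exact: bra_momfree. Qed.

Lemma obra_intro u v (X : 'I_n -> G) (Y : 'I_r -> G) :
  (forall k, X k = 0) ->
  (forall c, Y c = gmul (grdv (rshift r c) u) (gldv (lshift r c) v)
                 + gmul (grdv (lshift r c) u) (gldv (rshift r c) v)) ->
  \sum_k X k + \sum_c Y c = obra u v.
Proof.
move=> hX hY; rewrite big1 // add0r /obra big_split_ord /= addrC -big_split.
by apply: eq_bigr => c _ /=; rewrite hY dual_lshift dual_rshift !grdvE.
Qed.

(** A bare generator may be replaced by its regular version whenever the other
    argument vanishes outside the domain. *)
Lemma obra_gen_l a u : greg J u -> obra (ggen a) u = obra (sgen o a) u.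
Proof.
move=> ru; apply: eq_bigr => b _.
rewrite gldv_scalM ginvM ginv_scal gscalC -mulrA (gscal_o o_id) //.
exact: greg_gldv.
Qed.

Lemma obra_gen_r a u : greg J u -> obra u (ggen a) = obra u (sgen o a).
Proof.
move=> ru; apply: eq_bigr => b _.
rewrite gldv_scalM mulrA -gscalC (gscal_o o_id) //.
exact/greg_ginv/greg_gldv.
Qed.

End OddBracketLemmas.

Lemma mcoeff_mpolyC (n : nat) (L : comNzRingType) (c : L) m :
  mcoeff m (mpolyC n c) = if m == mnm0 then c else 0.
Proof. by rewrite mcoeffC; case: eqP; rewrite ?mulr1 ?mulr0. Qed.

Lemma mpoly_two_reg (n : nat) (L : comNzRingType) :
  (forall x : L, x + x = 0 -> x = 0) -> forall p : mpoly n L, p + p = 0 -> p = 0.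
Proof.
move=> h p pp; apply/mpolyP => m; rewrite mcoeff0; apply: h.
by rewrite -mcoeffD pp mcoeff0.
Qed.

Lemma gscal_sgen (K : comNzRingType) (s : nat) (c d : K) (a : 'I_(s + s)) :
  gscal c * sgen d a = sgen (d * c) a.
Proof. by rewrite /sgen mulrA -gscalMM mulrC. Qed.

(** * Functions over the domain of a chart *)
Section ChartFunctions.
Local Open Scope classical_set_scope.
Variables (R : realType) (n r : nat) (U : set 'rV[R]_n).
Hypothesis U_open : open U.
Local Notation L := ('rV[R]_n -> R).
Local Notation J := (chart_jets U_open).
Implicit Types (f : L) (F H : Defs.sfun R n r).

Lemma fct_char0 f m : f *+ m.+1 = 0 -> f = 0.
Proof.
move=> h; apply/funext => x; have : (f *+ m.+1) x = 0 by rewrite h.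
by rewrite natmulfctE => /eqP; rewrite mulrn_eq0 => /eqP.
Qed.

Lemma fct_two_reg f : f + f = 0 -> f = 0.
Proof. by rewrite -mulr2n; apply: fct_char0. Qed.

(** The constant [lambda] on [U], extended by zero: a regular coefficient all of
    whose derivatives vanish. *)
Definition cutoff (lambda : R) : mpoly n L := mpolyC n (cst lambda * dom_indic U).

Lemma smooth0_cutoff lambda : smooth0 U (cst lambda * dom_indic U).
Proof. by apply: smooth0Z => //; apply: smooth0_dom_indic. Qed.

Lemma cutoff_reg lambda : reg J (cutoff lambda).
Proof.
move=> m; rewrite mcoeff_mpolyC; case: ifP => _; last exact: smooth0_0.
exact: smooth0_cutoff.
Qed.

Lemma cutoff_dm lambda k : dm J k (cutoff lambda) = 0.
Proof. exact: mderivC. Qed.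

Lemma cut_partial_cutoff lambda k : cut_partial U k (cst lambda * dom_indic U) = 0.
Proof.
apply/funext=> x; case: (pselect (U x)) => Ux; last exact: cut_partialF.
rewrite cut_partialE // (@partial_eq _ _ _ U_open _ (cst lambda)) //.
  by rewrite /partial derive_cst.
by move=> y Uy; rewrite -[LHS]/(lambda * dom_indic U y) dom_indicT ?mulr1.
Qed.

Lemma cutoff_dp lambda k : dp J k (cutoff lambda) = 0.
Proof.
apply/mpolyP => m; rewrite mcoeff0 [LHS](mcoeff_jdp U_open) mcoeff_mpolyC.
by case: ifP => _; [apply: cut_partial_cutoff | apply: cut_partial0].
Qed.

Lemma cutoff_mul lambda p : reg J p -> cutoff lambda * p = mpolyC n (cst lambda) * p.
Proof.
move=> hp; apply/mpolyP => m; rewrite !mcoeffCM -mulrA dom_indic_mul //.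
by have [] := hp m.
Qed.

Lemma cutoff1_id p : reg J p -> cutoff 1 * p = p.
Proof. by move=> hp; rewrite cutoff_mul // -[RHS]mul1r. Qed.

Lemma eval_at_coef x F B : eval_at x F B = map_mpoly (fun f : L => f x) (F B).
Proof. exact: ffunE. Qed.

Lemma greg_chart F : (forall B m, smooth U (mcoeff m (F B))) ->
  (forall x, ~ U x -> eval_at x F = 0) -> greg J F.
Proof.
move=> sF F0 B m; split=> [|x Ux]; first exact: sF.
have /ffunP/(_ B) := F0 x Ux; rewrite eval_at_coef coef_grass0 => /(congr1 (mcoeff m)).
by rewrite mcoeff_map_poly0 // mcoeff0.
Qed.

Lemma eval_at_greg F x : greg J F -> ~ U x -> eval_at x F = 0.
Proof.
move=> rF Ux; apply/ffunP=> B; rewrite coef_grass0 eval_at_coef; apply/mpolyP => m.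
by rewrite mcoeff_map_poly0 // mcoeff0; have [_ ->] := rF B m.
Qed.

Lemma greg_smooth F B m : greg J F -> smooth U (mcoeff m (F B)).
Proof. by move=> rF; have [] := rF B m. Qed.

(** Equality at the points of [U] suffices, as both sides vanish elsewhere. *)
Lemma eval_at_inj F H : greg J F -> greg J H ->
  (forall x, U x -> eval_at x F = eval_at x H) -> F = H.
Proof.
move=> rF rH FH; apply/ffunP=> B; apply/mpolyP => m; apply/funext => x.
have {}FH : eval_at x F = eval_at x H.
  by case: (pselect (U x)) => Ux; [apply: FH | rewrite !eval_at_greg].
have /ffunP/(_ B)/(congr1 (mcoeff m)) := FH.
by rewrite !eval_at_coef !mcoeff_map_poly0.
Qed.

Lemma sscaleE lambda F : greg J F -> sscale lambda F = gscal (cutoff lambda) * F.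
Proof.
move=> rF; apply/ffunP=> B.
apply: etrans (coef_gscalM (mpolyC n (cst lambda)) F B) _.
apply: etrans (esym (coef_gscalM (cutoff lambda) F B)).
by apply/esym/cutoff_mul.
Qed.

End ChartFunctions.

(** * The structure over one chart *)
Section ChartStructure.
Local Open Scope classical_set_scope.
Variables (R : realType) (n r : nat) (A : vbundle R n r) (i : atlas A).
Implicit Types (F H P : Defs.sfun R n r).

Lemma cdom_open : open (@cdom R n r A i).
Proof. exact: chart_open. Qed.

Local Notation J := (chart_jets cdom_open).
Local Notation o := (cutoff (@cdom R n r A i) 1).
Local Notation bra := (@bra _ n r J).
Local Notation greg := (@greg _ n r J).
Local Notation bihom := (@bihom _ n r J).
Local Notation t c := (sgen o (rshift r c)).

Let J_dm k p : dm J k p = mderiv k p := erefl.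
Let o_reg : reg J o := cutoff_reg cdom_open 1.
Let o_dm k : dm J k o = 0 := cutoff_dm cdom_open 1 k.
Let o_id p : reg J p -> o * p = p := @cutoff1_id _ _ _ cdom_open p.
Let two_reg : forall p : mpoly n ('rV[R]_n -> R), p + p = 0 -> p = 0 :=
  mpoly_two_reg (@fct_two_reg R n).

Lemma in_F_greg k l (F : superfun A) : in_F k l F -> greg (F i).
Proof. by move=> [/(_ i) [_ sF F0] _]; apply: greg_chart. Qed.

Lemma in_F_weights k l (F : superfun A) : in_F k l F -> weights k l (F i).
Proof. by move=> [/(_ i) [bF _ _] _]. Qed.

Lemma in_F_bihom k l (F : superfun A) : (k = 0 \/ l = 0)%N -> in_F k l F -> bihom k l (F i).
Proof.
move=> kl hF; apply: weights_bihom => //.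
  exact: in_F_greg hF.
exact: in_F_weights hF.
Qed.

Lemma lbracket_obra F H : momfree J F -> momfree J H -> lbracket F H = obra F H.
Proof.
move=> mF mH; rewrite /lbracket; apply: obra_intro => [k|//].
have e1 : dmom k F = 0 by exact: mF.
have e2 : dmom k H = 0 by exact: mH.
by rewrite e1 e2 gmul0l gmul0r subrr.
Qed.

Lemma momfree_theta (c : 'I_r) : momfree J (theta c).
Proof. by move=> k; apply: gdm_gen. Qed.

Lemma lbracket_theta_l c F : greg F -> momfree J F ->
  lbracket (theta c) F = bra (t c) F.
Proof.
move=> rF mF; have [_ mt _] := bihom_vec o_reg o_dm c.
apply: etrans (lbracket_obra (@momfree_theta c) mF) _.
apply: etrans (obra_gen_l o_id _ rF) _.
by apply/esym/obra_bra.
Qed.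

Lemma lbracket_theta_r c F : greg F -> momfree J F ->
  lbracket F (theta c) = bra F (t c).
Proof.
move=> rF mF; have [_ mt _] := bihom_vec o_reg o_dm c.
apply: etrans (lbracket_obra mF (@momfree_theta c)) _.
apply: etrans (obra_gen_r o_id _ rF) _.
by apply/esym/obra_bra.
Qed.

Section Forms.
Variables (pi omega : superfun A).
Local Notation e := (pi i).
Local Notation f := (omega i).
Local Notation h := (bra (pi i) (omega i)).
Local Notation N := (Nmap pi omega i).
Hypothesis e_bihom : bihom 2 0 e.
Hypothesis f_bihom : bihom 0 2 f.

Let re : greg e. Proof. by case: e_bihom. Qed.
Let rf : greg f. Proof. by case: f_bihom. Qed.
Let mf : momfree J f. Proof. by case: f_bihom. Qed.
Let t_bihom c : bihom 1 0 (t c) := bihom_vec o_reg o_dm c.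
Let h_chart : bihom 1 1 h := h_bihom e_bihom f_bihom.

(** On vector fields, N is the action of the even element [h]. *)
Lemma Nmap_vec Y : bihom 1 0 Y -> N Y = bra h Y.
Proof.
move=> hY; have [rY _ _] := hY; rewrite /Nmap /sharp /flat.
rewrite (lbracket_bra rY rf) (lbracket_bra (greg_bra rY rf) re).
exact: (sharp_flat e_bihom f_bihom hY).
Qed.

Lemma Nmap_theta c : N (theta c) = bra h (t c).
Proof.
rewrite /Nmap /sharp /flat (lbracket_theta_l _ rf mf).
have [rt _ _] := t_bihom c.
rewrite (lbracket_bra (greg_bra rt rf) re).
exact: (sharp_flat e_bihom f_bihom (t_bihom c)).
Qed.

(** The extension of N to multivectors by one factor at a time is a derivation
    determined by its values on vectors, and so is the action of [h]. *)
Lemma gunder_bra P : section_like J P -> gunder N P = bra h P.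
Proof.
move=> hP; have [rh mh _] := h_chart; rewrite (bra_even_section mh hP).
apply: eq_bigr => c _; congr (gmul _ _).
apply: etrans (Nmap_theta c) _.
by rewrite -dual_lshift (bra_gen o_reg o_id o_dm).
Qed.

Lemma omegaN_chart : omegaN pi omega i = omN J o e f.
Proof.
apply: eq_bigr => a _; apply: eq_bigr => b _; congr (gmul _ _).
have [rt _ _] := t_bihom a; rewrite /eval2 Nmap_theta.
have hv := f_vec_bihom f_bihom (h_vec_bihom e_bihom f_bihom (t_bihom a));
  have [rv mv _] := hv.
have [ry _ _] := h_vec_bihom e_bihom f_bihom (t_bihom a).
have vE : bra (bra h (t a)) f = - bra f (bra h (t a)) by apply: (bihom_antisym _ f_bihom
  isT).
rewrite (lbracket_bra ry rf) lbracket_theta_r.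
- exact: (congr1 (fun y => bra (bra y f) (t b)) (esym (sharp_flat e_bihom f_bihom
  (t_bihom a)))).
- exact: greg_bra.
- by rewrite vE => k; rewrite gdmN mv oppr0.
Qed.

Variables (mu : superfun A) (lambda : R).
Hypothesis mu_F : in_F 1 2 mu.

Let rmu : greg (mu i) := in_F_greg mu_F.

(** The regular generator is a local section over the chart, to which the assumption
    on the square of N applies pointwise. *)
Lemma square_chart : square_scalar (Nmap pi omega) lambda ->
  forall c, bra h (bra h (t c)) = sgen (cutoff (@cdom R n r A i) lambda) (rshift r c).
Proof.
move=> sq c; have ht := t_bihom c; have [rt mt dt] := ht.
have hy := h_vec_bihom e_bihom f_bihom ht.
have hyy := h_vec_bihom e_bihom f_bihom hy; have [ryy _ _] := hyy.
have lsec : local_section i (t c).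
  split=> [|B m]; last exact: (greg_smooth (U_open := cdom_open)).
  exact: (bihom_weights J_dm (@fct_char0 R n) ht).
have [rl _ _] := bihom_veclam (cutoff_reg cdom_open lambda) (cutoff_dm cdom_open lambda) c.
have sc : sscale lambda (t c) = sgen (cutoff (@cdom R n r A i) lambda) (rshift r c).
  apply: etrans (sscaleE lambda rt) _; apply: etrans (gscal_sgen _ _ _) _.
  exact: (congr1 (fun z => sgen z _) (o_id (cutoff_reg cdom_open lambda))).
apply: (eval_at_inj (U_open := cdom_open) ryy rl) => x Ux.
have := sq i _ lsec x Ux; rewrite (Nmap_vec ht) (Nmap_vec hy) => E.
by rewrite sc in E; apply: E.
Qed.

Lemma h_square_chart : bracket mu omega = 0 -> bracket mu (omegaN pi omega) = 0 ->
  schouten mu pi pi = 0 -> square_scalar (Nmap pi omega) lambda ->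
  bra h (bra h (mu i)) = sscale lambda (mu i).
Proof.
move=> closed closedN poisson sq.
rewrite (sscaleE lambda rmu); apply: (h_square_mu o_reg o_id o_dm
  (cutoff_reg cdom_open lambda) (cutoff_dm cdom_open lambda)
  (cutoff_dp cdom_open lambda) two_reg) => //.
- exact: square_chart.
- by move=> B; apply: weights_balance; apply: in_F_weights mu_F.
- have := congr1 (fun F : superfun A => F i) poisson.
  rewrite /schouten /bracket (lbracket_bra re rmu) (lbracket_bra (greg_bra re rmu) re).
  by rewrite (bihom_antisym _ e_bihom isT) => /eqP; rewrite oppr_eq0 => /eqP.
- have := congr1 (fun F : superfun A => F i) closed.
  rewrite /bracket (lbracket_bra rmu rf) (bihom_antisym _ f_bihom isT).
  by move/eqP; rewrite oppr_eq0 => /eqP.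
apply: (closed_omN o_reg o_id o_dm two_reg e_bihom f_bihom).
have hN := bihom_omN o_reg o_id o_dm e_bihom f_bihom; have [rN _ _] := hN.
have := congr1 (fun F : superfun A => F i) closedN.
by rewrite /bracket omegaN_chart (lbracket_bra rmu rN).
Qed.

End Forms.
End ChartStructure.

(** * Evaluation at a point *)
Section CoefficientMaps.
Variables (K K' : comNzRingType) (phi : K -> K').
Hypothesis phi0 : phi 0 = 0.
Hypothesis phiD : forall x y, phi (x + y) = phi x + phi y.
Hypothesis phiM : forall x y, phi (x * y) = phi x * phi y.

Let phiN x : phi (- x) = - phi x.
Proof. by apply/eqP; rewrite -addr_eq0 -phiD addNr phi0. Qed.

Let phi_sign m x : phi ((-1) ^+ m * x) = (-1) ^+ m * phi x.
Proof. by rewrite -signr_odd -[in RHS]signr_odd !mulr_sign; case: (odd m) => //;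
  apply: phiN. Qed.

Section MpolyMap.
Variable n : nat.
Implicit Types p q : mpoly n K.

Lemma map_mpoly_add p q : map_mpoly phi (p + q) = map_mpoly phi p + map_mpoly phi q.
Proof. by apply/mpolyP => m; rewrite mcoeffD !mcoeff_map_poly0 // mcoeffD phiD. Qed.

Lemma map_mpoly_mul p q : map_mpoly phi (p * q) = map_mpoly phi p * map_mpoly phi q.
Proof.
apply/mpolyP => m; rewrite mcoeff_map_poly0 // !mcoeffM (big_morph phi phiD phi0).
by apply: eq_bigr => i _; rewrite !mcoeff_map_poly0.
Qed.

Lemma map_mpoly_zero : map_mpoly phi (0 : mpoly n K) = 0.
Proof. by apply/mpolyP => m; rewrite mcoeff_map_poly0 // !mcoeff0. Qed.

End MpolyMap.

Section GrassmannMap.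
Variable r : nat.
Implicit Types u v : grass K (r + r).

Definition gmap u : grass K' (r + r) := [ffun A : {set 'I_(r + r)} => phi (u A)].

Lemma gmapM u v : gmap (u * v) = gmap u * gmap v.
Proof.
apply/ffunP=> A; rewrite ffunE !coef_grassM (big_morph phi phiD phi0).
by apply: eq_bigr => B _; rewrite /gsign phi_sign phiM !ffunE.
Qed.

Lemma gmap_sum I (s : seq I) (P : pred I) (F : I -> grass K (r + r)) :
  gmap (\sum_(i <- s | P i) F i) = \sum_(i <- s | P i) gmap (F i).
Proof.
apply: (big_morph gmap) => [u v|]; apply/ffunP=> A.
  by rewrite coef_grassD !ffunE phiD.
by rewrite ffunE !coef_grass0.
Qed.

Lemma gmap_gldv a u : gmap (gldv a u) = gldv a (gmap u).
Proof. by apply/ffunP=> A; rewrite !ffunE; case: ifP => _ //; rewrite /gsign phi_sign. Qed.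

Lemma gmap_ginv u : gmap (ginv u) = ginv (gmap u).
Proof. by apply/ffunP=> A; rewrite !ffunE phi_sign. Qed.

Lemma gmap_obra u v : gmap (obra u v) = obra (gmap u) (gmap v).
Proof.
rewrite /obra gmap_sum; apply: eq_bigr => a _.
by rewrite gmapM gmap_ginv !gmap_gldv.
Qed.

End GrassmannMap.
End CoefficientMaps.

(** * Change of charts *)
Section Substitution.
Variables (R : realType) (n r : nat).
Local Notation K := (mpoly n R).

(** For elements free of momenta the substitution of the momenta is irrelevant, and
    what remains is the algebra morphism extending the linear substitution. *)
Lemma subst_gmorph (P : 'I_n -> pfun R n r) (T : 'I_(r + r) -> pfun R n r)
    (M : 'I_(r + r) -> 'I_(r + r) -> K) (u : pfun R n r) :
  (forall a, T a = lin M a) ->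
  (forall A m, mcoeff m (u A) != 0 -> m = mnm0) ->
  subst P T u = gmorph M u.
Proof.
move=> TM hu; apply: eq_bigr => A _.
have mom1 : \big[@gmul K (r + r)/gscal 1]_(k < n) iter (mnm0 k) (gmul (P k)) (gscal 1)
    = 1 :> grass K (r + r).
  by apply: (big_ind (fun z : grass K (r + r) => z = 1)) => [//|x y -> ->|k _];
    rewrite ?mnm0E // gmulP mulr1.
have odd1 : \big[@gmul K (r + r)/gscal 1]_(a <- enum A) T a
    = \prod_(a in A) lin M a :> grass K (r + r).
  by apply: etrans (big_filter _ _ _) _; apply: eq_bigr => a _; apply: TM.
have term m : gmul (gscal (mpolyC n (mcoeff m (u A))))
    (gmul (\big[@gmul K (r + r)/gscal 1]_(k < n) iter (m k) (gmul (P k)) (gscal 1))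
          (\big[@gmul K (r + r)/gscal 1]_(a <- enum A) T a))
    = if mcoeff m (u A) == 0 then 0 else gscal (u A) * \prod_(a in A) lin M a.
  case: eqP => [->|/eqP nz]; first by rewrite mpolyC0 gmulP gscal0 mul0r.
  have m0 := hu _ _ nz; rewrite {m}m0 in nz *.
  rewrite mom1 odd1 !gmulP mul1r; congr (gscal _ * _); apply/mpolyP => m.
  rewrite mcoeff_mpolyC; case: eqP => [-> //|nm].
  by apply/esym/eqP; apply: contraT => /hu.
apply: etrans (eq_bigr _ (fun m _ => term m)) _.
case: (eqVneq (u A) 0) => [->|nz]; first by rewrite msupp0 big_nil gscal0 mul0r.
have nz0 : mcoeff mnm0 (u A) != 0.
  apply: contraNneq nz => e; apply/eqP/mpoly_eq0 => m; apply/eqP; apply: contraT => nm.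
  by have m0 := hu _ _ nm; rewrite m0 e eqxx in nm.
rewrite (bigD1_seq mnm0) ?msupp_uniq ?mcoeff_msupp //= (negPf nz0) [X
  in _ + X]big1 ?addr0 // => m nm.
by case: eqP => // /eqP /hu e; rewrite e eqxx in nm.
Qed.

End Substitution.

Section CoordinateChange.
Local Open Scope classical_set_scope.
Variables (R : realType) (n r : nat) (A : vbundle R n r).

(** A vector read in one chart and then in the other comes back to itself. *)
Lemma trans_inv (i j : atlas A) (b : base A) : Defs.dom i b -> Defs.dom j b ->
  trans i j (chart i b) *m trans j i (chart j b) = 1%:M.
Proof.
move=> bi bj; apply/row_matrixP => k; rewrite row1 rowE mulmxA.
set v := delta_mx 0 k; set e := fibV i b v.
have ei : Defs.proj e = b by rewrite proj_fibV.
have fj : fib j e = v *m trans i j (chart i b).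
  by rewrite (@trans_fib _ _ _ A i j e) ?ei // fibVK.
have fi : fib i e = v by rewrite fibVK.
by rewrite -fj -fi (@trans_fib _ _ _ A j i e) ?ei.
Qed.

Section Overlap.
Variables (i j : atlas A) (b : base A).
Hypotheses (bi : Defs.dom i b) (bj : Defs.dom j b).

(** The coordinates theta of A transform by the transition matrix, the dual
    coordinates xi by the contragredient one. *)
Definition jac (a c : 'I_(r + r)) : mpoly n R :=
  match fintype.split a, fintype.split c with
  | inl a', inl c' => mpolyC n (trans j i (chart j b) c' a')
  | inr a', inr c' => mpolyC n (trans i j (chart i b) a' c')
  | _, _ => 0
  end.

Lemma jac_ll a c : jac (lshift r a) (lshift r c) = mpolyC n (trans j i (chart j b) c a).
Proof. by rewrite /jac !(unsplitK (inl _ : 'I_r + 'I_r)%type). Qed.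
Lemma jac_rr a c : jac (rshift r a) (rshift r c) = mpolyC n (trans i j (chart i b) a c).
Proof. by rewrite /jac !(unsplitK (inr _ : 'I_r + 'I_r)%type). Qed.
Lemma jac_lr a c : jac (lshift r a) (rshift r c) = 0.
Proof. by rewrite /jac (unsplitK (inl _ : 'I_r + 'I_r)%type) (unsplitK (inr _ : 'I_r +
  'I_r)%type). Qed.
Lemma jac_rl a c : jac (rshift r a) (lshift r c) = 0.
Proof. by rewrite /jac (unsplitK (inl _ : 'I_r + 'I_r)%type) (unsplitK (inr _ : 'I_r +
  'I_r)%type). Qed.

Lemma new_odd_lin a : @new_odd R n r A i j b a = lin jac a.
Proof.
rewrite -[a]splitK /lin big_split_ord; case: (fintype.split a) => c /=.
  rewrite /new_odd (unsplitK (inl _ : 'I_r + 'I_r)%type).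
  rewrite [X in _ = _ + X]big1 ?addr0 => [|d _]; last by rewrite jac_lr gscal0 mul0r.
  by apply: eq_bigr => d _; rewrite jac_ll.
rewrite /new_odd (unsplitK (inr _ : 'I_r + 'I_r)%type).
rewrite [X in _ = X + _]big1 ?add0r => [|d _]; last by rewrite jac_rl gscal0 mul0r.
by apply: eq_bigr => d _; rewrite jac_rr.
Qed.

(** The two blocks are inverse to each other up to transposition, whence the pairing
    of theta with xi does not depend on the chart. *)
Lemma jac_symplectic a c : \sum_d jac a d * jac c (dual d) = (c == dual a)%:R.
Proof.
have mxC (B C : 'M[R]_r) (x y : 'I_r) :
    \sum_d mpolyC n (B x d) * mpolyC n (C d y) = mpolyC n ((B *m C) x y).
  by rewrite mxE raddf_sum; apply: eq_bigr => d _ /=; apply/esym; exact: mpolyCM.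
rewrite big_split_ord -[a]splitK -[c]splitK.
case: (fintype.split a) => x; case: (fintype.split c) => y /=.
- rewrite !big1 ?addr0 => [|d _|d _]; rewrite ?dual_lshift ?dual_rshift ?jac_lr ?mul0r
  ?mulr0 //.
  by rewrite eq_lrshift.
- rewrite [X in _ + X]big1 ?addr0 => [|d _]; last by rewrite jac_lr mul0r.
  under eq_bigr => d _ do rewrite dual_lshift jac_ll jac_rr mulrC.
  by rewrite mxC trans_inv // mxE dual_lshift eq_rshift mpolyC_nat.
- rewrite [X in X + _]big1 ?add0r => [|d _]; last by rewrite jac_rl mul0r.
  under eq_bigr => d _ do rewrite dual_rshift jac_ll jac_rr.
  by rewrite mxC trans_inv // mxE dual_rshift eq_lshift eq_sym mpolyC_nat.
rewrite !big1 ?addr0 => [|d _|d _]; rewrite ?dual_lshift ?dual_rshift ?jac_rl ?mul0r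
  ?mulr0 //.
by rewrite eq_rlshift.
Qed.

End Overlap.
End CoordinateChange.

(** * Vector-valued forms of arity at most two *)
Section SmallUnshuffles.
Variable V : zmodType.
Implicit Types (x y : int * V) (xs : seq (int * V)).

Lemma enum_I2 : enum 'I_2 = [:: ord0; ord_max].
Proof. by rewrite enum_ordSl enum_ordSl enum_ord0 /=; congr [:: _; _]; apply: val_inj. Qed.

Lemma I2P (i : 'I_2) : i = ord0 \/ i = ord_max.
Proof. by case: i => [[|[|//]] h]; [left|right]; apply: val_inj. Qed.

Lemma S2P (s : 'S_2) : s = 1%g \/ s = tperm ord0 ord_max.
Proof.
have inj := @perm_inj _ s; case: (I2P (s ord0)) => s0; [left|right]; apply/permP => i.
  rewrite perm1; case: (I2P i) => ->; first by [].
  by case: (I2P (s ord_max)) => // s1; move: (inj _ _ (etrans s0 (esym s1))).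
case: (I2P i) => ->; rewrite ?tpermL ?tpermR //.
by case: (I2P (s ord_max)) => // s1; move: (inj _ _ (etrans s0 (esym s1))).
Qed.

Lemma tperm_neq1 : tperm ord0 ord_max != 1%g :> 'S_2.
Proof. by apply/eqP => /permP/(_ ord0); rewrite tpermL perm1. Qed.

Lemma sum_S2 (P : pred 'S_2) (F : 'S_2 -> V) :
  \sum_(s | P s) F s = (if P 1%g then F 1%g else 0)
    + (if P (tperm ord0 ord_max) then F (tperm ord0 ord_max) else 0).
Proof.
rewrite big_mkcond (bigD1 1%g) //= (bigD1 (tperm ord0 ord_max)) ?tperm_neq1 //=.
by rewrite big1 ?addr0 // => s; case: (S2P s) => ->; rewrite eqxx ?andbF.
Qed.

Lemma koszul2 (s : 'S_2) xs : koszul s xs =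
  (-1) ^+ [&& (s ord_max < s ord0)%N, odd_at xs (s ord0) & odd_at xs (s ord_max)].
Proof.
rewrite /koszul; congr (_ ^+ _).
rewrite -sum1_card big_mkcond /= (bigD1 (ord0, ord_max)) //= big1 ?addn0.
  by rewrite inE /=; case: ifP.
move=> [a b] /=; rewrite xpair_eqE inE /=.
by case: (I2P a) => ->; case: (I2P b) => ->.
Qed.

Lemma permute2 (s : 'S_2) xs :
  permute s xs = [:: nth (0, 0) xs (s ord0); nth (0, 0) xs (s ord_max)].
Proof. by rewrite /permute enum_I2. Qed.

Lemma unshuffle11 (s : 'S_2) : @unshuffle 1 1 s.
Proof.
apply/forallP => i; apply/forallP => j; apply/implyP => /andP[].
by case: (I2P i) => ->; case: (I2P j) => ->.
Qed.

Lemma unshuffle20 : @unshuffle 2 0 (1%g : 'S_2).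
Proof.
apply/forallP => i; apply/forallP => j; apply/implyP => /andP[ij _].
by rewrite !perm1.
Qed.

Lemma unshuffle20N : @unshuffle 2 0 (tperm ord0 ord_max : 'S_2) = false.
Proof.
apply/negP => /forallP/(_ ord0)/forallP/(_ ord_max)/implyP.
by rewrite tpermL tpermR => /(_ isT).
Qed.

Lemma insertion_1_2 d1 f1 d2 f2 x y :
  insertion (VForm 1 d1 f1) (VForm 2 d2 f2) [:: x; y] =
    f2 [:: (d1 + x.1, f1 [:: x]); y]
    + f2 [:: (d1 + y.1, f1 [:: y]); x] *~ (-1) ^+ (odd `|x.1|%N && odd `|y.1|%N).
Proof.
apply: etrans (sum_S2 _ _) _; rewrite !unshuffle11 !permute2 !koszul2.
rewrite !perm1 tpermL tpermR /= !big_cons !big_nil !addr0 mulr1z; congr (_ + _).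
by rewrite /odd_at /= andbC.
Qed.

Lemma insertion_2_1 d1 f1 d2 f2 x y :
  insertion (VForm 2 d1 f1) (VForm 1 d2 f2) [:: x; y] =
    f2 [:: (d1 + (x.1 + y.1), f1 [:: x; y])].
Proof.
apply: etrans (sum_S2 _ _) _; rewrite unshuffle20 unshuffle20N addr0 permute2 koszul2.
by rewrite !perm1 /= !big_cons !big_nil !addr0 mulr1z.
Qed.

Lemma S1P (s : 'S_1) : s = 1%g.
Proof. by apply/permP => i; rewrite (ord1 (s i)) (ord1 (_ i)). Qed.

Lemma permute1 (s : 'S_1) x : permute s [:: x] = [:: x].
Proof. by rewrite /permute enum_ordSl enum_ord0 /= (ord1 (s _)). Qed.

Lemma koszul1 (s : 'S_1) xs : koszul s xs = 1.
Proof.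
rewrite /koszul eq_card0 ?expr0 // => -[a b]; rewrite inE /=.
by rewrite (ord1 a) (ord1 b).
Qed.

Lemma insertion_1_1 d1 f1 d2 f2 x :
  insertion (VForm 1 d1 f1) (VForm 1 d2 f2) [:: x] = f2 [:: (d1 + x.1, f1 [:: x])].
Proof.
have us (s : 'S_1) : @unshuffle 1 0 s.
  by apply/forallP => i; apply/forallP => j; rewrite (ord1 i) (ord1 j).
have e : insertion (VForm 1 d1 f1) (VForm 1 d2 f2) [:: x] =
    \sum_(s : 'S_1 | @unshuffle 1 0 s) f2 [:: (d1 + x.1, f1 [:: x])].
  apply: eq_bigr => s _; rewrite permute1 koszul1 mulr1z /=.
  by rewrite big_cons big_nil addr0.
rewrite e (bigD1 1%g) ?us //= big1 ?addr0 // => s.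
by rewrite (S1P s) eqxx andbF.
Qed.

End SmallUnshuffles.

(** * Linearity over constants *)
Section ScalarLinearity.
Variables (K : comNzRingType) (n r : nat) (J : bideriv K n) (c : K).
Hypothesis c_reg : reg J c.
Hypothesis c_dm : forall k, dm J k c = 0.
Hypothesis c_dp : forall k, dp J k c = 0.
Local Notation G := (grass K (r + r)).
Implicit Types (u v : G) (N : G -> G).

Let gscal_reg : greg J (gscal c : G).
Proof. by move=> A; rewrite ffunE; case: ifP => // _; apply: reg0. Qed.

Let gscal_dm k : gdm J k (gscal c : G) = 0.
Proof. by apply/ffunP=> A; rewrite coef_grass0 !ffunE; case: ifP; rewrite ?dm0. Qed.

Let gscal_dp k : gdp J k (gscal c : G) = 0.
Proof. by apply/ffunP=> A; rewrite coef_grass0 !ffunE; case: ifP; rewrite ?dp0. Qed.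

Lemma bra_scalr u v : greg J v -> bra J u (gscal c * v) = gscal c * bra J u v.
Proof.
move=> rv; rewrite !bra_def mulrDr !mulr_sumr; congr (_ + _); apply: eq_bigr => i _.
  rewrite gdpM // gdmM gscal_dm gscal_dp !mul0r !add0r mulrBr.
  by rewrite ![gscal c * (_ * _)]mulrA ![gscal c * gdm _ _ u]gscalC
     ![gscal c * gdp _ _ u]gscalC !mulrA.
by rewrite gldv_scalM !mulrA -gscalC.
Qed.

Lemma bra_scall u v : greg J u -> bra J (gscal c * u) v = gscal c * bra J u v.
Proof.
move=> ru; rewrite !bra_def mulrDr !mulr_sumr; congr (_ + _); apply: eq_bigr => i _.
  by rewrite gdpM // gdmM gscal_dm gscal_dp !mul0r !add0r mulrBr !mulrA.
by rewrite gldv_scalM ginvM ginv_scal mulrA.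
Qed.

End ScalarLinearity.

Section GunderLinearity.
Variables (K : comNzRingType) (r : nat).
Local Notation G := (grass K (r + r)).
Implicit Types (u v : G) (N : G -> G).

Lemma gunderD N u v : gunder N (u + v) = gunder N u + gunder N v.
Proof. by rewrite /gunder -big_split; apply: eq_bigr => a _ /=; rewrite gldvD gmulDr. Qed.

Lemma gunder0 N : gunder N 0 = 0.
Proof. by rewrite /gunder big1 // => a _; rewrite gldv0 gmul0r. Qed.

Lemma gunder_scalM N c u : gunder N (gscal c * u) = gscal c * gunder N u.
Proof.
rewrite /gunder mulr_sumr; apply: eq_bigr => a _.
by rewrite gldv_scalM !gmulP !mulrA -gscalC.
Qed.

End GunderLinearity.

Section SuperfunScale.
Variables (R : realType) (n r : nat) (A : vbundle R n r).
Local Notation K := (mpoly n ('rV[R]_n -> R)).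
Implicit Types (P Q : superfun A) (F : Defs.sfun R n r) (a b : R).

Lemma mpolyC_cstD a b : mpolyC n (cst (a + b) : 'rV[R]_n -> R)
  = mpolyC n (cst a) + mpolyC n (cst b).
Proof. exact: mpolyCD. Qed.

Lemma mpolyC_cstM a b : mpolyC n (cst (a * b) : 'rV[R]_n -> R)
  = mpolyC n (cst a) * mpolyC n (cst b).
Proof. exact: mpolyCM. Qed.

Lemma scale_addl a b P : scale (a + b) P = scale a P + scale b P.
Proof.
apply/funext => i; apply: etrans (mulrDl (gscal (mpolyC n (cst a))) (gscal (mpolyC n
  (cst b))) (P i)).
apply: (congr1 (fun z : grass K (r + r) => z * P i)).
exact: (etrans (congr1 (@gscal K (r + r)) (mpolyC_cstD a b)) (gscalD _ _ _)).
Qed.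

Lemma scale_comp a b P : scale a (scale b P) = scale (a * b) P.
Proof.
apply/funext => i; apply: etrans (mulrA (gscal (mpolyC n (cst a))) (gscal (mpolyC n (cst
  b))) (P i)) _.
apply: (congr1 (fun z : grass K (r + r) => z * P i)).
exact: (esym (etrans (congr1 (@gscal K (r + r)) (mpolyC_cstM a b)) (gscalMM _ _ _))).
Qed.

Lemma sscale_addr a (F H : Defs.sfun R n r) : sscale a (F + H) = sscale a F + sscale a H.
Proof. exact: gmulDr. Qed.

Lemma scale_addr a P Q : scale a (P + Q) = scale a P + scale a Q.
Proof. by apply/funext => i; exact: sscale_addr. Qed.

Lemma scale1 P : scale 1 P = P.
Proof. by apply/funext => i; exact: (gmul1l (P i)). Qed.

Lemma scale0 P : scale 0 P = 0.
Proof.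
have := scale_addl 0 0 P; rewrite addr0 => /eqP.
by rewrite -subr_eq0 opprD addrA subrr sub0r oppr_eq0 => /eqP.
Qed.

Lemma scale_opp a P : scale (- a) P = - scale a P.
Proof. by apply/eqP; rewrite -addr_eq0 -scale_addl addNr scale0. Qed.

Lemma scale_zero a : scale a (0 : superfun A) = 0.
Proof. by rewrite -{1}(scale0 0) scale_comp mulr0 scale0. Qed.

Lemma scale_oppr a P : scale a (- P) = - scale a P.
Proof. by apply/eqP; rewrite -addr_eq0 -scale_addr addNr scale_zero. Qed.

Lemma scale_int (z : int) P : P *~ z = scale z%:~R P.
Proof.
have nat_case m : P *+ m = scale m%:R P.
  elim: m => [|m IH]; first by rewrite mulr0n scale0.
  by rewrite mulrS IH -[m.+1]add1n natrD scale_addl scale1.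
case: z => m; first exact: nat_case.
by rewrite NegzE !mulrNz scale_opp -!pmulrn; congr (- _); apply: nat_case.
Qed.

Lemma scale_mulrz a (z : int) P : scale a (P *~ z) = scale a P *~ z.
Proof. by rewrite (scale_int z P) (scale_int z (scale a P)) !scale_comp mulrC. Qed.

End SuperfunScale.

(** * Multivector fields and the operator of N *)
Section SectionSpaces.
Local Open Scope classical_set_scope.
Variables (R : realType) (n r : nat) (A : vbundle R n r).
Implicit Types (P Q F : superfun A).
Local Notation J i := (chart_jets (@cdom_open R n r A i)).
Local Notation L0 := ('rV[R]_n -> R).

Lemma eval_obra x (F H : Defs.sfun R n r) :
  eval_at x (obra F H) = obra (eval_at x F) (eval_at x H).
Proof.
pose ev : L0 -> R := fun f => f x.
have h0 := @map_mpoly_zero _ _ ev erefl n.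
have hD := @map_mpoly_add _ _ ev erefl (fun _ _ => erefl) n.
have hM := @map_mpoly_mul _ _ ev erefl (fun _ _ => erefl) (fun _ _ => erefl) n.
exact: (gmap_obra h0 hD hM F H).
Qed.

Lemma eval_momfree i (F : Defs.sfun R n r) x : momfree (J i) F ->
  forall B m, mcoeff m (eval_at x F B) != 0 -> m = mnm0.
Proof.
move=> mF B m nz; apply: (coef_momfree (J := J i) (fun k p => erefl) (@fct_char0 R n) mF
  (A := B)).
apply: contraNneq nz => e; rewrite eval_at_coef mcoeff_map_poly0 // e.
exact/eqP.
Qed.

Definition compatible F := forall i j b, Defs.dom i b -> Defs.dom j b ->
  eval_at (chart j b) (F j) =
    subst (@new_mom R n r A i j b) (@new_odd R n r A i j b) (eval_at (chart i b) (F i)).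

Lemma subst_chart i j b (F : Defs.sfun R n r) : momfree (J i) F ->
  subst (@new_mom R n r A i j b) (@new_odd R n r A i j b) (eval_at (chart i b) F)
  = gmorph (jac i j b) (eval_at (chart i b) F).
Proof.
move=> mF; apply: subst_gmorph; first exact: new_odd_lin.
exact: eval_momfree mF.
Qed.

(** Substitution is an algebra morphism preserving the pairing of the generators,
    hence it preserves the bracket of elements free of momenta. *)
Lemma compatible_obra (F H : superfun A) :
  (forall i, momfree (J i) (F i)) -> (forall i, momfree (J i) (H i)) ->
  compatible F -> compatible H -> compatible (fun i => obra (F i) (H i)).
Proof.
move=> mF mH cF cH i j b bi bj.
rewrite (@subst_chart i); last first.
  by rewrite -(obra_bra (mF i) (mH i)); apply: momfree_bra.
rewrite !eval_obra (cF i j b bi bj) (cH i j b bi bj) !subst_chart //.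
by rewrite gmorph_obra //; apply: jac_symplectic.
Qed.

Lemma in_F_intro k F : (forall i, bihom (J i) k 0 (F i)) -> compatible F -> in_F k 0 F.
Proof.
move=> hF cF; split=> // i; have [rF mF dF] := hF i; split.
- exact: (bihom_weights (J := J i) (fun k p => erefl) (@fct_char0 R n) (hF i)).
- by move=> B m; apply: (greg_smooth (U_open := @cdom_open R n r A i)).
by move=> x Ux; apply: (eval_at_greg (U_open := @cdom_open R n r A i) rF).
Qed.

Lemma in_F_section k F i : in_F k 0 F -> bihom (J i) k 0 (F i).
Proof. by apply: in_F_bihom; right. Qed.

Lemma in_F_compatible k l F : in_F k l F -> compatible F.
Proof. by case. Qed.

Lemma in_F_scale k c P : in_F k 0 P -> in_F k 0 (scale c P).
Proof.
move=> hP; have hs i : bihom (J i) k 0 (scale c P i).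
  have [rP mP dP] := in_F_section i hP.
  have -> : scale c P i = gscal (cutoff (@cdom R n r A i) c) * P i by exact: (sscaleE c rP).
  have c_reg := cutoff_reg (@cdom_open R n r A i) c.
  have c_dm := cutoff_dm (@cdom_open R n r A i) c.
  split.
  - apply: gregM => // B; rewrite ffunE; case: ifP => _; [exact: c_reg | exact: reg0].
  - move=> k'; rewrite gdmM mP mulr0 addr0.
    have -> : gdm (J i) k' (gscal (cutoff (@cdom R n r A i) c) : Defs.sfun R n r) = 0.
      by apply/ffunP=> B; rewrite coef_grass0 !ffunE; case: ifP => // _; apply: dm0.
    exact: mul0r.
  exact: gdeg_scal.
apply: (in_F_intro hs) => i j b bi bj.
have ev i' x : eval_at x (scale c P i') = gscal (mpolyC n c) * eval_at x (P i').
  apply/ffunP=> B; apply: etrans (eval_at_coef _ _ _) _.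
  apply: etrans (esym (coef_gscalM (mpolyC n c) (eval_at x (P i')) B)).
  apply: etrans (esym (congr1 ( *%R (mpolyC n c)) (eval_at_coef x (P i') B))).
  have -> : scale c P i' B = mpolyC n (cst c) * P i' B by exact: coef_gscalM.
  apply/mpolyP => m; rewrite mcoeff_map_poly0 // [in RHS]mcoeffCM mcoeff_map_poly0 //.
  have -> : mcoeff m (mpolyC n (cst c : L0) * P i' B)
    = cst c * mcoeff m (P i' B) by exact: mcoeffCM.
  by [].
have [_ mP _] := in_F_section i hP.
rewrite !ev (in_F_compatible hP bi bj) (subst_chart _ _ mP).
rewrite -gmorphZ -ev; apply/esym/subst_chart.
by have [_ ms _] := hs i.
Qed.

Lemma in_F0 k : in_F k 0 (0 : superfun A).
Proof.
have h0 i : bihom (J i) k 0 ((0 : superfun A) i).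
  by split=> [|x|]; [apply: greg0 | apply: gdm0 | apply: gdeg0].
have e0 i x : eval_at x ((0 : superfun A) i) = 0.
  apply/ffunP=> B; rewrite coef_grass0; apply: etrans (eval_at_coef _ _ _) _.
  have -> : (0 : superfun A) i B = 0 by exact: coef_grass0.
  by apply/mpolyP => m; rewrite mcoeff_map_poly0 // !mcoeff0.
apply: (in_F_intro h0) => i j b bi bj.
have [_ m0 _] := h0 i; rewrite (subst_chart _ _ m0) !e0.
by rewrite gmorph0.
Qed.

(** Only the parity of the degree enters the Koszul signs.  In degrees below -2,
    where the graded space is zero, any bidegree of the right parity will do. *)
Lemma in_L_F d P : in_L d P -> exists2 k, in_F k 0 P & odd k = odd `|d|%N.
Proof.
rewrite /in_L; case E: (d + 2) => [k|k] hP.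
  by exists k => //; move: E; case: d => m; lia.
exists (odd `|d|%N : nat); first by rewrite hP; apply: in_F0.
by rewrite oddb.
Qed.

Lemma in_L_scale d c P : in_L d P -> in_L d (scale c P).
Proof.
rewrite /in_L; case: (d + 2) => [k|k]; first exact: in_F_scale.
move=> ->; apply/funext => i.
by apply: etrans (gmul0r _) _.
Qed.

Section NijenhuisOperator.
Variables (pi omega : superfun A).
Hypothesis pi_F : in_F 2 0 pi.
Hypothesis omega_F : in_F 0 2 omega.
Local Notation bra i := (@bra _ n r (J i)).
Local Notation h i := (bra i (pi i) (omega i)).

Definition nij P : superfun A := fun i => gunder (Nmap pi omega i) (P i).

Let pi_bihom i : bihom (J i) 2 0 (pi i) := in_F_bihom i (or_intror erefl) pi_F.
Let omega_bihom i : bihom (J i) 0 2 (omega i) := in_F_bihom i (or_introl erefl) omega_F.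
Let h_chart i : bihom (J i) 1 1 (h i) := h_bihom (pi_bihom i) (omega_bihom i).

Lemma nij_section_like P i : section_like (J i) (P i) -> nij P i = bra i (h i) (P i).
Proof. exact: (gunder_bra (pi_bihom i) (omega_bihom i)). Qed.

Lemma nij_section k P i : in_F k 0 P -> nij P i = bra i (h i) (P i).
Proof. by move=> hP; apply: nij_section_like; apply: bihom_section_like (in_F_section i
  hP). Qed.

(** The formula for the operator refers to a frame.  Its independence of the chart
    comes from writing it as iterated brackets of [pi], [omega] and [P]. *)
Lemma in_F_nij k P : in_F k 0 P -> in_F k 0 (nij P).
Proof.
move=> hP; apply: in_F_intro => [i|].
  rewrite (nij_section i hP).
  exact: (bihom_bra (h_chart i) (in_F_section i hP) erefl erefl).
have mpi i : momfree (J i) (pi i) by have [_] := pi_bihom i.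
have mom i : momfree (J i) (omega i) by have [_] := omega_bihom i.
have mP i : momfree (J i) (P i) by have [_] := in_F_section i hP.
have mo i : momfree (J i) (obra (pi i) (omega i)).
  by rewrite -(obra_bra (mpi i) (mom i)); have [_] := h_chart i.
have -> : nij P = fun i => obra (obra (pi i) (omega i)) (P i).
  apply/funext => i; rewrite (nij_section i hP) (obra_bra (mpi i) (mom i)).
  exact: obra_bra.
apply: compatible_obra => //; last exact: in_F_compatible hP.
apply: compatible_obra => //; first exact: in_F_compatible pi_F.
exact: in_F_compatible omega_F.
Qed.

Lemma nijD P Q : nij (P + Q) = nij P + nij Q.
Proof. by apply/funext => i; apply: gunderD. Qed.

Lemma nij0 : nij 0 = 0.
Proof. by apply/funext => i; apply: gunder0. Qed.

Lemma nij_scale c P : nij (scale c P) = scale c (nij P).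
Proof. by apply/funext => i; exact: gunder_scalM. Qed.

Lemma in_L_nij d P : in_L d P -> in_L d (nij P).
Proof.
rewrite /in_L; case: (d + 2) => [k|k]; first exact: in_F_nij.
by move=> ->; apply: nij0.
Qed.

Definition derived (mu P Q : superfun A) : superfun A := bracket (bracket mu P) Q.

Definition smooth_sf (mu : superfun A) := forall i, greg (J i) (mu i).

Lemma derivedE mu P Q p q i : smooth_sf mu -> in_F p 0 P -> in_F q 0 Q ->
  derived mu P Q i = bra i (bra i (mu i) (P i)) (Q i).
Proof.
move=> rmu hP hQ; have rP := in_F_greg i hP; have rQ := in_F_greg i hQ.
rewrite /derived /bracket (lbracket_bra (rmu i) rP).
by rewrite (lbracket_bra (greg_bra (rmu i) rP) rQ).
Qed.

Lemma superfun_sign (F : superfun A) (s : bool) i :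
  (F *~ (-1) ^+ s) i = (-1) ^+ s * F i.
Proof.
case: s; last by rewrite expr0 mulr1z; apply/esym/mul1r.
by rewrite expr1 mulrN1z; apply/esym/mulN1r.
Qed.

Lemma derivedC mu P Q p q : smooth_sf mu -> in_F p 0 P -> in_F q 0 Q ->
  derived mu P Q = derived mu Q P *~ (-1) ^+ (odd p && odd q).
Proof.
move=> rmu hP hQ; apply/funext => i.
have [rP mP dP] := in_F_section i hP; have [rQ mQ dQ] := in_F_section i hQ.
have [_ xP] := bihom_section_like (in_F_section i hP);
  have [_ xQ] := bihom_section_like (in_F_section i hQ).
have pP : gpar (odd p) (P i) by have := gdeg_gpar dP; rewrite addn0.
have pQ : gpar (odd q) (Q i) by have := gdeg_gpar dQ; rewrite addn0.
rewrite (derivedE i rmu hP hQ) (derived_sym (mu i) rP rQ pP pQ mP mQ xP xQ).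
rewrite -(derivedE i rmu hQ hP).
exact/esym/superfun_sign.
Qed.

Lemma derived_scalel c mu P Q p q : smooth_sf mu -> in_F p 0 P -> in_F q 0 Q ->
  derived mu (scale c P) Q = scale c (derived mu P Q).
Proof.
move=> rmu hP hQ; apply/funext => i.
have rP := in_F_greg i hP; have rQ := in_F_greg i hQ.
have c_reg := cutoff_reg (@cdom_open R n r A i) c.
have c_dm := cutoff_dm (@cdom_open R n r A i) c.
have c_dp := cutoff_dp (@cdom_open R n r A i) c.
have rb := greg_bra (rmu i) rP.
apply: etrans (derivedE i rmu (in_F_scale c hP) hQ) _.
have e1 : scale c P i = gscal (cutoff (@cdom R n r A i) c) * P i by exact: (sscaleE c rP).
rewrite e1 (bra_scalr c_reg c_dm c_dp _ rP) (bra_scall c_reg c_dm c_dp _ rb).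
have rd : greg (J i) (derived mu P Q i) by rewrite (derivedE i rmu hP hQ); apply: greg_bra.
by rewrite -(derivedE i rmu hP hQ); exact: (esym (sscaleE c rd)).
Qed.

Definition ad_h (mu : superfun A) : superfun A := fun i => bra i (h i) (mu i).

Lemma smooth_ad_h mu : smooth_sf mu -> smooth_sf (ad_h mu).
Proof. by move=> rmu i; have [rh _ _] := h_chart i; apply: greg_bra. Qed.

(** The operator of N agrees with the action of [h] only on elements free of momenta
    and xi, so that its value on a derived bracket is known under this
    condition. *)
Definition preserves_sections mu := forall p q P Q i, in_F p 0 P -> in_F q 0 Q ->
  section_like (J i) (derived mu P Q i).

(** The bracket of N with the derived bracket of [mu], as vector-valued forms, is
    minus the derived bracket of [ad_h mu]. *)
Lemma nij_derived mu P Q p q : smooth_sf mu -> preserves_sections mu ->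
  in_F p 0 P -> in_F q 0 Q ->
  derived mu (nij P) Q + derived mu (nij Q) P *~ (-1) ^+ (odd p && odd q)
    - nij (derived mu P Q) = - derived (ad_h mu) P Q.
Proof.
move=> rmu smu hP hQ; apply/funext => i.
have hjP := in_F_nij hP; have hjQ := in_F_nij hQ.
have e1 : derived mu (nij P) Q i = bra i (bra i (mu i) (bra i (h i) (P i))) (Q i).
  by rewrite (derivedE i rmu hjP hQ) (nij_section i hP); exact: erefl.
have e2 : derived mu (nij Q) P i = bra i (bra i (mu i) (bra i (h i) (Q i))) (P i).
  by rewrite (derivedE i rmu hjQ hP) (nij_section i hQ); exact: erefl.
have e3 : nij (derived mu P Q) i = bra i (h i) (bra i (bra i (mu i) (P i)) (Q i)).
  rewrite (nij_section_like (smu _ _ _ _ i hP hQ)) (derivedE i rmu hP hQ); exact: erefl.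
have e4 : derived (ad_h mu) P Q i = bra i (bra i (bra i (h i) (mu i)) (P i)) (Q i).
  exact: (derivedE i (smooth_ad_h rmu) hP hQ).
have E := derived_vbracket (h_chart i) (rmu i) (in_F_section i hP) (in_F_section i hQ).
apply: etrans (etrans _ E) (esym (congr1 -%R e4)).
pose s := odd p && odd q.
apply: etrans (congr1 (fun z => derived mu (nij P) Q i + z - nij (derived mu P Q) i)
  (superfun_sign (derived mu (nij Q) P) s i)) _.
exact: (f_equal3 (fun x y z : grass (mpoly n L0) (r + r) => x + (-1) ^+ s * y - z) e1 e2
  e3).
Qed.

(** By [nij_derived] the derived bracket of [ad_h mu] is a combination of values of
    the derived bracket of [mu] and of the operator of N, each of which stays
    among the sections. *)
Lemma preserves_sections_ad_h mu : smooth_sf mu -> preserves_sections mu ->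
  preserves_sections (ad_h mu).
Proof.
move=> rmu smu p q P Q i hP hQ.
have hjP := in_F_nij hP; have hjQ := in_F_nij hQ.
rewrite -[derived _ _ _]opprK -(nij_derived rmu smu hP hQ).
apply: section_likeN; apply: section_likeD; first apply: section_likeD.
- exact: smu hjP hQ.
- case: (odd p && odd q); first by rewrite expr1 mulrN1z;
  apply/section_likeN/(smu _ _ _ _ i hjQ hP).
  by rewrite expr0 mulr1z; apply: (smu _ _ _ _ i hjQ hP).
apply: section_likeN; rewrite (nij_section_like (smu _ _ _ _ i hP hQ)).
have sd := smu _ _ _ _ i hP hQ; have [_ mh dh] := h_chart i.
rewrite (bra_even_section mh sd); apply: (section_after_sum (m := 0)) => c _.
apply: (section_after_mul (m := 0)); last exact: section_like_gldv.
apply: (section_after_ginv (m := 0)); split=> [k|c']; first by rewrite gdm_gldv mh gldv0.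
apply: (gdeg_gldv0 (k := 1) (l := 0)); last by rewrite isxi_lshift orbT.
by apply: gdeg_gldv; rewrite isth_lshift isxi_lshift.
Qed.

End NijenhuisOperator.
End SectionSpaces.

(** * The Nijenhuis property *)
Section MainComputation.
Local Open Scope classical_set_scope.
Variables (R : realType) (n r : nat) (A : vbundle R n r).
Variables (mu pi omega : superfun A) (lambda : R).
Hypothesis mu_F : in_F 1 2 mu.
Hypothesis pi_F : in_F 2 0 pi.
Hypothesis omega_F : in_F 0 2 omega.
Local Notation J i := (chart_jets (@cdom_open R n r A i)).
Local Notation nij := (nij pi omega).
Local Notation ad_h := (ad_h pi omega).
Local Notation L := (@in_L R n r A).
Implicit Types (P Q : superfun A) (x y : int * superfun A) (nu : superfun A).

Lemma smooth_mu : smooth_sf mu.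
Proof. by move=> i; apply: in_F_greg mu_F. Qed.

(** The structure element has degree two in the momenta and xi, and a derived
    bracket consumes both. *)
Lemma preserves_sections_mu : preserves_sections mu.
Proof.
move=> p q P Q i hP hQ; rewrite (derivedE i smooth_mu hP hQ).
have rP := in_F_greg i hP; have rQ := in_F_greg i hQ.
have sP := bihom_section_like (in_F_section i hP);
  have sQ := bihom_section_like (in_F_section i hQ).
have o2 : section_after (J i) 2 (mu i).
  apply: xi_weight_section_after => // B m nz.
  by have [] := in_F_weights mu_F nz.
exact: section_after_bra rQ (section_after_bra rP o2 sP) sQ.
Qed.

Local Notation nform := (underline (Nmap pi omega)).

Lemma derived_scale c nu P Q p q : smooth_sf nu -> in_F p 0 P -> in_F q 0 Q ->
  derived (scale c nu) P Q = scale c (derived nu P Q).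
Proof.
move=> rnu hP hQ; apply/funext => i.
have rP := in_F_greg i hP; have rQ := in_F_greg i hQ.
have c_reg := cutoff_reg (@cdom_open R n r A i) c.
have c_dm := cutoff_dm (@cdom_open R n r A i) c.
have c_dp := cutoff_dp (@cdom_open R n r A i) c.
have rs : smooth_sf (scale c nu).
  move=> i'; have -> : scale c nu i' = gscal (cutoff (@cdom R n r A i') c) * nu i'.
    exact: (sscaleE c (rnu i')).
  apply: gregM => // B; rewrite ffunE; case: ifP => _; last exact: reg0.
  exact: (cutoff_reg (@cdom_open R n r A i') c).
apply: etrans (derivedE i rs hP hQ) _.
have e1 : scale c nu i = gscal (cutoff (@cdom R n r A i) c) * nu i by exact: (sscaleE c
  (rnu i)).
rewrite e1 (bra_scall c_reg c_dm c_dp _ (rnu i)).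
rewrite (bra_scall c_reg c_dm c_dp _ (greg_bra (rnu i) rP)).
have rd : greg (J i) (derived nu P Q i).
  by rewrite (derivedE i rnu hP hQ); apply: greg_bra rQ; apply: greg_bra rP; apply: rnu.
by rewrite -(derivedE i rnu hP hQ); exact: (esym (sscaleE c rd)).
Qed.

Lemma vbracket_1_2 d1 f1 d2 f2 x y : d1 = 0 ->
  vbracket (VForm 1 d1 f1) (VForm 2 d2 f2) [:: x; y] =
    f2 [:: (d1 + x.1, f1 [:: x]); y]
    + f2 [:: (d1 + y.1, f1 [:: y]); x] *~ (-1) ^+ (odd `|x.1|%N && odd `|y.1|%N)
    - f1 [:: (d2 + (x.1 + y.1), f2 [:: x; y])].
Proof.
move=> d0.
apply: etrans (f_equal2 (fun u v => u - v *~ (-1) ^+ absz (d1 * d2))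
  (insertion_1_2 _ _ _ _ _ _) (insertion_2_1 _ _ _ _ _ _)) _.
by rewrite d0 mul0r expr0 mulr1z.
Qed.

Lemma vbracket_1_1 d1 f1 d2 f2 x : d1 = 0 ->
  vbracket (VForm 1 d1 f1) (VForm 1 d2 f2) [:: x] =
    f2 [:: (d1 + x.1, f1 [:: x])] - f1 [:: (d2 + x.1, f2 [:: x])] :> superfun A.
Proof.
move=> d0.
apply: etrans (f_equal2 (fun u v => u - v *~ (-1) ^+ absz (d1 * d2))
  (insertion_1_1 _ _ _ _ _) (insertion_1_1 _ _ _ _ _)) _.
by rewrite d0 mul0r expr0 mulr1z.
Qed.

(** Stated for any multiple of a derived bracket so that it applies twice, first to
    the binary bracket itself and then to the result. *)
Lemma nform_derived (l : vform (superfun A)) d c nu x y p q :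
  smooth_sf nu -> preserves_sections nu ->
  (forall x y p q, in_F p 0 x.2 -> in_F q 0 y.2 -> odd p = odd `|x.1|%N ->
     odd q = odd `|y.1|%N -> l [:: x; y] = scale c (derived nu x.2 y.2)) ->
  arity l = 2 -> degree l = d ->
  in_F p 0 x.2 -> in_F q 0 y.2 -> odd p = odd `|x.1|%N -> odd q = odd `|y.1|%N ->
  vbracket nform l [:: x; y] = scale (- c) (derived (ad_h nu) x.2 y.2).
Proof.
case: l => [a d' f] rnu snu hl /= al _ hx hy px py.
rewrite al in hl *; apply: etrans (vbracket_1_2 _ _ _ _ _ erefl) _ => /=.
have hjx := in_F_nij pi_F omega_F hx; have hjy := in_F_nij pi_F omega_F hy.
have E := nij_derived pi_F omega_F rnu snu hx hy.
have e1 := hl (0 + x.1, nij x.2) y p q hjx hy.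
have e2 := hl (0 + y.1, nij y.2) x q p hjy hx.
have e3 := hl x y p q hx hy px py.
rewrite /= !add0r in e1 e2 e3 *.
apply: etrans (f_equal3 (fun u v w => u + v *~ (-1) ^+ (odd `|x.1|%N && odd `|y.1|%N) -
  nij w)
  (e1 px py) (e2 py px) e3) _.
rewrite nij_scale -px -py.
rewrite -(scale_mulrz c _ (derived nu (nij y.2) x.2)).
by rewrite -scale_oppr -!scale_addr E scale_opp scale_oppr.
Qed.

Lemma ad_h_square : bracket mu omega = 0 -> bracket mu (omegaN pi omega) = 0 ->
  schouten mu pi pi = 0 -> square_scalar (Nmap pi omega) lambda ->
  ad_h (ad_h mu) = scale lambda mu.
Proof.
move=> closed closedN poi sq; apply/funext => i.
have pi_bihom := in_F_bihom i (or_intror erefl) pi_F.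
have omega_bihom := in_F_bihom i (or_introl erefl) omega_F.
exact: (h_square_chart pi_bihom omega_bihom mu_F closed closedN poi sq).
Qed.

Local Notation lform := (l2 mu).
Local Notation kform := (vscale (@scale R n r A) (- lambda) euler).

(** The binary bracket raises degrees by one, so the Euler map contributes the factor
    d + e - (1 + d + e) = -1 in degrees d and e. *)
Lemma kform_derived x y p q :
  in_F p 0 x.2 -> in_F q 0 y.2 -> odd p = odd `|x.1|%N -> odd q = odd `|y.1|%N ->
  vbracket kform lform [:: x; y] = scale lambda (derived mu x.2 y.2).
Proof.
move=> hx hy px py; case: x y hx hy px py => [d P] [e Q] /= hx hy px py.
apply: etrans (vbracket_1_2 _ _ _ _ _ erefl) _ => /=.
pose sg : int := (-1) ^+ (odd p && odd q).
have e1 : derived mu (scale (- lambda) (P *~ d)) Q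
  = scale (- lambda * d%:~R) (derived mu P Q).
  by rewrite (scale_int d P) scale_comp (derived_scalel _ smooth_mu hx hy).
have e2 : derived mu (scale (- lambda) (Q *~ e)) P *~ sg
  = scale (- lambda * e%:~R) (derived mu P Q).
  rewrite (scale_int e Q) scale_comp (derived_scalel _ smooth_mu hy hx) -scale_mulrz.
  by rewrite (derivedC smooth_mu hx hy).
have e3 : scale (- lambda) (derived mu P Q *~ (1 + (d + e)))
    = scale (- lambda * (1 + (d + e))%:~R) (derived mu P Q).
  rewrite (scale_int _ (derived mu P Q)) scale_comp; exact: erefl.
rewrite -px -py; apply: etrans (f_equal3 (fun u v w => u + v - w) e1 e2 e3) _.
rewrite -scale_opp -!scale_addl.
apply: (congr1 (fun z => scale z (derived mu P Q))).
by rewrite !intrD; ring.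
Qed.

End MainComputation.

Lemma size1_seq (T : Type) (s : seq T) : size s = 1%N -> exists x, s = [:: x].
Proof. by case: s => [|x [|]] // _; exists x. Qed.

Lemma size2_seq (T : Type) (s : seq T) : size s = 2%N -> exists x y, s = [:: x; y].
Proof. by case: s => [|x [|y [|]]] // _; exists x, y. Qed.

Theorem corollary5p15 (R : realType) (n r : nat) (A : vbundle R n r)
    (mu pi omega : superfun A) (lambda : R) :
  lie_algebroid mu ->
  poisson mu pi ->
  in_F 0 2 omega ->
  closed_form mu omega ->
  square_scalar (Nmap pi omega) lambda ->
  POmega mu pi omega ->
  nijenhuis (@scale R n r A) (@in_L R n r A)
    (l2 mu) (underline (Nmap pi omega)) (vscale (@scale R n r A) (- lambda) euler).
Proof.
move=> [mu_F _] [pi_F poi] omega_F closed sq [_ _ _ closedN].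
split.
- split=> //; split.
  + case=> [|[d P] [|]] //= _ hP; rewrite big_seq1 add0r.
    by apply: in_L_nij => //; apply: (hP (d, P)); rewrite inE.
  + by case=> [|x [|]] // s _ _; rewrite permute1 koszul1 mulr1z.
  case=> [|? ?] [|? ?] d x y c //= _ _ _ _ _.
  apply: etrans (nijD pi omega (scale c x) y) _.
  by rewrite nij_scale.
- split=> //; split.
  + case=> [|[d P] [|]] //= _ hP; rewrite big_seq1 add0r (scale_int d P).
    by do 2!apply: in_L_scale; apply: (hP (d, P)); rewrite inE.
  + by case=> [|x [|]] // s _ _; rewrite permute1 koszul1 mulr1z.
  case=> [|? ?] [|? ?] d x y c //= _ _ _ _ _.
  rewrite (scale_int d (scale c x + y)) (scale_int d x) (scale_int d y).
  have e : - lambda * d%:~R * c = c * - lambda * d%:~R by ring.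
  rewrite !scale_addr !scale_comp e; exact: erefl.
- split; [exact: (erefl 2%N) | exact: (erefl (1 : int)) | move=> xs sz;
  have [x [y ->]] := size2_seq sz => hxy].
  have [p hx px] : exists2 p, in_F p 0 x.2 & odd p = odd `|x.1|%N.
    by apply: in_L_F; apply: hxy; rewrite inE eqxx.
  have [q hy py] : exists2 q, in_F q 0 y.2 & odd q = odd `|y.1|%N.
    by apply: in_L_F; apply: hxy; rewrite !inE eqxx orbT.
  (* Both sides equal lambda times the derived bracket of mu. *)
  apply: etrans (esym (kform_derived lambda mu_F hx hy px py)).
  have sm := smooth_mu mu_F; have sec := preserves_sections_mu mu_F.
  have first_bracket x1 y1 p1 q1 : in_F p1 0 x1.2 -> in_F q1 0 y1.2 ->
      odd p1 = odd `|x1.1|%N -> odd q1 = odd `|y1.1|%N ->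
      vbracket (underline (Nmap pi omega)) (l2 mu) [:: x1; y1]
        = scale (- 1) (derived (ad_h pi omega mu) x1.2 y1.2).
    move=> hx1 hy1 px1 py1.
    apply: (nform_derived pi_F omega_F sm sec (l := l2 mu) (d :=
      1) _ erefl erefl hx1 hy1 px1 py1).
    by move=> *; rewrite scale1.
  apply: etrans (nform_derived pi_F omega_F (smooth_ad_h pi_F omega_F sm)
    (preserves_sections_ad_h pi_F omega_F sm sec) first_bracket erefl erefl hx hy px py) _.
  rewrite opprK scale1 (ad_h_square mu_F pi_F omega_F closed closedN poi sq).
  exact: (derived_scale lambda sm hx hy).
move=> xs sz; have [[d P] ->] := size1_seq sz => hP.
have e1 : scale (- lambda) (nij pi omega P *~ (0 + d))
  = scale (- lambda * d%:~R) (nij pi omega P).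
  by rewrite add0r (scale_int d (nij pi omega P)) scale_comp.
have e2 : nij pi omega (scale (- lambda) (P *~ d))
  = scale (- lambda * d%:~R) (nij pi omega P).
  by rewrite (scale_int d P) scale_comp nij_scale.
apply: etrans (vbracket_1_1 _ _ _ _ erefl) _.
exact: etrans (f_equal2 (fun u v => u - v) e1 e2) (subrr _).
Qed.
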